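(* Let $F$ be a finite Orlicz function. Suppose that the mapping $t\mapsto F(t)t^{-2}$ is essentially decreasing on $[1,\infty)$. Then any complemented subsymmetric basic sequence in $L_F$ is equivalent to the unit vector system of $\ell_2$ or to the unit vector system of $\ell_G$ for some $G\in C_F$.
   Context: An Orlicz function is a convex non-decreasing function $F\colon[0,\infty)\to[0,\infty]$, not identically zero, with $F(0)=0$ and $F(c)<\infty$ for some $c>0$; it is finite if it never takes the value $\infty$. $L_F$ denotes the Orlicz space over $[0,1)$ with Lebesgue measure: measurable (real or complex) $f$ with $\|f\|=\inf\{t>0:\int_0^1F(|f|/t)\,dx\le 1\}<\infty$. For an Orlicz function $G$, $\ell_G$ is the Orlicz sequence space with norm $\|(a_n)\|=\inf\{t>0:\sum_nG(|a_n|/t)\le1\}$. A nonnegative function $h$ is essentially decreasing on $[1,\infty)$ if there is a constant $C$ with $h(t)\le Ch(s)$ for $1\le s\le t$. For finite $F$ and $s>0$ with $F(s)>0$ set $F_s(t)=F(st)/F(s)$, $t\ge0$. For $b\ge0$ let $C_{F,b}$ be the closure in $(\mathcal C([0,1/2]),\|\cdot\|_\infty)$ of the convex hull of $\{F_s: s>b\}$ (restricted to $[0,1/2]$), and $C_F=\bigcap_{b\ge0}C_{F,b}$. Each $G\in C_{F}$ is extended to an Orlicz function on $[0,\infty)$ by requiring it to be linear (affine) on $[1/2,\infty)$ with $G(1)=1$; so $\ell_G$ makes sense (if $G$ vanishes near zero, $\ell_G=\ell_\infty$). A basic sequence is a Schauder basis of its closed linear span; it is complemented if that span is the range of a bounded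 projection; unconditional if every rearrangement is a basic sequence, spreading if it is equivalent to each of its subsequences, subsymmetric if unconditional and spreading. Two sequences are equivalent if there is an isomorphism between their closed linear spans mapping one to the other termwise. *)

(* Defs.v *)
From HB Require Import structures.
From mathcomp Require Import all_boot all_order all_algebra.
From mathcomp Require Import generic_quotient ring_quotient.
From mathcomp Require Import all_classical all_reals all_analysis.
From mathcomp Require Import measurable_realfun.
From mathcomp Require Import complex.

Set Implicit Arguments.
Unset Strict Implicit.
Unset Printing Implicit Defensive.

Import Order.TTheory GRing.Theory Num.Theory.
Import numFieldNormedType.Exports.

Local Open Scope classical_set_scope.
Local Open Scope ring_scope.

Variant scalar_kind := RealScalars | ComplexScalars.

Definition scalar (R : realType) (k : scalar_kind) : numFieldType :=
  match k with RealScalars => R | ComplexScalars => R[i] end.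

Section scalar.
Context {R : realType} {k : scalar_kind}.
Implicit Types z w : scalar R k.

(* [sreal] embeds R into the scalars; [sre] and [sim] are the real and
   imaginary parts (sim = 0 over the reals) *)
Definition sreal : R -> scalar R k :=
  match k return R -> scalar R k with
  | RealScalars => id | ComplexScalars => real_complex R
  end.

Definition sre : scalar R k -> R :=
  match k return scalar R k -> R with
  | RealScalars => id | ComplexScalars => @complex.Re R
  end.

Definition sim : scalar R k -> R :=
  match k return scalar R k -> R with
  | RealScalars => fun=> 0 | ComplexScalars => @complex.Im R
  end.

Definition sabs z : R := sre `|z|.

Lemma sabsE z : `|z| = sreal (sabs z).
Proof.
rewrite /sabs /sre /sreal; case: k z => [z//|z].
by case: z => a b; rewrite normc_def.
Qed.

Lemma sreal_ge0 (r : R) : (0 <= sreal r) = (0 <= r).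
Proof. by rewrite /sreal; case: k => //; rewrite lecR. Qed.

Lemma sreal_le (r s : R) : (sreal r <= sreal s) = (r <= s).
Proof. by rewrite /sreal; case: k => //; rewrite lecR. Qed.

Lemma srealD (r s : R) : sreal (r + s) = sreal r + sreal s.
Proof. by rewrite /sreal; case: k => //; rewrite rmorphD. Qed.

Lemma srealM (r s : R) : sreal (r * s) = sreal r * sreal s.
Proof. by rewrite /sreal; case: k => //; rewrite rmorphM. Qed.

Lemma sreal0 : sreal 0 = 0.
Proof. by rewrite /sreal; case: k => //; rewrite rmorph0. Qed.

Lemma sreal_inj : injective sreal.
Proof. by move=> r s /eqP; rewrite eq_le !sreal_le -eq_le => /eqP. Qed.

Lemma sabs_ge0 z : 0 <= sabs z.
Proof. by rewrite -sreal_ge0 -sabsE. Qed.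

Lemma sabsM z w : sabs (z * w) = sabs z * sabs w.
Proof. by apply: sreal_inj; rewrite srealM -!sabsE normrM. Qed.

Lemma sabsD z w : sabs (z + w) <= sabs z + sabs w.
Proof. by rewrite -sreal_le srealD -!sabsE ler_normD. Qed.

Lemma sabs0 : sabs 0 = 0.
Proof. by apply: sreal_inj; rewrite -sabsE normr0 sreal0. Qed.

Lemma sabs1 : sabs 1 = 1.
Proof.
apply: sreal_inj; rewrite -sabsE normr1 /sreal.
by case: k => //; rewrite rmorph1.
Qed.

Lemma sabs_eq0 z : (sabs z == 0) = (z == 0).
Proof. by rewrite -[RHS]normr_eq0 sabsE -sreal0 (inj_eq sreal_inj). Qed.

Lemma sreD z w : sre (z + w) = sre z + sre w.
Proof. by rewrite /sre; case: k z w => //= -[? ?] [? ?]. Qed.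

Lemma simD z w : sim (z + w) = sim z + sim w.
Proof.
by rewrite /sim; case: k z w => //= [_ _|[? ?] [? ?]//]; rewrite addr0.
Qed.

Lemma sreM z w : sre (z * w) = sre z * sre w - sim z * sim w.
Proof.
rewrite /sre /sim; case: k z w => //= [z w|[? ?] [? ?]//].
by rewrite mulr0 subr0.
Qed.

Lemma simM z w : sim (z * w) = sre z * sim w + sim z * sre w.
Proof.
rewrite /sre /sim; case: k z w => //= [z w|[? ?] [? ?]//].
by rewrite mulr0 mul0r addr0.
Qed.

Lemma sabs_sqrt z : sabs z = Num.sqrt (sre z ^+ 2 + sim z ^+ 2).
Proof.
rewrite /sabs /sre /sim; case: k z => [z|[a b]].
  by rewrite expr0n/= addr0 sqrtr_sqr.
by rewrite normc_def.
Qed.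

End scalar.

(* A [0, +oo]-valued seminorm on a subspace [esn_dom] of E. [nspace] below is
   the normed space of the vectors of [esn_dom] of finite seminorm, modulo those
   of seminorm 0; as in normedModType, its norm has values in the scalars *)
Record eseminorm (R : realType) (k : scalar_kind) (E : lmodType (scalar R k)) :=
  ESeminorm {
    esn_dom : set E;
    esn :> E -> \bar R;
    esn_dom0 : esn_dom 0;
    esn_domD : forall x y, esn_dom x -> esn_dom y -> esn_dom (x + y);
    esn_domZ : forall a x, esn_dom x -> esn_dom (a *: x);
    esn_ge0 : forall x, (0 <= esn x)%E;
    esnD : forall x y, esn_dom x -> esn_dom y ->
      (esn (x + y) <= esn x + esn y)%E;
    esnZ : forall a x, esn_dom x -> esn (a *: x) = ((sabs a)%:E * esn x)%E
  }.

Section finite_part.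
Context {R : realType} {k : scalar_kind} {E : lmodType (scalar R k)}.
Variable p : eseminorm E.

Definition finite_part : {pred E} :=
  [pred x | `[< esn_dom p x >] && (p x < +oo)%E].

Lemma finite_partP x :
  reflect (esn_dom p x /\ (p x < +oo)%E) (x \in finite_part).
Proof.
by apply: (iffP andP) => -[d f]; split => //; apply/asboolP.
Qed.

Lemma finite_part_fin x : x \in finite_part -> p x \is a fin_num.
Proof. by move=> /finite_partP[_ ?]; rewrite ge0_fin_numE// esn_ge0. Qed.

Lemma esn0 : p 0 = 0%E.
Proof. by rewrite -(scale0r 0) esnZ ?sabs0 ?mul0e//; exact: esn_dom0. Qed.

Fact finite_part_submod : submod_closed finite_part.
Proof.
split; first by apply/finite_partP; rewrite esn0; split=> //; exact: esn_dom0.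
move=> a x y /[dup] xf /finite_partP[dx px] /finite_partP[dy py].
have dax := esn_domZ a dx.
apply/finite_partP; split; first exact: esn_domD.
rewrite (le_lt_trans (esnD dax dy))// esnZ// lte_add_pinfty//.
by rewrite -(fineK (finite_part_fin xf)) -EFinM ltry.
Qed.

HB.instance Definition _ :=
  GRing.isSubmodClosed.Build (scalar R k) E finite_part
    (GRing.submod_closed_semi finite_part_submod).

Definition finite_sub : Type := {x | x \in finite_part}.
HB.instance Definition _ := SubChoice.on finite_sub.
HB.instance Definition _ := [SubChoice_isSubLmodule of finite_sub by <:].

Definition null_part : {pred finite_sub} := [pred x | p (val x) == 0%E].

Fact null_part_zmod : zmod_closed null_part.
Proof.
split=> [|x y]; rewrite !inE; first by rewrite raddf0 esn0.
move=> /eqP px /eqP py.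
have [/finite_partP[dx _] /finite_partP[dy _]] := (valP x, valP y).
rewrite eq_le esn_ge0 andbT raddfB -scaleN1r.
rewrite (le_trans (esnD dx (esn_domZ _ dy)))// esnZ//.
by rewrite [X in (X + _)%E]px [X in (_ * X)%E]py mule0 adde0.
Qed.

HB.instance Definition _ :=
  GRing.isZmodClosed.Build finite_sub null_part null_part_zmod.

End finite_part.
Arguments null_part {R k E} p _.

Section normed_quotient.
Context {R : realType} {k : scalar_kind} {E : lmodType (scalar R k)}.
Variable p : eseminorm E.
Local Open Scope quotient_scope.

Definition nspace : Type := Quotient.quot (null_part p).

HB.instance Definition _ := GRing.Zmodule.on nspace.

HB.instance Definition _ := ZmodQuotient.on nspace.

Definition nscale (a : scalar R k) (u : nspace) : nspace :=
  \pi_nspace (a *: repr u).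


Let mem (x : finite_sub p) : esn_dom p (val x) /\ (p (val x) < +oo)%E.
Proof. exact/finite_partP/(valP x). Qed.

Let domB (x y : finite_sub p) : esn_dom p (val x - val y).
Proof.
by rewrite -scaleN1r; exact: esn_domD (mem x).1 (esn_domZ _ (mem y).1).
Qed.

Lemma pi_nspaceP (x y : finite_sub p) :
  p (val x - val y) = 0%E <-> \pi_nspace x = \pi_nspace y.
Proof.
split=> [/eqP xy|/eqP]; [apply/eqP|];
  by rewrite eqquotE Quotient.equivE inE raddfB// => /eqP.
Qed.

Lemma repr_nspace (x : finite_sub p) :
  p (val (repr (\pi_nspace x)) - val x) = 0%E.
Proof. by apply/pi_nspaceP; rewrite reprK. Qed.

Lemma esn_repr (x : finite_sub p) : p (val (repr (\pi_nspace x))) = p (val x).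
Proof.
have le (y z : finite_sub p) : p (val y - val z) = 0%E ->
    (p (val y) <= p (val z))%E.
  move=> yz; rewrite -(subrK (val z) (val y)).
  rewrite (le_trans (esnD (domB y z) (mem z).1))//.
  by rewrite [X in (X + _)%E]yz add0e.
have xr := repr_nspace x.
apply/eqP; rewrite eq_le !le//.
rewrite -opprB -scaleN1r esnZ; last exact: domB.
by rewrite [X in (_ * X)%E]xr mule0.
Qed.

Let valZ a (x : finite_sub p) : val (a *: x) = a *: val x.
Proof. exact: linearZ. Qed.

Lemma pi_nscale a (x : finite_sub p) :
  nscale a (\pi_nspace x) = \pi_nspace (a *: x).
Proof.
apply/pi_nspaceP; rewrite !valZ -scalerBr esnZ; last exact: domB.
by rewrite [X in (_ * X)%E]repr_nspace mule0.
Qed.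

Fact nscaleA a b u : nscale a (nscale b u) = nscale (a * b) u.
Proof. by elim/quotW: u => x; rewrite (pi_nscale b) !pi_nscale scalerA. Qed.

Fact nscale1 : left_id 1 nscale.
Proof. by move=> u; elim/quotW: u => x; rewrite !pi_nscale scale1r. Qed.

Fact nscaleDr : right_distributive nscale +%R.
Proof.
move=> a u v; elim/quotW: u => x; elim/quotW: v => y;
by rewrite -raddfD !pi_nscale scalerDr raddfD.
Qed.

Fact nscaleDl u : {morph nscale^~ u : a b / a + b}.
Proof.
by elim/quotW: u => x a b; rewrite !pi_nscale scalerDl raddfD.
Qed.

HB.instance Definition _ := GRing.Zmodule_isLmodule.Build (scalar R k) nspace
  nscaleA nscale1 nscaleDr nscaleDl.

Definition nnorm (u : nspace) : scalar R k := sreal (fine (p (val (repr u)))).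

Let fin (x : finite_sub p) : p (val x) \is a fin_num.
Proof. exact/finite_part_fin/(valP x). Qed.

Lemma nnorm_pi x : nnorm (\pi_nspace x) = sreal (fine (p (val x))).
Proof. by rewrite /nnorm esn_repr. Qed.

Fact ler_nnormD u v : nnorm (u + v) <= nnorm u + nnorm v.
Proof.
elim/quotW: u => x; elim/quotW: v => y;
rewrite -raddfD !nnorm_pi -srealD sreal_le.
rewrite -fineD// fine_le ?fin_numD ?fin//.
exact: esnD (mem _).1 (mem _).1.
Qed.

Fact nnormZ a u : nnorm (a *: u) = `|a| * nnorm u.
Proof.
elim/quotW: u => x; rewrite [_ *: _]pi_nscale !nnorm_pi sabsE -srealM valZ.
by rewrite esnZ; [rewrite fineM|exact: (mem _).1].
Qed.

Fact nnorm_eq0 u : nnorm u = 0 -> u = 0.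
Proof.
elim/quotW: u => x; rewrite nnorm_pi -sreal0 => /sreal_inj px0.
rewrite -(raddf0 \pi_nspace); apply/pi_nspaceP.
have -> : val (0 : finite_sub p) = 0 by exact: raddf0.
by rewrite subr0 -[LHS]fineK// px0.
Qed.

HB.instance Definition _ := Lmodule_isNormed.Build (scalar R k) nspace
  ler_nnormD nnormZ nnorm_eq0.

Definition nclass (x : E) (h : x \in finite_part p) : nspace :=
  \pi_nspace (exist _ x h : finite_sub p).

End normed_quotient.

(* only the values on [0, +oo) matter *)
Record orlicz (R : realType) := Orlicz {
  orlicz_fun :> R -> \bar R;
  orlicz_ge0 : forall t, 0 <= t -> (0 <= orlicz_fun t)%E;
  orlicz_nd : forall s t, 0 <= s -> s <= t -> (orlicz_fun s <= orlicz_fun t)%E;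
  orlicz_convex : forall a s t, 0 <= a <= 1 -> 0 <= s -> 0 <= t ->
    (orlicz_fun (a * s + (1 - a) * t)
       <= a%:E * orlicz_fun s + (1 - a)%:E * orlicz_fun t)%E;
  orlicz0 : orlicz_fun 0 = 0%E;
  orlicz_neq0 : exists2 t, 0 <= t & orlicz_fun t != 0%E;
  orlicz_fin : exists2 c, 0 < c & (orlicz_fun c < +oo)%E
}.

Definition finite_orlicz (R : realType) (F : orlicz R) :=
  forall t, 0 <= t -> (F t < +oo)%E.

Section luxemburg.
Context {R : realType} {T : Type}.
Variable rho : (T -> R) -> \bar R.
Implicit Types g h : T -> R.

Definition luxemburg g : \bar R :=
  ereal_inf [set t%:E | t in [set t : R | 0 < t /\
    (rho (fun x => g x / t)%R <= 1)%E]].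

Lemma luxemburg_ge0 g : (0 <= luxemburg g)%E.
Proof.
by apply/ereal_infP => _ [t [t0 _] <-]; rewrite lee_fin ltW.
Qed.

Lemma luxemburg_le g t :
  0 < t -> (rho (fun x => g x / t)%R <= 1)%E -> (luxemburg g <= t%:E)%E.
Proof. by move=> t0 rt; apply: ereal_inf_lbound; exists t. Qed.

Lemma luxemburg0 : (rho (fun=> 0%R) <= 1)%E -> luxemburg (fun=> 0) = 0%E.
Proof.
move=> r0; apply/eqP; rewrite eq_le luxemburg_ge0 andbT.
apply/lee_addgt0Pr => e e0; rewrite add0e; apply: luxemburg_le => //.
by under [X in rho X]eq_fun do rewrite mul0r.
Qed.

Let luxemburgZ_le g c : 0 < c ->
  (luxemburg (fun x => c * g x)%R <= c%:E * luxemburg g)%E.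
Proof.
move=> c0; rewrite -lee_pdivrMl//; apply/ereal_infP => _ [t [t0 rt] <-].
rewrite lee_pdivrMl// -EFinM; apply: luxemburg_le; first exact: mulr_gt0.
rewrite (_ : (fun x => _) = (fun x => g x / t))//.
by apply/funext => x; rewrite invfM mulrACA divff ?mul1r// gt_eqF.
Qed.

Lemma luxemburgZ g c : (rho (fun=> 0%R) <= 1)%E -> 0 <= c ->
  luxemburg (fun x => c * g x) = (c%:E * luxemburg g)%E.
Proof.
move=> r0; rewrite le_eqVlt => /predU1P[<-|c0].
  by under [X in luxemburg X]eq_fun do rewrite mul0r; rewrite luxemburg0 ?mul0e.
apply/eqP; rewrite eq_le luxemburgZ_le//= -lee_pdivlMl//.
have := @luxemburgZ_le (fun x => c * g x) c^-1.
under [X in luxemburg X]eq_fun do rewrite mulKf ?gt_eqF//.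
by apply; rewrite invr_gt0.
Qed.

Variable D : set (T -> R).
Hypothesis Dconv : forall a b g h, 0 <= a -> 0 <= b -> D g -> D h ->
  D (fun x => a * g x + b * h x).
Hypothesis rho_conv : forall a g h, 0 <= a <= 1 -> D g -> D h ->
  (rho (fun x => a * g x + (1 - a) * h x)%R
     <= a%:E * rho g + (1 - a)%:E * rho h)%E.
Hypothesis rho_le : forall g h, D g -> D h -> (forall x, g x <= h x) ->
  (rho g <= rho h)%E.

Let DZ c g : 0 <= c -> D g -> D (fun x => g x / c).
Proof.
move=> c0 Dg; have := @Dconv c^-1 0 g g _ (lexx _) Dg Dg.
by under eq_fun do rewrite mul0r addr0 mulrC; apply; rewrite invr_ge0.
Qed.

Lemma luxemburgD u g h : D u -> D g -> D h -> (forall x, u x <= g x + h x) ->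
  (luxemburg u <= luxemburg g + luxemburg h)%E.
Proof.
move=> Du Dg Dh ugh.
have [->|gfin] := eqVneq (luxemburg g) +oo%E.
  by rewrite addye ?leey// -ltNye (lt_le_trans _ (luxemburg_ge0 _)).
have {}gfin : luxemburg g \is a fin_num.
  by rewrite ge0_fin_numE ?luxemburg_ge0// ltey.
rewrite addeC -leeBlDr//; apply/ereal_infP => _ [t [t0 ht] <-].
rewrite leeBlDr// addeC -leeBlDr//; apply/ereal_infP => _ [s [s0 gs] <-].
rewrite leeBlDr// -EFinD; have st0 : 0 < s + t by rewrite addr_gt0.
apply: luxemburg_le => //.
pose a := s / (s + t).
have aE : 1 - a = t / (s + t).
  by rewrite /a -{1}(divff (lt0r_neq0 st0)) -mulrBl addrAC subrr add0r.
have a01 : 0 <= a <= 1.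
  by rewrite /a ler_pdivrMr// mul1r lerDl (ltW t0) divr_ge0 ?ltW.
apply: (@le_trans _ _ (rho (fun x => a * (g x / s) + (1 - a) * (h x / t)))).
  apply: rho_le.
  - exact/DZ/Du/ltW.
  - case/andP: a01 => a0 a1.
    by apply: Dconv; rewrite ?subr_ge0//; apply: DZ => //; exact: ltW.
  - have dE (c y : R) : 0 < c -> c / (s + t) * (y / c) = y / (s + t).
      by move=> c0; rewrite mulrCA mulrAC divff ?gt_eqF// mul1r.
    move=> x; rewrite aE /a !dE// -mulrDl ler_wpM2r// invr_ge0.
    exact: ltW.
apply: le_trans (rho_conv a01 _ _) _; [by apply: DZ => //; exact: ltW..|].
have -> : 1%E = (a%:E * 1 + (1 - a)%:E * 1)%E :> \bar R.
  by rewrite !mule1 -EFinD subrKC.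
by case/andP: a01 => a0 a1; apply: leeD; apply: lee_wpmul2l;
  rewrite ?lee_fin ?subr_ge0.
Qed.

End luxemburg.

Section orlicz_spaces.
Context {R : realType} (k : scalar_kind).
Implicit Types F G : orlicz R.

Definition scalar_measurable (A : set R) (f : R -> scalar R k) :=
  measurable_fun A (fun x => sre (f x)) /\
  measurable_fun A (fun x => sim (f x)).

Definition LF_modular F (g : R -> R) : \bar R :=
  (\int[lebesgue_measure]_(x in `[0%R, 1%R[) F (g x))%E.

Definition lG_modular G (g : nat -> R) : \bar R := (\sum_(n <oo) G (g n))%E.

Definition LF_norm F (f : R -> scalar R k) : \bar R :=
  luxemburg (LF_modular F) (fun x => sabs (f x)).

Definition lG_norm G (a : nat -> scalar R k) : \bar R :=
  luxemburg (lG_modular G) (fun n => sabs (a n)).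

Definition l2_norm (a : nat -> scalar R k) : \bar R :=
  ('N[counting]_2%:E[EFin \o (fun n => sabs (a n))])%E.

Local Notation I01 := (`[0%R, 1%R[%classic : set R).

Let D : set (R -> R) :=
  [set g : R -> R | (forall x, 0 <= g x) /\ measurable_fun I01 g].

Let Dconv a b g h : 0 <= a -> 0 <= b -> D g -> D h ->
  D (fun x => a * g x + b * h x).
Proof.
move=> a0 b0 [g0 mg] [h0 mh]; split=> [x|]; first by rewrite addr_ge0 ?mulr_ge0.
by apply: measurable_funD; apply: measurable_funM.
Qed.

Lemma measurable_orlicz F : measurable_fun [set: R] (fun t => F (Num.max 0 t)).
Proof.
move=> mT; apply: (measurability _ (ErealGenOInfty.measurableE R)) => //.
move=> /= _ [_ [x ->] <-]; apply: measurableI => //.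
apply: is_interval_measurable => s t/=.
rewrite !in_itv/= !andbT => fs ft u /andP[su ut].
rewrite in_itv/= andbT (lt_le_trans fs)//.
by apply: orlicz_nd; rewrite ?ge_max !le_max lexx ?su ?orbT.
Qed.

Let mF F g : D g -> measurable_fun I01 (fun x => F (g x)).
Proof.
move=> [g0 mg].
rewrite (_ : (fun x => _) = (fun t => F (Num.max 0 t)) \o g).
  exact: measurableT_comp (measurable_orlicz F) mg.
by apply/funext => x /=; rewrite max_r.
Qed.

Let LFconv F a g h : 0 <= a <= 1 -> D g -> D h ->
  (LF_modular F (fun x => a * g x + (1 - a) * h x)%R
     <= a%:E * LF_modular F g + (1 - a)%:E * LF_modular F h)%E.
Proof.
move=> /[dup] a01 /andP[a0 a1] /[dup] Dg [g0 _] /[dup] Dh [h0 _].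
have b0 : 0 <= 1 - a by rewrite subr_ge0.
have mI : measurable (I01 : set R) by exact: measurable_itv.
have Fg x : (0 <= F (g x))%E by rewrite orlicz_ge0.
have Fh x : (0 <= F (h x))%E by rewrite orlicz_ge0.
have maF c u : D u -> measurable_fun I01 (fun x => (c%:E * F (u x))%E).
  by move=> Du; apply: emeasurable_funM => //; exact: mF.
rewrite /LF_modular -!ge0_integralZl//; [|exact: mF..].
rewrite -ge0_integralD//; first last.
- exact: maF.
- by move=> x _; rewrite mule_ge0.
- exact: maF.
- by move=> x _; rewrite mule_ge0.
apply: ge0_le_integral => //.
- by move=> x _; rewrite orlicz_ge0// addr_ge0 ?mulr_ge0.
- by apply: mF; exact: Dconv.
- by apply: emeasurable_funD; exact: maF.
- by move=> x _; exact: orlicz_convex.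
Qed.

Let LFle F g h : D g -> D h -> (forall x, g x <= h x) ->
  (LF_modular F g <= LF_modular F h)%E.
Proof.
move=> /[dup] Dg [g0 _] /[dup] Dh [h0 _] gh; apply: ge0_le_integral.
- exact: measurable_itv.
- by move=> x _; rewrite orlicz_ge0.
- exact: mF.
- exact: mF.
- by move=> x _; exact: orlicz_nd.
Qed.

Let LF0 F : (LF_modular F (fun=> 0%R) <= 1)%E.
Proof. by rewrite /LF_modular orlicz0 integral0. Qed.

Let lGconv G a (g h : nat -> R) : 0 <= a <= 1 ->
  (forall n, 0 <= g n) -> (forall n, 0 <= h n) ->
  (lG_modular G (fun x => a * g x + (1 - a) * h x)%R
     <= a%:E * lG_modular G g + (1 - a)%:E * lG_modular G h)%E.
Proof.
move=> /[dup] a01 /andP[a0 a1] g0 h0.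
have b0 : 0 <= 1 - a by rewrite subr_ge0.
rewrite /lG_modular -!nneseriesZl; [|by move=> n _; rewrite orlicz_ge0..].
rewrite -nneseriesD; [|by move=> n _ _; rewrite mule_ge0// orlicz_ge0..].
apply: lee_nneseries => n _; last exact: orlicz_convex.
by move=> _; rewrite orlicz_ge0// addr_ge0 ?mulr_ge0.
Qed.

Let lGle G (g h : nat -> R) :
  (forall n, 0 <= g n) -> (forall n, 0 <= h n) -> (forall n, g n <= h n) ->
  (lG_modular G g <= lG_modular G h)%E.
Proof.
move=> g0 h0 gh; apply: lee_nneseries => n _; last exact: orlicz_nd.
by move=> _; exact: orlicz_ge0.
Qed.

Let lG0 G : (lG_modular G (fun=> 0%R) <= 1)%E.
Proof. by rewrite /lG_modular eseries0// => n _; rewrite orlicz0. Qed.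

Let measurable_sabs f : scalar_measurable I01 f -> D (fun x => sabs (f x)).
Proof.
move=> [mr mi]; split=> [x|]; first exact: sabs_ge0.
rewrite (_ : (fun x => _) =
    Num.sqrt \o (fun x => sre (f x) ^+ 2 + sim (f x) ^+ 2)); last first.
  by apply/funext => x; rewrite /= sabs_sqrt.
apply: measurableT_comp.
  exact: continuous_measurable_fun (@sqrt_continuous R).
by apply: measurable_funD; apply: measurable_funX.
Qed.

Fact scalar_measurable0 : scalar_measurable I01 (0 : R -> scalar R k).
Proof.
by split; [exact: (measurable_cst (sre 0))|exact: (measurable_cst (sim 0))].
Qed.

Fact scalar_measurableD (f g : R -> scalar R k) :
  scalar_measurable I01 f -> scalar_measurable I01 g ->
  scalar_measurable I01 (f + g).
Proof.
move=> [rf jf] [rg jg]; split.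
- rewrite (_ : (fun x => _) = (fun x => sre (f x)) \+ (fun x => sre (g x))).
    exact: measurable_funD.
  by apply/funext => x; exact: sreD.
- rewrite (_ : (fun x => _) = (fun x => sim (f x)) \+ (fun x => sim (g x))).
    exact: measurable_funD.
  by apply/funext => x; exact: simD.
Qed.

Fact scalar_measurableZ (a : scalar R k) (f : R -> scalar R k) :
  scalar_measurable I01 f -> scalar_measurable I01 (a *: f).
Proof.
move=> [rf jf]; split.
- rewrite (_ : (fun x => _) =
      (fun x => sre a * sre (f x) - sim a * sim (f x))).
    by apply: measurable_funB; apply: measurable_funM.
  by apply/funext => x; exact: sreM.
- rewrite (_ : (fun x => _) =
      (fun x => sre a * sim (f x) + sim a * sre (f x))).
    by apply: measurable_funD; apply: measurable_funM.
  by apply/funext => x; exact: simM.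
Qed.

Fact LF_normD F (f g : R -> scalar R k) :
  scalar_measurable I01 f -> scalar_measurable I01 g ->
  (LF_norm F (f + g)%R <= LF_norm F f + LF_norm F g)%E.
Proof.
move=> mf mg; apply: (@luxemburgD _ _ _ D Dconv (@LFconv F) (@LFle F));
  try exact: measurable_sabs.
- exact/measurable_sabs/scalar_measurableD.
- by move=> x; exact: sabsD.
Qed.

Fact LF_normZ F (a : scalar R k) (f : R -> scalar R k) :
  LF_norm F (a *: f) = ((sabs a)%:E * LF_norm F f)%E.
Proof.
rewrite -luxemburgZ ?sabs_ge0//; congr luxemburg.
by apply/funext => x; rewrite -sabsM.
Qed.

Fact LF_norm_ge0 F (f : R -> scalar R k) : (0 <= LF_norm F f)%E.
Proof. exact: luxemburg_ge0. Qed.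

Definition LF_eseminorm F : eseminorm (R -> scalar R k) :=
  @ESeminorm R k _ (scalar_measurable I01) (LF_norm F)
    scalar_measurable0 scalar_measurableD scalar_measurableZ
    (LF_norm_ge0 F) (@LF_normD F) (fun a f _ => LF_normZ F a f).

(* the quotient in [nspace (LF_eseminorm F)] identifies functions equal a.e.
   on [0, 1); values outside [0, 1) are irrelevant *)
Lemma LF_norm_eq0 F (f : R -> scalar R k) : scalar_measurable I01 f ->
  LF_norm F f = 0%E <-> {ae lebesgue_measure, forall x, I01 x -> f x = 0}.
Proof.
move=> mf; have Df := measurable_sabs mf.
have Dc c : 0 <= c -> D (fun x => c * sabs (f x)).
  move=> c0; have := Dconv c0 c0 Df Df.
  split=> [x|]; first by rewrite mulr_ge0 ?sabs_ge0.
  by apply: measurable_funM => //; exact: Df.2.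
have Fc0 c x : 0 <= c -> (0 <= F (c * sabs (f x))%R)%E.
  by move=> c0; rewrite orlicz_ge0// mulr_ge0 ?sabs_ge0.
split=> [Nf0|f0]; last first.
  apply/eqP; rewrite eq_le luxemburg_ge0 andbT.
  apply/lee_addgt0Pr => e e0; rewrite add0e; apply: luxemburg_le => //.
  have e'0 : 0 <= e^-1 by rewrite invr_ge0 ltW.
  suff -> : LF_modular F (fun x => sabs (f x) / e) = 0%E by [].
  rewrite -[RHS](integral0 lebesgue_measure I01); apply: ae_eq_integral => //.
  - rewrite [X in measurable_fun _ X](_ : _ =
        fun x => F (e^-1 * sabs (f x))); first exact: mF (Dc _ e'0).
    by apply/funext => x; rewrite mulrC.
  - case: f0 => N [mN N0 fN]; exists N; split=> // x /= Fx; apply: fN => /= fx.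
    by apply: Fx => Ix; rewrite fx// sabs0 mul0r orlicz0.
have le1 c : 0 < c -> (LF_modular F (fun x => c * sabs (f x))%R <= 1)%E.
  move=> c0.
  have : (LF_norm F f < (c^-1)%:E)%E by rewrite Nf0 lte_fin invr_gt0.
  move=> /ereal_inf_lt[_ [t [t0 ht] <-]]; rewrite lte_fin => tc.
  apply: le_trans _ ht; apply: LFle; first exact/Dc/ltW.
    rewrite [X in D X](_ : _ = fun x => t^-1 * sabs (f x)).
      by apply: Dc; rewrite invr_ge0 ltW.
    by apply/funext => x; rewrite mulrC.
  move=> x; rewrite mulrC ler_wpM2l ?sabs_ge0//.
  by rewrite -(invrK c) lef_pV2 ?posrE ?invr_gt0// ltW.
have eq0 c : 0 < c -> LF_modular F (fun x => c * sabs (f x))%R = 0%E.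
  move=> c0; apply/eqP; rewrite eq_le integral_ge0 ?andbT; last first.
    by move=> x _; exact/Fc0/ltW.
  apply/lee_addgt0Pr => e e0; rewrite add0e.
  pose l := Num.min e 1.
  have l0 : 0 < l by rewrite lt_min e0 ltr01.
  have l1 : l <= 1 by rewrite ge_min lexx orbT.
  have l01 : 0 <= l <= 1 by rewrite (ltW l0).
  have D0 : D (fun=> 0) by split => //; exact: measurable_cst.
  have := @LFconv F l _ _ l01 (Dc (c / l) (ltW (divr_gt0 c0 l0))) D0.
  have -> : LF_modular F (fun=> 0%R) = 0%E.
    by rewrite /LF_modular orlicz0 integral0.
  rewrite mule0 adde0.
  rewrite (_ : (fun x => _) = (fun x => c * sabs (f x))); last first.
    by apply/funext => x; rewrite mulr0 addr0 mulrA mulrCA divff ?mulr1//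
       gt_eqF.
  move=> /le_trans; apply; apply: (@le_trans _ _ (l%:E * 1)%E).
    by apply: lee_wpmul2l; [rewrite lee_fin ltW|exact/le1/divr_gt0].
  by rewrite mule1 lee_fin ge_min lexx.
have ae0 n : {ae lebesgue_measure, forall x, I01 x ->
    F (n.+1%:R * sabs (f x)) = 0%E}.
  apply: (ae_eq_integral_abs _ _ _).1 => //.
  - exact: mF (Dc _ (ler0n _ _)).
  - rewrite -[RHS](eq0 n.+1%:R)//; apply: eq_integral => x _.
    by rewrite gee0_abs// Fc0.
have [N [mN N0 fN]] := ae_foralln ae0.
exists N; split=> // x /= fx; apply: fN => /= Fx0; apply: fx => Ix.
apply/eqP; rewrite -sabs_eq0.
apply: contraT => fx0.
have {}fx0 : 0 < sabs (f x) by rewrite lt_neqAle eq_sym fx0 sabs_ge0.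
have [t t0 /negP[]] := orlicz_neq0 F.
rewrite eq_le orlicz_ge0// andbT.
rewrite -(Fx0 (Num.truncn (t / sabs (f x))) Ix); apply: orlicz_nd => //.
by rewrite -ler_pdivrMr//; exact/ltW/truncnS_gt.
Qed.

Fact lG_normD G (a b : nat -> scalar R k) :
  (lG_norm G (a + b)%R <= lG_norm G a + lG_norm G b)%E.
Proof.
pose P := [set g : nat -> R | forall n, 0 <= g n].
apply: (@luxemburgD _ _ _ P _ (fun c g h c01 => @lGconv G c g h c01) (@lGle G)).
- by move=> c d g h c0 d0 g0 h0 n; rewrite addr_ge0 ?mulr_ge0.
- by move=> n; exact: sabs_ge0.
- by move=> n; exact: sabs_ge0.
- by move=> n; exact: sabs_ge0.
- by move=> n; exact: sabsD.
Qed.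

Fact lG_normZ G (c : scalar R k) (a : nat -> scalar R k) :
  lG_norm G (c *: a) = ((sabs c)%:E * lG_norm G a)%E.
Proof.
rewrite -luxemburgZ ?sabs_ge0//; congr luxemburg.
by apply/funext => x; rewrite -sabsM.
Qed.

Fact lG_norm_ge0 G (a : nat -> scalar R k) : (0 <= lG_norm G a)%E.
Proof. exact: luxemburg_ge0. Qed.

Definition lG_eseminorm G : eseminorm (nat -> scalar R k) :=
  @ESeminorm R k _ setT (lG_norm G) Logic.I
    (fun _ _ _ _ => Logic.I) (fun _ _ _ => Logic.I) (lG_norm_ge0 G)
    (fun a b _ _ => @lG_normD G a b) (fun c a _ => lG_normZ G c a).

Fact l2_normD (a b : nat -> scalar R k) :
  (l2_norm (a + b)%R <= l2_norm a + l2_norm b)%E.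
Proof.
have l2E (c : nat -> R) : ('N[counting]_2%:E[EFin \o c])%E =
  ((\sum_(n <oo) (`|(c n)%:E| `^ 2)) `^ 2^-1)%E.
  by rewrite Lnorm_counting.
apply: (@le_trans _ _ ('N[counting]_2%:E[EFin \o
    ((fun n => sabs (a n)) \+ (fun n => sabs (b n)))%R])%E).
  rewrite /l2_norm !l2E; apply: gt0_ler_poweR.
  - by [].
  - by rewrite in_itv/= leey andbT nneseries_ge0// => n _ _; exact: poweR_ge0.
  - by rewrite in_itv/= leey andbT nneseries_ge0// => n _ _; exact: poweR_ge0.
  apply: lee_nneseries => n _; first by rewrite poweR_ge0.
  rewrite /= lee_fin ge0_ler_powR ?nnegrE//.
  rewrite !ger0_norm ?addr_ge0//; do ?exact: sabs_ge0.
  exact: sabsD.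
by apply: minkowski_EFin => //; rewrite ler1n.
Qed.

Fact l2_normZ (c : scalar R k) (a : nat -> scalar R k) :
  l2_norm (c *: a) = ((sabs c)%:E * l2_norm a)%E.
Proof.
rewrite /l2_norm !Lnorm_counting//.
rewrite (_ : (\sum_(n <oo) _)%E = ((sabs c `^ 2)%:E *
    \sum_(n <oo) (`|(EFin \o (fun n => sabs (a n))) n| `^ 2))%E).
  rewrite poweRM ?lee_fin ?powR_ge0//; last first.
    by rewrite nneseries_ge0// => n _ _; exact: poweR_ge0.
  by rewrite -poweR_EFin -poweRrM divff// poweRe1// lee_fin sabs_ge0.
rewrite -nneseriesZl; last by move=> n _; exact: poweR_ge0.
apply: eq_eseriesr => n _.
rewrite /= [X in sabs X](_ : _ = c * a n)// sabsM normrM powRM ?normr_ge0//.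
by rewrite (ger0_norm (sabs_ge0 c)) EFinM.
Qed.

Fact l2_norm_ge0 (a : nat -> scalar R k) : (0 <= l2_norm a)%E.
Proof. exact: Lnorm_ge0. Qed.

Definition l2_eseminorm : eseminorm (nat -> scalar R k) :=
  @ESeminorm R k _ setT l2_norm Logic.I (fun _ _ _ _ => Logic.I)
    (fun _ _ _ => Logic.I) l2_norm_ge0 (fun a b _ _ => l2_normD a b)
    (fun c a _ => l2_normZ c a).

Definition unit_seq (n : nat) : nat -> scalar R k := fun m => (m == n)%:R.

Let sabs_unit_seq n m : sabs (unit_seq n m) = (m == n)%:R :> R.
Proof. by rewrite /unit_seq; case: eqP => _; rewrite ?sabs1 ?sabs0. Qed.

Lemma unit_seq_lG G n : unit_seq n \in finite_part (lG_eseminorm G).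
Proof.
apply/finite_partP; split=> //; have [c c0 Gc] := orlicz_fin G.
have {Gc} : G c \is a fin_num by rewrite ge0_fin_numE// orlicz_ge0// ltW.
case Er : (G c) => [r| |]// _.
have r0 : 0 <= r by rewrite -lee_fin -Er orlicz_ge0// ltW.
pose l := (1 + r)^-1; have l0 : 0 < l by rewrite invr_gt0 ltr_pwDl.
have l1 : l <= 1 by rewrite invf_le1 ?ltr_pwDl// lerDl.
suff h : (lG_norm G (unit_seq n) <= ((l * c)^-1)%:E)%E.
  exact: le_lt_trans h (ltry _).
apply: luxemburg_le; first by rewrite invr_gt0 mulr_gt0.
rewrite invrK /lG_modular (nneseriesD1 (n := n))//; last first.
  move=> m _; rewrite orlicz_ge0// mulr_ge0 ?sabs_ge0// ltW// mulr_gt0//.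
rewrite eseries0 ?adde0; last first.
  by move=> m _ /negPf mn; rewrite sabs_unit_seq mn mul0r orlicz0.
rewrite sabs_unit_seq eqxx mul1r -[l * c]addr0 -(mulr0 (1 - l)).
apply: le_trans (orlicz_convex G _ (ltW c0) (lexx 0)) _.
  by rewrite (ltW l0).
rewrite orlicz0 mule0 adde0 Er -EFinM lee_fin /l.
rewrite mulrC ler_pdivrMr ?mul1r ?ltr_pwDl//.
by rewrite lerDr.
Qed.

Lemma unit_seq_l2 n : unit_seq n \in finite_part l2_eseminorm.
Proof.
apply/finite_partP; split=> //=; rewrite /l2_norm Lnorm_counting//.
apply: poweR_lty; rewrite (nneseriesD1 (n := n))//; last first.
  by move=> m _; exact: poweR_ge0.
rewrite eseries0 ?adde0 ?poweR_EFin ?ltry// => m _ /negPf mn.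
by rewrite /= sabs_unit_seq mn normr0 powR0.
Qed.

Definition LF F : normedModType (scalar R k) := nspace (LF_eseminorm F).

Definition lG G : normedModType (scalar R k) := nspace (lG_eseminorm G).

Definition l2 : normedModType (scalar R k) := nspace l2_eseminorm.

Definition lG_unit G (n : nat) : lG G := nclass (unit_seq_lG G n).

Definition l2_unit (n : nat) : l2 := nclass (unit_seq_l2 n).

End orlicz_spaces.

Section basic_sequences.
Context {K : numFieldType} {V : normedModType K}.
Implicit Types x : nat -> V.

Definition linear_span x : set V :=
  [set v | exists n (a : nat -> K), v = \sum_(i < n) a i *: x i].

Definition closed_span x : set V := closure (linear_span x).

Definition schauder_basis (Y : set V) x :=
  (forall n, Y (x n)) /\
  forall y, Y y -> exists! a : nat -> K,
    (fun n => \sum_(i < n) a i *: x i) @ \oo --> y.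

Definition basic_sequence x := schauder_basis (closed_span x) x.

Definition complemented x :=
  exists P : {linear V -> V},
    [/\ continuous P, P \o P =1 P & range P = closed_span x].

Definition unconditional x :=
  forall s : nat -> nat, bijective s -> basic_sequence (x \o s).

End basic_sequences.

Section equivalence.
Context {K : numFieldType} {V W : normedModType K}.

Definition linear_on (A : set V) (T : V -> W) :=
  forall (a : K) v w, A v -> A w -> T (a *: v + w) = a *: T v + T w.

(* linear homeomorphism from [closed_span x] onto [closed_span y]; the values
   of T and T' outside these subspaces are irrelevant *)
Definition equivalent (x : nat -> V) (y : nat -> W) :=
  exists (T : V -> W) (T' : W -> V),
    [/\ linear_on (closed_span x) T,
        set_fun (closed_span x) (closed_span y) T /\
        set_fun (closed_span y) (closed_span x) T',
        {in closed_span x, cancel T T'} /\ {in closed_span y, cancel T' T},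
        {within closed_span x, continuous T} /\
        {within closed_span y, continuous T'}
      & forall n, T (x n) = y n].

End equivalence.

Section subsymmetric.
Context {K : numFieldType} {V : normedModType K}.
Implicit Types x : nat -> V.

Definition spreading x :=
  forall s : nat -> nat, {homo s : m n / (m < n)%N} -> equivalent x (x \o s).

Definition subsymmetric x := unconditional x /\ spreading x.

End subsymmetric.

Definition essentially_decreasing (R : realType) (h : R -> R) :=
  exists C : R, forall s t, 1 <= s -> s <= t -> h t <= C * h s.

Definition convex_hull (R : numDomainType) (V : lmodType R) (A : set V) :
    set V :=
  [set v | exists n (w : 'I_n -> R) (a : 'I_n -> V),
    [/\ forall i, 0 <= w i, \sum_i w i = 1, forall i, A (a i)
      & v = \sum_i w i *: a i]].

Section CF.
Context {R : realType}.
Implicit Types F G : orlicz R.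

Definition dilate F (s : R) : R -> R := fun t => fine (F (s * t)) / fine (F s).

(* Elements of C([0, 1/2]) are represented by functions R -> R continuous on
   [0, 1/2]; the topology of [{uniform` A -> R}] only depends on the
   restrictions to A *)
Definition CFb F (b : R) : set (R -> R) :=
  [set g : R -> R | {within `[0%R, 2^-1], continuous g} /\
    closure (convex_hull [set dilate F s | s in [set s | b < s /\ (0 < F s)%E]]
      : set {uniform` `[0%R, 2^-1] -> R}) g].

Definition CF F : set (R -> R) := \bigcap_(b in [set b : R | 0 <= b]) CFb F b.

(* G is the Orlicz function on [0, +oo) obtained from g on [0, 1/2] *)
Definition affine_extension (g : R -> R) G :=
  [/\ forall t, 0 <= t <= 2^-1 -> G t = (g t)%:E,
      exists a b : R, forall t, 2^-1 <= t -> G t = (a * t + b)%:E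
    & G 1 = 1%:E].

End CF.

(* Main.v *)
Require Import Defs.
From mathcomp Require Import all_boot all_order all_algebra.
From mathcomp Require Import all_classical all_reals all_analysis.
From mathcomp Require Import ring lra complex measurable_realfun.
Import Defs.

Set Implicit Arguments.
Unset Strict Implicit.
Unset Printing Implicit Defensive.

Import Order.TTheory GRing.Theory Num.Theory.
Import numFieldNormedType.Exports.

Local Open Scope classical_set_scope.
Local Open Scope ring_scope.

(** Why the theorem holds.  Write x_n for the given sequence, [closed_span x] for
    its closed span.  The projection, the basis property and unconditionality
    together yield functionals phi_n on the whole of L_F, biorthogonal to x_n,
    and a constant bounding every signed finite sum of the phi_n(v) x_n by the
    norm of v ([unconditional_coordinates]).  The uniform bounds come from
    Zabreiko's lemma: a countably subadditive seminorm on a complete normed space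
    is bounded.

    Averaging over signs gives the main tool, [diagonal_estimate]: the norm of
    the sum of the phi_i(w_i) x_i is at most a constant times the average of the
    norm of the sum of the e_i w_i over the choices of signs e_i.  Hence, when
    x_i is replaced by a part z_i of itself with |phi_i(z_i)| bounded below, the
    combinations of the x_i are controlled by sign averages of those of the z_i.

    Spreading forces the norms of the x_n to lie between two positive constants,
    so they may be rescaled to be less than 1.  For b > 0 let z_n be the part of
    x_n where |x_n| <= b.

    First case: for some b all |phi_n(z_n)| are at least 1/2.  As F(t) = O(t^2)
    at infinity, the norm of L_F is at most a constant times 1 plus the square of
    the L_2 norm; the z_n are uniformly bounded, so sign averages give an upper
    l_2-estimate.  Conversely the norm of L_F dominates the integral, the z_n
    have square integrals bounded below, and Khinchine's inequality gives the
    lower l_2-estimate.  So x is equivalent to the unit vectors of l_2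
    ([l2_equivalence]).

    Second case: for every b some |phi_n(z_n)| is less than 1/2.  Then a large
    part of some x_n lives where |x_n| > b, and since the growth condition makes
    tails small in norm, a gliding hump produces a subsequence x_(s i) and
    disjoint sets A_i on which |x_(s i)| is bounded and larger than i, while phi
    of the part of x_(s i) in A_i stays bounded below ([choose_blocks]).  The
    diagonal estimate, used in both directions, compares x_(s i) with these
    disjoint parts ([block_upper], [block_lower]).  Rounding |x_(s i)| down to an
    integer on A_i changes norms by a factor of at most 2, and the modular of a
    combination of disjoint integer-valued functions is exactly
    \sum_i m_i H_i(|a_i|/tau), where m_i is bounded above and below and H_i is
    a convex combination of functions t |-> F(s t) / F(s) with integers s > i.
    Along an ultrafilter the H_i converge on [0, 1] to a convex function g; the
    convergence is uniform on [0, 1/2] for a subsequence because convex functions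
    with values in [0, 1] are equi-Lipschitz there, so g belongs to C_F.  If the
    uniform distance of H_i to g is at most 2^-(i+2), the total error of the
    modulars is at most 1/2, and the subsequence is equivalent to the unit
    vectors of l_G, with G the affine extension of g ([block_subsequence]).
    Since x is spreading, it is equivalent to this subsequence. *)

(** * Scalars and real-valued norms *)

Section scalars.
Context {R : realType} {k : scalar_kind}.
Implicit Types z w : scalar R k.

Lemma sabs_sreal (r : R) : sabs (sreal r : scalar R k) = `|r|.
Proof.
rewrite sabs_sqrt /sre /sim /sreal; case: k => /=.
  by rewrite expr0n/= addr0 sqrtr_sqr.
by rewrite expr0n/= addr0 sqrtr_sqr.
Qed.

Lemma sreK z : 0 <= z -> sreal (sabs z) = z.
Proof. by move=> z0; rewrite -sabsE ger0_norm. Qed.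

Lemma sabsN z : sabs (- z) = sabs z.
Proof. by apply: (@sreal_inj R k); rewrite -!sabsE normrN. Qed.

Lemma sreal1 : sreal 1 = 1 :> scalar R k.
Proof. by rewrite /sreal; case: k => //; rewrite rmorph1. Qed.

Lemma srealV (r : R) : sreal r^-1 = (sreal r)^-1 :> scalar R k.
Proof.
have [->|r0] := eqVneq r 0; first by rewrite invr0 sreal0 invr0.
apply: (@mulfI _ (sreal r)); first by rewrite -sreal0 (inj_eq sreal_inj).
by rewrite -srealM !divff ?sreal1// -sreal0 (inj_eq sreal_inj).
Qed.

Lemma sabsV z : sabs z^-1 = (sabs z)^-1.
Proof. by apply: (@sreal_inj R k); rewrite -sabsE normfV sabsE srealV. Qed.

Lemma sabs_sign (b : bool) : sabs ((-1) ^+ b : scalar R k) = 1.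
Proof. by case: b; rewrite /= ?expr1 ?expr0 ?sabsN sabs1. Qed.

Lemma sre_sum (I : Type) (s : seq I) (f : I -> scalar R k) :
  sre (\sum_(i <- s) f i) = \sum_(i <- s) sre (f i).
Proof.
elim: s => [|i s ih]; last by rewrite !big_cons sreD ih.
by rewrite !big_nil /sre; case: k.
Qed.

Lemma sim_sum (I : Type) (s : seq I) (f : I -> scalar R k) :
  sim (\sum_(i <- s) f i) = \sum_(i <- s) sim (f i).
Proof.
elim: s => [|i s ih]; last by rewrite !big_cons simD ih.
by rewrite !big_nil /sim; case: k.
Qed.

Lemma sreN z : sre (- z) = - sre z.
Proof. by rewrite /sre; case: k z => // -[]. Qed.

Lemma simN z : sim (- z) = - sim z.
Proof. by rewrite /sim; case: k z => //= [_|[]//]; rewrite oppr0. Qed.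

Lemma sre_le z : `|sre z| <= sabs z.
Proof.
rewrite sabs_sqrt -sqrtr_sqr ler_wsqrtr// lerDl sqr_ge0//.
Qed.

Lemma sim_le z : `|sim z| <= sabs z.
Proof. by rewrite sabs_sqrt -sqrtr_sqr ler_wsqrtr// lerDr sqr_ge0. Qed.

Lemma sabs_le z : sabs z <= `|sre z| + `|sim z|.
Proof.
rewrite sabs_sqrt -[leRHS]ger0_norm ?addr_ge0// -sqrtr_sqr ler_wsqrtr//.
rewrite sqrrD !real_normK ?num_real// lerD2r lerDl.
by rewrite mulrn_wge0 ?mulr_ge0.
Qed.

Lemma sabs_sum (I : Type) (s : seq I) (f : I -> scalar R k) :
  sabs (\sum_(i <- s) f i) <= \sum_(i <- s) sabs (f i).
Proof.
elim: s => [|i s ih]; first by rewrite !big_nil sabs0.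
by rewrite !big_cons (le_trans (sabsD _ _))// lerD2l.
Qed.

Definition mk_scalar (a b : R) : scalar R k :=
  match k return scalar R k with
  | RealScalars => a | ComplexScalars => (a +i* b)%C
  end.

Lemma sre_mk a b : sre (mk_scalar a b) = a.
Proof. by rewrite /sre /mk_scalar; case: k. Qed.

End scalars.

Section real_norm.
Context {R : realType} {k : scalar_kind} {V : normedModType (scalar R k)}.
Implicit Types v w : V.

(** The norm of a space over [scalar R k] takes scalar values; estimates are
    made with its real value [rn]. *)
Definition rn v : R := sabs `|v|.

Lemma rnE v : `|v| = sreal (rn v).
Proof. by rewrite sreK. Qed.

Lemma rn_ge0 v : 0 <= rn v. Proof. exact: sabs_ge0. Qed.

Lemma rn0 : rn 0 = 0. Proof. by rewrite /rn normr0 sabs0. Qed.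

Lemma rnD v w : rn (v + w) <= rn v + rn w.
Proof. by rewrite -(@sreal_le R k) srealD -!rnE ler_normD. Qed.

Lemma rnZ a v : rn (a *: v) = sabs a * rn v.
Proof. by apply: (@sreal_inj R k); rewrite srealM -!rnE normrZ sabsE. Qed.

Lemma rnN v : rn (- v) = rn v. Proof. by rewrite /rn normrN. Qed.

Lemma rnBC v w : rn (v - w) = rn (w - v). Proof. by rewrite -opprB rnN. Qed.

Lemma rnB v w : rn (v - w) <= rn v + rn w.
Proof. by rewrite (le_trans (rnD _ _))// rnN. Qed.

Lemma rn_dist v w : rn v <= rn w + rn (v - w).
Proof. by rewrite -{1}(subrK w v) addrC rnD. Qed.

Lemma rn_eq0 v : (rn v == 0) = (v == 0).
Proof. by rewrite -(@normr_eq0 _ _ v) rnE -(@sreal0 R k) (inj_eq sreal_inj). Qed.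

Lemma rn_sum (I : Type) (s : seq I) (P : pred I) (f : I -> V) :
  rn (\sum_(i <- s | P i) f i) <= \sum_(i <- s | P i) rn (f i).
Proof.
elim/big_ind2 : _ => //; first by rewrite rn0.
by move=> x a y b xa yb; rewrite (le_trans (rnD _ _))// lerD.
Qed.

Lemma functional0 (h : V -> scalar R k) :
  (forall a u v, h (a *: u + v) = a * h u + h v) -> h 0 = 0.
Proof.
move=> h_lin; have := h_lin 1 0 0; rewrite scale1r mul1r addr0 => /eqP.
by rewrite -subr_eq0 opprD addrA subrr add0r oppr_eq0 => /eqP.
Qed.

Lemma functionalZ (h : V -> scalar R k) a v :
  (forall a u v, h (a *: u + v) = a * h u + h v) -> h (a *: v) = a * h v.
Proof. by move=> h_lin; rewrite -[a *: v]addr0 h_lin functional0// addr0. Qed.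

Definition rcvg (u : nat -> V) (l : V) :=
  forall e : R, 0 < e -> \forall n \near \oo, rn (l - u n) < e.

Lemma sreal_gt0 (e : R) : (0 < (sreal e : scalar R k)) = (0 < e).
Proof.
by rewrite !lt_def sreal_ge0 -(@sreal0 R k) (inj_eq sreal_inj).
Qed.

Lemma sreal_lt (e f : R) : ((sreal e : scalar R k) < sreal f) = (e < f).
Proof.
by rewrite !lt_def sreal_le (inj_eq sreal_inj).
Qed.

Lemma gt0_sreal (e : scalar R k) : 0 < e -> exists2 r : R, 0 < r & e = sreal r.
Proof.
move=> e0; exists (sabs e); last by rewrite sreK// ltW.
by rewrite -sreal_gt0 sreK// ltW.
Qed.

Lemma rcvgP u l : u @ \oo --> l <-> rcvg u l.
Proof.
split=> [/cvgrPdist_lt ul e e0|ul].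
  have := ul (sreal e); rewrite sreal_gt0 => /(_ e0).
  by apply: filterS => n; rewrite rnE sreal_lt.
apply/cvgrPdist_lt => _ /gt0_sreal[r r0 ->].
by have := ul _ r0; apply: filterS => n; rewrite rnE sreal_lt.
Qed.

(** The filter-based closure, restated with real-valued distances. *)
Lemma closure_rnP (A : set V) v :
  closure A v <-> forall e : R, 0 < e -> exists2 w, A w & rn (v - w) < e.
Proof.
split=> [cA e e0|cA U].
  have [|w [Aw]] := cA (ball v (sreal e)).
    by apply: nbhsx_ballx; rewrite sreal_gt0.
  by rewrite -ball_normE /= rnE sreal_lt => ?; exists w.
move=> /nbhs_ballP[_ /= /gt0_sreal[r r0 ->] U1].
have [w Aw vw] := cA _ r0; exists w; split=> //; apply: U1.
by rewrite -ball_normE /= rnE sreal_lt.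
Qed.

Lemma rcvg_le u l C : rcvg u l -> (\forall n \near \oo, rn (u n) <= C) -> rn l <= C.
Proof.
move=> ul uC; apply/ler_addgt0Pr => e e0; near \oo => n.
rewrite (le_trans (rn_dist l (u n)))// lerD//; first by near: n.
by rewrite ltW//; near: n; exact: ul.
Unshelve. all: by end_near. Qed.

Lemma rcvg_bounded u l : rcvg u l -> exists C : R, forall n, rn (u n) <= C.
Proof.
move=> /(_ _ ltr01)[N _ h].
exists (rn l + 1 + \sum_(i < N) rn (u i)) => n.
have s0 : 0 <= \sum_(i < N) rn (u i) by rewrite sumr_ge0// => *; exact: rn_ge0.
have [Nn|nN] := leqP N n.
  rewrite ler_wpDr// (le_trans (rn_dist _ l))// lerD2l.
  by rewrite -rnN opprB ltW// h.
rewrite (bigD1 (Ordinal nN))//= ler_wpDl ?addr_ge0 ?rn_ge0//.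
by rewrite lerDl sumr_ge0// => *; exact: rn_ge0.
Qed.

Lemma rcvgD u u' l m : rcvg u l -> rcvg u' m ->
  rcvg (fun n => u n + u' n) (l + m).
Proof. by move=> /rcvgP ul /rcvgP vm; apply/rcvgP; exact: cvgD. Qed.

Lemma rcvgZ a u l : rcvg u l -> rcvg (fun n => a *: u n) (a *: l).
Proof. by move=> /rcvgP ul; apply/rcvgP; exact: cvgZl_tmp. Qed.

(** Completeness in the form in which it is proved and used: absolutely
    convergent series converge. *)
Definition series_complete :=
  forall v : nat -> V, (exists C : R, forall n, \sum_(i < n) rn (v i) <= C) ->
  exists l, rcvg (fun n => \sum_(i < n) v i) l.

End real_norm.
Arguments series_complete {R k} V.

(** * Boundedness of countably subadditive seminorms *)

Section zabreiko.
Context {R : realType} {k : scalar_kind} {V : normedModType (scalar R k)}.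

(** Baire's argument, in the form of a point chosen in every P m: each ball
    contains a smaller ball inside P m, and the centres of nested balls with
    halving radii form an absolutely convergent telescoping series. *)
Lemma nested_balls (P : nat -> set V) : series_complete V ->
  (forall m c r, 0 < r -> exists2 w, rn (w - c) < r &
    exists2 e : R, 0 < e & forall z, rn (z - w) < e -> P m z) ->
  exists z, forall m, P m z.
Proof.
move=> cV hP.
have /choice[f hf] : forall s : nat * (V * R), exists t : V * R, 0 < s.2.2 ->
    [/\ rn (t.1 - s.2.1) <= s.2.2 / 2, 0 < t.2, t.2 <= s.2.2 / 2 &
      forall z, rn (z - t.1) <= t.2 -> P s.1 z].
  move=> [m [c r]] /=; have [r0|] := pselect (0 < r); last by exists (c, r).
  have [|w wc [e e0 h]] := hP m c (r / 2); first by rewrite divr_gt0.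
  exists (w, Num.min (r / 2) (e / 2)) => _ /=; split=> //.
  - exact: ltW.
  - by rewrite lt_min !divr_gt0.
  - by rewrite ge_min lexx.
  move=> z; rewrite le_min => /andP[_ ze]; apply: h.
  by rewrite (le_lt_trans ze)// ltr_pdivrMr// ltr_pMr// ltr1n.
(* the radius at stage n is at least twice that of stage n.+1, so it bounds
   the remaining path of the centres *)
pose fix s n : V * R := if n is m.+1 then f (m, s m) else (0, 1).
have r0 n : 0 < (s n).2.
  by elim: n => [|n ih]; [exact: ltr01|case: (hf (n, s n) ih)].
have step n : rn ((s n.+1).1 - (s n).1) <= (s n).2 - (s n.+1).2.
  have [h1 _ h2 _] := hf (n, s n) (r0 n).
  have h3 : (s n.+1).2 <= (s n).2 / 2 := h2.
  have h4 : rn ((s n.+1).1 - (s n).1) <= (s n).2 / 2 := h1.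
  by apply: (le_trans h4); lra.
have dist m n : rn ((s (m + n)%N).1 - (s m).1) <= (s m).2 - (s (m + n)%N).2.
  elim: n => [|n ih]; first by rewrite addn0 !subrr rn0.
  rewrite addnS (_ : (s (m + n).+1).1 - (s m).1 =
    ((s (m + n).+1).1 - (s (m + n)%N).1) + ((s (m + n)%N).1 - (s m).1)).
    apply: le_trans (rnD _ _) _.
    by apply: le_trans (lerD (step _) ih) _; lra.
  by rewrite addrA subrK.
have sumE n : \sum_(i < n) ((s i.+1).1 - (s i).1) = (s n).1 - (s 0%N).1.
  rewrite -(telescope_sumr (fun i => (s i).1) (leq0n n)) big_mkord.
  by [].
have [|l ll] := cV (fun n => (s n.+1).1 - (s n).1).
  exists 1 => n; apply: (@le_trans _ _ ((s 0%N).2 - (s n).2)); last first.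
    by have := r0 n; rewrite /=; lra.
  rewrite -opprB -(telescope_sumr (fun i => (s i).2) (leq0n n)) big_mkord -sumrN.
  by apply: ler_sum => i _; rewrite opprB.
have {}ll : rcvg (fun n => (s n).1) l.
  by move=> e /ll; apply: filterS => n; rewrite sumE subr0.
have close m : rn (l - (s m).1) <= (s m).2.
  apply/ler_addgt0Pr => e /ll [N _ h].
  have /= := h (m + N)%N (leq_addl _ _) => lN.
  rewrite (_ : l - (s m).1 =
    (l - (s (m + N)%N).1) + ((s (m + N)%N).1 - (s m).1)); last first.
    by rewrite addrA subrK.
  rewrite addrC (le_trans (rnD _ _))// lerD//; last exact: ltW.
  by apply: le_trans (dist m N) _; rewrite gerBl ltW.
by exists l => m; have [_ _ _] := hf (m, s m) (r0 m); apply; exact: (close m.+1).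
Qed.

(** Zabreiko's lemma. By Baire's argument some sublevel set of q is dense in a
    ball (otherwise a point with q > m for all m would exist); symmetry and
    convexity move this ball to the origin, scaling shows that each w is
    approximated arbitrarily well by u with q u <= D * rn w, and summing
    successive approximations with halving errors gives the bound by countable
    subadditivity. *)
Lemma zabreiko (q : V -> R) : series_complete V ->
  (forall u v, q (u + v) <= q u + q v) ->
  (forall a v, q (a *: v) = sabs a * q v) ->
  (forall (v : nat -> V) l C, rcvg (fun n => \sum_(i < n) v i) l ->
     (forall n, \sum_(i < n) q (v i) <= C) -> q l <= C) ->
  exists2 C : R, 0 <= C & forall v, q v <= C * rn v.
Proof.
move=> cV qD qZ qS.
have q0 : q 0 = 0 by rewrite -(scale0r 0) qZ sabs0 mul0r.
have qN v : q (- v) = q v by rewrite -scaleN1r qZ sabsN sabs1 mul1r.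
have q_ge0 v : 0 <= q v.
  by have := qD v (- v); rewrite subrr q0 qN -mulr2n pmulrn_lge0.
pose appr (m : nat) (w : V) := forall e, 0 < e -> exists2 u, q u <= m%:R & rn (w - u) < e.
have [m [c [r r0 hr]]] : exists m c, exists2 r, 0 < r & forall w, rn (w - c) < r -> appr m w.
  apply: contrapT => no.
  have [|z hz] := @nested_balls (fun m z => m%:R < q z) cV.
    move=> m c r r0; apply: contrapT => no1; apply: no; exists m, c, r => // w wc e e0.
    apply: contrapT => no2; apply: no1; exists w => //; exists e => // z zw.
    rewrite ltNge; apply/negP => qz; apply: no2; exists z => //.
    by rewrite rnBC.
  have := hz (Num.truncn (q z)).+1; rewrite ltNge => /negP; apply.
  exact/ltW/truncnS_gt.
have {}hr w : rn w < r -> appr m w.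
  move=> wr e e0.
  have [|u1 qu1 h1] := hr (c + w) _ e e0; first by rewrite addrC addKr.
  have [|u2 qu2 h2] := hr (c - w) _ e e0; first by rewrite addrC addKr rnN.
  have two : sabs (2^-1 : scalar R k) = 2^-1.
    have -> : (2 : scalar R k) = sreal 2.
      by rewrite -[2 in RHS]/(1 + 1) srealD sreal1.
    by rewrite sabsV sabs_sreal ger0_norm.
  have n2 : (2 : scalar R k) != 0 by rewrite pnatr_eq0.
  (* w is the half-difference of c + w and c - w, both in the ball about c *)
  exists (2^-1 *: (u1 - u2)).
    rewrite qZ two ler_pdivrMl//; apply: le_trans (qD _ _) _; rewrite qN.
    lra.
  have -> : w - 2^-1 *: (u1 - u2) = 2^-1 *: ((c + w - u1) - (c - w - u2)).
    have -> : (c + w - u1) - (c - w - u2) = 2 *: w - (u1 - u2).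
      rewrite opprD opprK addrACA opprB opprB; congr (_ + _); last exact: addrC.
      by rewrite addrC addrA subrK scaler_nat mulr2n.
    by rewrite [RHS]scalerBr scalerA mulVf// scale1r.
  rewrite rnZ two ltr_pdivrMl//; apply: le_lt_trans (rnB _ _) _; lra.
pose D := 2 * m%:R / r.
have D0 : 0 <= D by rewrite /D divr_ge0 ?mulr_ge0// ltW.
have {hr} hD w e : 0 < e -> exists2 u, q u <= D * rn w & rn (w - u) < e.
  move=> e0; have [->|w0] := eqVneq w 0.
    by exists 0; rewrite ?subr0 rn0// q0 mulr0.
  have {}w0 : 0 < rn w by rewrite lt_neqAle rn_ge0 andbT eq_sym rn_eq0.
  pose t := r / (2 * rn w).
  have t0 : 0 < t by rewrite /t divr_gt0// mulr_gt0.
  have st : sabs (sreal t : scalar R k) = t by rewrite sabs_sreal gtr0_norm.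
  have sn0 : sreal t != 0 :> scalar R k by rewrite -sabs_eq0 st gt_eqF.
  have [||u qu uw] := hr (sreal t *: w) _ (e * t).
  - rewrite rnZ st /t.
    have -> : r / (2 * rn w) * rn w = r / 2 by field; rewrite gt_eqF.
    by rewrite ltr_pdivrMr// ltr_pMr// ltr1n.
  - exact: mulr_gt0.
  exists ((sreal t)^-1 *: u).
    rewrite qZ sabsV st ler_pdivrMl// (le_trans qu)//.
    suff -> : t * (D * rn w) = m%:R by [].
    rewrite /t /D; field; rewrite !gt_eqF//.
  have eqw : sreal t *: w - u = sreal t *: (w - (sreal t)^-1 *: u).
    by rewrite scalerBr scalerA divff// scale1r.
  by move: uw; rewrite eqw rnZ st mulrC ltr_pM2r.
have /choice[g hg] : forall s : V * R, exists u, 0 < s.2 ->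
    q u <= D * rn s.1 /\ rn (s.1 - u) < s.2.
  move=> [w e] /=; have [e0|e0] := pselect (0 < e); last by exists 0.
  by have [u ? ?] := hD w e e0; exists u.
exists (D * 2); first by rewrite mulr_ge0.
move=> v; have [->|v0] := eqVneq v 0; first by rewrite q0 rn0 mulr0.
have {}v0 : 0 < rn v by rewrite lt_neqAle rn_ge0 andbT eq_sym rn_eq0.
pose eps n := rn v / 2 ^+ n.
have eps0 n : 0 < eps n by rewrite /eps divr_gt0// exprn_gt0.
(* w n is what remains of v after n approximations *)
pose fix w n := if n is j.+1 then w j - g (w j, eps j.+1) else v.
have hw n : rn (w n) <= eps n.
  case: n => [|n /=]; first by rewrite /eps expr0 divr1.
  by have /= [] := hg (w n, eps n.+1) (eps0 _) => _ /ltW.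
have wE n : \sum_(i < n) g (w i, eps i.+1) = v - w n.
  elim: n => [|n ih]; first by rewrite big_ord0 subrr.
  by rewrite big_ord_recr /= ih opprB addrA addrAC.
apply: (qS (fun i => g (w i, eps i.+1))).
- move=> e e0; have : (fun n => eps n) @ \oo --> (0 : R).
    rewrite -(mulr0 (rn v)); apply: cvgMr; rewrite /eps.
    rewrite (_ : (fun n => _) = (fun n => (2^-1 : R) ^+ n)).
      by apply: cvg_expr; rewrite ger0_norm// invf_lt1// ltr1n.
    by apply/funext => n; rewrite exprVn.
  move=> /cvgr0Pnorm_lt/(_ _ e0); apply: filterS => n.
  rewrite gtr0_norm//; apply: le_lt_trans; rewrite wE opprB addrC subrK.
  exact: hw.
- move=> n; have qle i : q (g (w i, eps i.+1)) <= D * eps i.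
    have /= [h _] := hg (w i, eps i.+1) (eps0 _).
    by rewrite (le_trans h)// ler_wpM2l.
  apply: (@le_trans _ _ (D * (2 * rn v - 2 * eps n))).
    elim: n => [|n ih]; first by rewrite big_ord0 /eps expr0 divr1 subrr mulr0.
    rewrite big_ord_recr /=; apply: le_trans (lerD ih (qle n)) _.
    rewrite -mulrDr ler_wpM2l//.
    have -> : eps n = 2 * eps n.+1 by rewrite /eps exprS; field; rewrite expf_neq0.
    lra.
  by rewrite -[D * 2 * _]mulrA ler_wpM2l// gerBl mulr_ge0// ltW.
Qed.

End zabreiko.

(** * Rearrangements and bounded finite sums *)

(** A permutation of nat can be built by growing finite lists without
    repetition, provided that every integer is eventually listed. *)
Lemma bijective_of_prefixes (W : nat -> seq nat) :
  (forall k, uniq (W k)) -> (forall k, prefix (W k) (W k.+1)) ->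
  (forall k i, (i < k)%N -> i \in W k) ->
  exists2 s : nat -> nat, bijective s &
    forall k i, (i < size (W k))%N -> s i = nth 0%N (W k) i.
Proof.
move=> uW pW mW.
have pW2 k m : (k <= m)%N -> prefix (W k) (W m).
  elim: m => [|m ih]; first by rewrite leqn0 => /eqP->; exact: prefix_refl.
  rewrite leq_eqVlt => /predU1P[->|/ih]; first exact: prefix_refl.
  by move/prefix_trans; apply; exact: pW.
have nthW k m i : (k <= m)%N -> (i < size (W k))%N ->
    nth 0%N (W m) i = nth 0%N (W k) i.
  by move=> /pW2/prefixP[t ->] ik; rewrite nth_cat ik.
have szW k : (k <= size (W k))%N.
  rewrite -[leqLHS](size_iota 0); apply: uniq_leq_size; first exact: iota_uniq.
  by move=> i; rewrite mem_iota add0n /= => ik; exact: mW.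
pose s i := nth 0%N (W i.+1) i.
have sE k i : (i < size (W k))%N -> s i = nth 0%N (W k) i.
  move=> ik; rewrite /s; have [ki|ki] := leqP k i.+1; first by rewrite (nthW k).
  by rewrite (nthW i.+1 k)//; exact: ltnW.
exists s => //.
pose t j := index j (W j.+1).
have tW k j : j \in W k -> index j (W k) = t j.
  have idx a b : (a <= b)%N -> j \in W a -> index j (W b) = index j (W a).
    by move=> /pW2/prefixP[u ->] ja; rewrite index_cat ja.
  move=> jk; rewrite /t; have [kj|kj] := leqP k j.+1; first by rewrite (idx k j.+1).
  by rewrite (idx j.+1 k) ?mW//; exact: ltnW.
exists t => [i|j].
  have ik : (i < size (W i.+1))%N by exact: szW.
  by rewrite (sE i.+1)// -(tW i.+1) ?index_uniq// mem_nth.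
have jW := mW j.+1 j (leqnn _).
by rewrite (sE j.+1) /t ?nth_index// index_mem.
Qed.

Section bounded_sums.
Context {R : realType} {k : scalar_kind} {V : normedModType (scalar R k)}.

(** If finite sums were unbounded, one could append to any finite list a
    disjoint block with large sum; alternating such blocks with the integers
    not yet listed produces a rearrangement with unbounded partial sums. *)
Lemma bounded_finite_sums (z : nat -> V) :
  (forall s : nat -> nat, bijective s ->
     exists C : R, forall n, rn (\sum_(i < n) z (s i)) <= C) ->
  exists C : R, forall A : seq nat, uniq A -> rn (\sum_(i <- A) z i) <= C.
Proof.
move=> bz; apply: contrapT => no.
have big (C : R) : exists2 A : seq nat, uniq A & C < rn (\sum_(i <- A) z i).
  apply: contrapT => no2; apply: no; exists C => A uA; rewrite leNgt.
  by apply/negP => CA; apply: no2; exists A.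
have /choice[f hf] : forall s : seq nat * nat, exists A,
    [/\ uniq A, (forall i, i \in A -> i \notin s.1) &
        s.2%:R < rn (\sum_(i <- A) z i)].
  move=> [W m] /=.
  have [A uA hA] := big (m%:R + \sum_(i <- undup W) rn (z i)).
  exists [seq i <- A | i \notin W]; split.
  - exact: filter_uniq.
  - by move=> i; rewrite mem_filter => /andP[].
  rewrite big_filter -(ltrD2r (\sum_(i <- undup W) rn (z i))).
  apply: lt_le_trans hA _.
  rewrite (bigID (fun i => i \notin W))/= (le_trans (rnD _ _))// lerD2l.
  apply: le_trans (rn_sum _ _ _) _.
  rewrite -[leLHS]big_filter.
  rewrite [leLHS](_ : _ = \sum_(i <- [seq i <- undup W | i \in A]) rn (z i));
    last first.
    apply: perm_big; apply: uniq_perm; rewrite ?filter_uniq ?undup_uniq//.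
    by move=> i; rewrite !mem_filter negbK mem_undup andbC.
  rewrite [leLHS]big_filter [leRHS](bigID (fun i => i \in A))/= lerDl.
  by rewrite sumr_ge0// => i _; exact: rn_ge0.
(* W1 appends a block with sum of norm at least m, W2 the integers up to m
   that are not listed yet *)
pose W1 W m := W ++ f (W, m).
pose W2 W m := W1 W m ++ [seq i <- iota 0 m.+1 | i \notin W1 W m].
pose fix W m := if m is n.+1 then W2 (W n) n else [::].
have u1 V0 m : uniq V0 -> uniq (W1 V0 m).
  move=> uV; have [uf df _] := hf (V0, m).
  rewrite cat_uniq uV uf andbT/=; apply/hasPn => i; exact: df.
have uW m : uniq (W m).
  elim: m => // m ih.
  rewrite -[W m.+1]/(W2 (W m) m) /W2 cat_uniq u1// andTb; apply/andP; split.
    by apply/hasPn => i; rewrite mem_filter => /andP[].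
  exact/filter_uniq/(iota_uniq 0 m.+1).
have p1 m : prefix (W1 (W m) m) (W m.+1) by exact: prefix_prefix.
have pW m : prefix (W m) (W m.+1).
  by apply: prefix_trans (p1 m); exact: prefix_prefix.
have mW m i : (i < m)%N -> i \in W m.
  case: m => // m im; rewrite -[W m.+1]/(W2 (W m) m) /W2 mem_cat mem_filter.
  rewrite mem_iota add0n im andbT.
  by case: (i \in _).
have [s bs sE] := bijective_of_prefixes uW pW mW.
have sumW m A : prefix A (W m) ->
    \sum_(i < size A) z (s i) = \sum_(i <- A) z i.
  move=> /prefixP[t At]; rewrite (big_nth 0%N) big_mkord; apply: eq_bigr => i _.
  by rewrite (sE m) At ?nth_cat ?ltn_ord// size_cat ltn_addr.
have [C hC] := bz s bs.
have [m hm] : exists m : nat, C + C < m%:R.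
  by exists (Num.truncn (C + C)).+1; exact: truncnS_gt.
have := sumW _ _ (p1 m); rewrite /W1 big_cat/= -(sumW _ _ (pW m)) => e1.
have [_ _] := hf (W m, m); rewrite ltNge => /negP; apply.
rewrite /= (_ : \sum_(i <- f (W m, m)) z i =
  \sum_(i < size (W m ++ f (W m, m))) z (s i) - \sum_(i < size (W m)) z (s i)).
  by rewrite (le_trans (rnB _ _))// (le_trans (lerD (hC _) (hC _)))// ltW.
by rewrite e1 [RHS]addrC addKr.
Qed.

End bounded_sums.

(** * Series of scalars and closed spans *)

Section scalar_series.
Context {R : realType} {k : scalar_kind}.

Lemma abs_series_cvg (r : nat -> R) (C : R) : (forall n, \sum_(i < n) `|r i| <= C) ->
  exists l : R, (fun n => \sum_(i < n) r i) @ \oo --> l.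
Proof.
move=> hC; exists (limn (series r)).
have -> : (fun n => \sum_(i < n) r i) = series r.
  by apply/funext => n; rewrite seriesEord.
apply: normed_cvg.
have e n : [normed series r] n = \sum_(i < n) `|r i|.
  by rewrite /normed_series_of /series/= big_mkord.
apply: nondecreasing_is_cvgn.
  by apply/nondecreasing_seqP => n; rewrite !e big_ord_recr/= lerDl.
by exists C => _ [n _ <-]; rewrite e.
Qed.

Lemma sim_mk_sum (p q : R) (a : nat -> scalar R k) n :
  `|sim (mk_scalar p q : scalar R k) - \sum_(i < n) sim (a i)|
    <= `|q - \sum_(i < n) sim (a i)|.
Proof.
rewrite /sim /mk_scalar; case: k a => [a|a]//=.
by rewrite big1// subr0 normr0.
Qed.

(** Completeness of the scalar field, reduced to that of the reals by taking
    real and imaginary parts. *)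
Lemma scalar_series (a : nat -> scalar R k) C :
  (forall n, \sum_(i < n) sabs (a i) <= C) ->
  exists l, forall e : R, 0 < e -> \forall n \near \oo, sabs (l - \sum_(i < n) a i) < e.
Proof.
move=> hC.
have [|p hp] := @abs_series_cvg (fun i => sre (a i)) C.
  by move=> n; apply: le_trans (hC n); apply: ler_sum => i _; exact: sre_le.
have [|q hq] := @abs_series_cvg (fun i => sim (a i)) C.
  by move=> n; apply: le_trans (hC n); apply: ler_sum => i _; exact: sim_le.
exists (mk_scalar p q) => e e0.
have e2 : 0 < e / 2 by rewrite divr_gt0.
near=> n.
rewrite (le_lt_trans (sabs_le _))// [ltRHS]splitr ltrD//.
  rewrite sreD sreN sre_mk sre_sum.
  near: n; by move/cvgrPdist_lt : hp => /(_ _ e2).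
apply: (@le_lt_trans _ _ `|q - \sum_(i < n) sim (a i)|).
  by rewrite simD simN sim_sum; exact: sim_mk_sum.
near: n; by move/cvgrPdist_lt : hq => /(_ _ e2).
Unshelve. all: by end_near. Qed.

End scalar_series.

Section spans.
Context {R : realType} {k : scalar_kind} {V : normedModType (scalar R k)}.
Implicit Types x : nat -> V.

Lemma linear_span_mem x n : linear_span x (x n).
Proof.
exists n.+1, (fun i => (i == n)%:R); rewrite big_ord_recr /= eqxx scale1r.
rewrite big1 ?add0r// => i _; by rewrite (ltn_eqF (ltn_ord i)) scale0r.
Qed.

Lemma linear_span_widen x n (a : nat -> scalar R k) m : (n <= m)%N ->
  \sum_(i < n) a i *: x i = \sum_(i < m) (if (i < n)%N then a i else 0) *: x i.
Proof.
move=> nm; rewrite (big_ord_widen _ (fun i => a i *: x i) nm) big_mkcond /=.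
by apply: eq_bigr => i _; case: ifP => //; rewrite scale0r.
Qed.

Lemma linear_spanD x u v : linear_span x u -> linear_span x v ->
  linear_span x (u + v).
Proof.
move=> [n [a ->]] [m [b ->]].
rewrite (linear_span_widen x a (leq_maxl n m)).
rewrite (linear_span_widen x b (leq_maxr n m)) -big_split /=.
eexists; eexists (fun i => (if (i < n)%N then a i else 0) + (if (i < m)%N then b i else 0)).
by apply: eq_bigr => i _; rewrite scalerDl.
Qed.

Lemma linear_spanZ x c u : linear_span x u -> linear_span x (c *: u).
Proof.
move=> [n [a ->]]; exists n, (fun i => c * a i); rewrite scaler_sumr.
by apply: eq_bigr => i _; rewrite scalerA.
Qed.

Lemma linear_span_sum x (I : Type) (s : seq I) (f : I -> V) :
  (forall i, linear_span x (f i)) -> linear_span x (\sum_(i <- s) f i).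
Proof.
move=> h; elim/big_ind : _ => //; last exact: linear_spanD.
by exists 0%N, (fun=> 0); rewrite big_ord0.
Qed.

Lemma subset_closed_span x : linear_span x `<=` closed_span x.
Proof. exact: subset_closure. Qed.

Lemma closed_span_perm x s : bijective s -> closed_span (x \o s) = closed_span x.
Proof.
move=> [t st ts]; congr closure; apply/seteqP; split=> v [n [a ->]].
  apply: linear_span_sum => i; apply: linear_spanZ; exact: linear_span_mem.
apply: linear_span_sum => i; apply: linear_spanZ.
by rewrite -(ts i); exact: (linear_span_mem (x \o s)).
Qed.

Lemma closed_span_lim x u l : (forall n, closed_span x (u n)) -> rcvg u l ->
  closed_span x l.
Proof.
move=> hu ul; apply/closure_rnP => e e0.
have e2 : 0 < e / 2 by rewrite divr_gt0.
have [N _ /(_ N (leqnn N)) h] := ul _ e2.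
have /closure_rnP/(_ _ e2)[w ww uw] := hu N.
exists w => //; rewrite (_ : l - w = (l - u N) + (u N - w)).
  by rewrite (le_lt_trans (rnD _ _))// [ltRHS]splitr ltrD.
by rewrite addrA subrK.
Qed.

(** The uniform boundedness principle for operators which are not known to be
    continuous individually: Zabreiko's lemma applied to the supremum of the
    seminorms rn (T j v). *)
Lemma zabreiko_family (J : Type) (j0 : J) (T : J -> V -> V) :
  series_complete V ->
  (forall j a u v, T j (a *: u + v) = a *: T j u + T j v) ->
  (forall v, exists C : R, forall j, rn (T j v) <= C) ->
  (forall (v : nat -> V) l (b : nat -> R) C,
     rcvg (fun n => \sum_(i < n) v i) l -> (forall i j, rn (T j (v i)) <= b i) ->
     (forall n, \sum_(i < n) b i <= C) -> forall j, rn (T j l) <= C) ->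
  exists2 C : R, 0 <= C & forall v j, rn (T j v) <= C * rn v.
Proof.
move=> cV lT bT cT.
pose q v := sup [set rn (T j v) | j in setT].
have q_ub v j : rn (T j v) <= q v.
  by apply: ub_le_sup; [have [C hC] := bT v; exists C => _ [i _ <-]|exists j].
have q_le v C : (forall j, rn (T j v) <= C) -> q v <= C.
  by move=> h; apply: ge_sup; [exists (rn (T j0 v)), j0|move=> _ [i _ <-]].
have TD j u v : T j (u + v) = T j u + T j v.
  by rewrite -{1}(scale1r u) lT scale1r.
have T0 j : T j 0 = 0.
  by apply: (addrI (T j 0)); rewrite -TD !addr0.
have TZ j a u : T j (a *: u) = a *: T j u by rewrite -[a *: u]addr0 lT T0 addr0.
have q_ge0 v : 0 <= q v by rewrite (le_trans _ (q_ub v j0))// rn_ge0.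
have [|||C C0 hC] := @zabreiko R k V q cV.
- move=> u v; apply: q_le => j.
  by rewrite TD (le_trans (rnD _ _))// lerD.
- have le a v : q (a *: v) <= sabs a * q v.
    by apply: q_le => j; rewrite TZ rnZ ler_wpM2l ?sabs_ge0.
  move=> a v; apply/eqP; rewrite eq_le le /=.
  have [->|a0] := eqVneq a 0; first by rewrite sabs0 mul0r q_ge0.
  have sa0 : 0 < sabs a by rewrite lt_def sabs_ge0 sabs_eq0 a0.
  have := le a^-1 (a *: v); rewrite scalerA mulVf// scale1r sabsV.
  by rewrite ler_pdivlMl.
- move=> v l C vl hC; apply: q_le => j.
  exact: (cT v l (fun i => q (v i))).
exists C => // v j; exact: le_trans (q_ub _ _) (hC _).
Qed.

End spans.

(** * Coordinate functionals of a complemented unconditional basic sequence *)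

Section basis.
Context {R : realType} {k : scalar_kind} {V : normedModType (scalar R k)}.
Hypothesis cV : series_complete V.
Variables (x : nat -> V) (P : V -> V) (phi : nat -> V -> scalar R k).
Hypothesis P_lin : forall a u v, P (a *: u + v) = a *: P u + P v.
Hypothesis P_span : forall v, closed_span x (P v).
Hypothesis P_id : forall v, closed_span x v -> P v = v.
Hypothesis P_cont : forall u l, rcvg u l -> rcvg (P \o u) (P l).
Hypothesis phiP : forall v, rcvg (fun n => \sum_(i < n) phi i v *: x i) (P v).
Hypothesis phi_uniq : forall v (a : nat -> scalar R k),
  rcvg (fun n => \sum_(i < n) a i *: x i) (P v) -> forall i, a i = phi i v.

Lemma coord_linear i a u v : phi i (a *: u + v) = a * phi i u + phi i v.
Proof.
have := @phi_uniq (a *: u + v) (fun i => a * phi i u + phi i v).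
move=> <- //; rewrite P_lin.
rewrite (_ : (fun n => _) = (fun n => a *: (\sum_(i < n) phi i u *: x i) +
    \sum_(i < n) phi i v *: x i)).
  by apply: rcvgD => //; exact: rcvgZ.
apply/funext => n; rewrite scaler_sumr -big_split /=.
by apply: eq_bigr => j _; rewrite scalerDl scalerA.
Qed.

Let rcvg_eventually (u : nat -> V) l N : (forall n, (N <= n)%N -> u n = l) -> rcvg u l.
Proof.
by move=> h e e0; exists N => // n /= Nn; rewrite h// subrr rn0.
Qed.

Lemma span_coord n (a : nat -> scalar R k) i : phi i (\sum_(j < n) a j *: x j) = if (i < n)%N then a i else 0.
Proof.
rewrite -(@phi_uniq _ (fun i => if (i < n)%N then a i else 0))//.
rewrite P_id; last by apply: subset_closed_span; exists n, a.
apply: (@rcvg_eventually _ _ n) => m nm.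
by rewrite [RHS](linear_span_widen x a nm).
Qed.

Lemma coord_basis i j : phi i (x j) = (i == j)%:R.
Proof.
have <- : \sum_(l < j.+1) (l == j :> nat)%:R *: x l = x j.
  rewrite big_ord_recr /= eqxx scale1r big1 ?add0r// => l _.
  by rewrite (ltn_eqF (ltn_ord l)) scale0r.
rewrite (span_coord j.+1 (fun l => (l == j)%:R)) ltnS.
by case: ltngtP.
Qed.

Lemma basis_neq0 i : x i != 0.
Proof.
apply/eqP => xi0; have := coord_basis i i; rewrite xi0 eqxx.
have -> : phi i 0 = 0.
  by have := span_coord 0 (fun=> 0) i; rewrite big_ord0.
by move/esym/eqP; rewrite oner_eq0.
Qed.

Let rx i : 0 < rn (x i).
Proof. by rewrite lt_def rn_ge0 rn_eq0 basis_neq0. Qed.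

Let psum n v := \sum_(i < n) phi i v *: x i.

Let psum_lin n a u v : psum n (a *: u + v) = a *: psum n u + psum n v.
Proof.
rewrite /psum scaler_sumr -big_split /=; apply: eq_bigr => i _.
by rewrite coord_linear scalerDl scalerA.
Qed.

Let coord_sum i m (v : nat -> V) : phi i (\sum_(j < m) v j) = \sum_(j < m) phi i (v j).
Proof.
elim: m => [|m ih].
  by have := span_coord 0 (fun=> 0) i; rewrite !big_ord0.
by rewrite !big_ord_recr /= addrC -[v m]scale1r coord_linear ih scale1r mul1r addrC.
Qed.

Let psum_sum n m (v : nat -> V) : psum n (\sum_(j < m) v j) = \sum_(j < m) psum n (v j).
Proof.
rewrite /psum exchange_big /=; apply: eq_bigr => i _.
by rewrite coord_sum scaler_suml.
Qed.

Let psum_sub (v : nat -> V) (b : nat -> R) n m m' : (forall i j, rn (psum j (v i)) <= b i) ->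
  (m <= m')%N ->
  rn (psum n (\sum_(j < m') v j) - psum n (\sum_(j < m) v j)) <=
  \sum_(j < m') b j - \sum_(j < m) b j.
Proof.
move=> hb mm'; rewrite !psum_sum -(subnKC mm').
rewrite !big_split_ord /= addrAC subrr add0r addrAC subrr add0r.
by apply: le_trans (rn_sum _ _ _) _; apply: ler_sum => i _.
Qed.

(** The supremum of the partial sum norms is countably subadditive: absolute
    convergence makes every coordinate series converge, and the limits are the
    coordinates of P l by uniqueness of expansions. *)
Let psum_csub (v : nat -> V) l (b : nat -> R) C :
     rcvg (fun n => \sum_(i < n) v i) l -> (forall i j, rn (psum j (v i)) <= b i) ->
     (forall n, \sum_(i < n) b i <= C) -> forall j, rn (psum j l) <= C.
Proof.
move=> vl hb hC.
have b0 i : 0 <= b i by rewrite (le_trans _ (hb i 0%N))// rn_ge0.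
have /choice[A hA] : forall i, exists a : scalar R k, forall e : R, 0 < e ->
    \forall m \near \oo, sabs (a - \sum_(j < m) phi i (v j)) < e.
  move=> i; apply: (@scalar_series R k (fun j => phi i (v j)) ((C + C) / rn (x i))) => n.
  rewrite ler_pdivlMr// mulr_suml.
  apply: (@le_trans _ _ (\sum_(j < n) (b j + b j))); last first.
    by rewrite big_split /=; apply: lerD; exact: hC.
  apply: ler_sum => j _; rewrite -rnZ.
  have -> : phi i (v j) *: x i = psum i.+1 (v j) - psum i (v j).
    by rewrite /psum big_ord_recr /= [RHS]addrC addKr.
  by rewrite (le_trans (rnB _ _))// lerD.
pose B n := \sum_(i < n) A i *: x i.
pose L m := \sum_(j < m) v j.
have LB n : rcvg (fun m => psum n (L m)) (B n).
  elim: n => [|n ih].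
    by apply: (@rcvg_eventually _ _ 0%N) => m _; rewrite /psum /B !big_ord0.
  rewrite (_ : (fun m => _) =
      (fun m => psum n (L m) + (\sum_(j < m) phi n (v j)) *: x n)); last first.
    by apply/funext => m; rewrite /psum big_ord_recr /= coord_sum.
  rewrite [B _]big_ord_recr /=; apply: rcvgD ih _ => e e0.
  have := hA n (e / rn (x n)); rewrite divr_gt0// => /(_ isT).
  by apply: filterS => m; rewrite -scalerBl rnZ ltr_pdivlMr.
have [s hs] : exists s : R, (fun n => \sum_(i < n) b i) @ \oo --> s.
  apply: (@abs_series_cvg _ _ C) => n.
  by under eq_bigr do rewrite ger0_norm//.
have s_ub m : \sum_(i < m) b i <= s.
  have nd : {homo (fun n => \sum_(i < n) b i) : n m / (n <= m)%N >-> n <= m}.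
    by apply/nondecreasing_seqP => n; rewrite big_ord_recr /= lerDl.
  have cs : cvgn (fun n => \sum_(i < n) b i) by apply/cvg_ex; exists s.
  by rewrite -(cvg_lim (@Rhausdorff R) hs); exact: nondecreasing_cvgn_le nd cs m.
have tail n m : rn (B n - psum n (L m)) <= s - \sum_(i < m) b i.
  apply: (@rcvg_le _ _ _ (fun m' => psum n (L m') - psum n (L m))).
    move=> e e0; have := LB n e e0; apply: filterS => m'.
    by rewrite opprB addrA subrK.
  exists m => // m' /= mm'; apply: le_trans (psum_sub _ hb mm') _.
  by rewrite lerD2r.
have BP : rcvg B (P l).
  move=> e e0.
  have e3 : 0 < e / 3 by rewrite divr_gt0.
  have [m [h1 h2]] : exists m, rn (P l - P (L m)) < e / 3 /\ s - \sum_(i < m) b i < e / 3.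
    near \oo => m; exists m; split; near: m; first exact: (P_cont vl).
    move/cvgrPdist_lt : hs => /(_ _ e3); apply: filterS => m.
    by apply: le_lt_trans; exact: ler_norm.
  have := phiP (L m) e3; apply: filterS => n h3.
  rewrite (_ : P l - B n = (P l - P (L m)) + ((P (L m) - psum n (L m)) - (B n - psum n (L m)))).
    have h4 := tail n m.
    apply: le_lt_trans (rnD _ _) _.
    have h5 := rnB (P (L m) - psum n (L m)) (B n - psum n (L m)).
    rewrite -/(psum n _) in h3; lra.
  by rewrite opprB !addrA !subrK.
have phiA i : phi i l = A i by rewrite -(phi_uniq BP).
move=> n; rewrite (_ : psum n l = B n); last by apply: eq_bigr => i _; rewrite phiA.
apply: (rcvg_le (LB n)); exists 0%N => // m _.
rewrite psum_sum; apply: le_trans (rn_sum _ _ _) _.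
by apply: le_trans (hC m); apply: ler_sum.
Unshelve. all: by end_near. Qed.

(** The partial sum operators composed with the projection are uniformly
    bounded on the whole space; their continuity is part of the conclusion. *)
Lemma basis_constant : exists2 C : R, 0 <= C &
  forall v n, rn (\sum_(i < n) phi i v *: x i) <= C * rn v.
Proof.
apply: (zabreiko_family 0%N cV psum_lin) psum_csub.
by move=> v; exact: rcvg_bounded (phiP v).
Qed.

Lemma coord_bounded i : exists2 C : R, 0 <= C & forall v, sabs (phi i v) <= C * rn v.
Proof.
have [C C0 hC] := basis_constant.
exists ((C + C) / rn (x i)); first by rewrite divr_ge0 ?addr_ge0// rn_ge0.
move=> v; rewrite mulrAC ler_pdivlMr// -rnZ.
have -> : phi i v *: x i = psum i.+1 v - psum i v.
  by rewrite /psum big_ord_recr /= [RHS]addrC addKr.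
rewrite (le_trans (rnB _ _))// mulrDl; apply: lerD; exact: hC.
Qed.

Lemma coord_cont i u l : rcvg u l -> forall e : R, 0 < e ->
  \forall n \near \oo, sabs (phi i l - phi i (u n)) < e.
Proof.
move=> ul e e0; have [C C0 hC] := coord_bounded i.
have := ul (e / (C + 1)); rewrite divr_gt0 ?ltr_wpDl// => /(_ isT).
apply: filterS => n; rewrite ltr_pdivlMr ?ltr_wpDl// => h.
have -> : phi i l - phi i (u n) = phi i (l - u n).
  have -> : l - u n = -1 *: u n + l by rewrite scaleN1r addrC.
  by rewrite coord_linear mulN1r addrC.
apply: le_lt_trans (hC _) _; apply: le_lt_trans _ h.
by rewrite mulrC ler_wpM2l ?rn_ge0// lerDl.
Qed.

Hypothesis x_unc : unconditional x.

(** A rearranged basis expands P v with some coefficients; continuity of the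
    coordinates identifies them with the phi (s i) v, so all rearranged
    partial sums are bounded. *)
Lemma perm_expansion v (s : nat -> nat) : bijective s ->
  exists C : R, forall n, rn (\sum_(i < n) phi (s i) v *: x (s i)) <= C.
Proof.
move=> bs; have [t st ts] := bs.
have [_ /(_ (P v))] := x_unc bs.
rewrite closed_span_perm// => /(_ (@P_span v))[b [/rcvgP hb _]].
suff bE i : b i = phi (s i) v.
  have [C hC] := rcvg_bounded hb.
  by exists C => n; under eq_bigr do rewrite -bE; exact: hC.
have Pv j : phi j (P v) = phi j v.
  apply: (@phi_uniq v (fun j => phi j (P v))).
  by have := @phiP (P v); rewrite (P_id (@P_span v)).
apply/eqP; rewrite -subr_eq0 -sabs_eq0 eq_le sabs_ge0 andbT.
apply/ler_addgt0Pr => e e0; rewrite add0r.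
have [N _ h] := coord_cont (s i) hb e0.
have /= := h (maxn N i.+1) (leq_maxl _ _).
rewrite Pv.
have -> : phi (s i) (\sum_(j < maxn N i.+1) b j *: (x \o s) j) = b i.
  rewrite (coord_sum (s i) _ (fun j => b j *: (x \o s) j)).
  have im : (i < maxn N i.+1)%N by rewrite leq_maxr.
  have phiZ j a u : phi j (a *: u) = a * phi j u := functionalZ a u (coord_linear j).
  rewrite (bigD1 (Ordinal im))//= phiZ coord_basis eqxx mulr1 big1 ?addr0// => j ji.
  rewrite phiZ coord_basis (inj_eq (can_inj st)).
  by move: ji; rewrite -val_eqE /= eq_sym => /negPf->; rewrite mulr0.
by rewrite -sabsN opprB => /ltW.
Qed.

(** Boundedness of all rearranged partial sums gives boundedness of all finite
    sums for each v, hence a uniform bound by [zabreiko_family]; a signed sum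
    is a difference of two such sums. *)
Lemma unconditional_constant : exists2 C : R, 0 <= C & forall (A : seq nat) (e : nat -> bool) v, uniq A ->
  rn (\sum_(i <- A) (-1) ^+ (e i) *: (phi i v *: x i)) <= C * rn v.
Proof.
have phi_sum (A : seq nat) a u v : \sum_(i <- A) phi i (a *: u + v) *: x i =
    a *: \sum_(i <- A) phi i u *: x i + \sum_(i <- A) phi i v *: x i.
  rewrite scaler_sumr -big_split /=; apply: eq_bigr => i _.
  by rewrite coord_linear scalerDl scalerA.
pose T (A : {A : seq nat | uniq A}) v := \sum_(i <- val A) phi i v *: x i.
have [|||C C0 hC] := @zabreiko_family _ _ _ _ (exist _ [::] isT) T cV.
- by move=> A a u v; exact: phi_sum.
- move=> v; have [|C hC] := @bounded_finite_sums _ _ _ (fun i => phi i v *: x i).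
    by move=> s bs; exact: perm_expansion.
  by exists C => -[A uA]; exact: hC.
- move=> v l b C vl hb hC A.
  apply: (@rcvg_le _ _ _ (fun m => T A (\sum_(j < m) v j))).
    move=> e e0; rewrite /T.
    have : forall A : seq nat, rcvg (fun m => \sum_(i <- A) phi i (\sum_(j < m) v j) *: x i)
       (\sum_(i <- A) phi i l *: x i).
      elim=> [|i B ih].
        by apply: (@rcvg_eventually _ _ 0%N) => m _; rewrite !big_nil.
      rewrite big_cons; under eq_fun do rewrite big_cons.
      apply: rcvgD ih => d d0.
      have := coord_cont i vl (divr_gt0 d0 (rx i)).
      by apply: filterS => m; rewrite -scalerBl rnZ ltr_pdivlMr.
    by apply.
  exists 0%N => // m _; apply: le_trans (hC m).
  elim: m => [|m ih].
    rewrite !big_ord0 /T big1 ?rn0// => i _.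
    by have := span_coord 0 (fun=> 0) i; rewrite big_ord0 => ->; rewrite scale0r.
  rewrite !big_ord_recr /= [leRHS]addrC.
  have -> : \sum_(j < m) v j + v m = 1 *: v m + \sum_(j < m) v j.
    by rewrite scale1r addrC.
  rewrite /T phi_sum scale1r.
  by apply: le_trans (rnD _ _) _; apply: lerD (hb m A) ih.
exists (C + C); first exact: addr_ge0.
move=> A e v uA.
have eA : \sum_(i <- A) (-1) ^+ e i *: (phi i v *: x i) =
  \sum_(i <- [seq i <- A | ~~ e i]) phi i v *: x i -
  \sum_(i <- [seq i <- A | e i]) phi i v *: x i.
  rewrite !big_filter (bigID e) /= addrC -sumrN; congr (_ + _).
    by apply: eq_bigr => i /negPf->; rewrite expr0 scale1r.
  by apply: eq_bigr => i ->; rewrite expr1 scaleN1r.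
have hT (B : seq nat) (uB : uniq B) : rn (\sum_(i <- B) phi i v *: x i) <= C * rn v.
  exact: (hC v (exist (fun B : seq nat => is_true (uniq B)) B uB)).
rewrite eA mulrDl (le_trans (rnB _ _))//.
by apply: lerD; apply: hT; exact: filter_uniq.
Qed.

End basis.

Section coordinates.
Context {R : realType} {k : scalar_kind} {V : normedModType (scalar R k)}.
Implicit Types x : nat -> V.

(** The coordinates are those of P v, so that they are defined on the whole
    space; this extension is what the complementation hypothesis is for. *)
Lemma unconditional_coordinates x : series_complete V ->
  basic_sequence x -> complemented x -> unconditional x ->
  exists (phi : nat -> V -> scalar R k), exists2 C : R, 0 <= C &
  [/\ forall i a u v, phi i (a *: u + v) = a * phi i u + phi i v,
      forall i j, phi i (x j) = (i == j)%:R,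
      forall v, closed_span x v -> rcvg (fun n => \sum_(i < n) phi i v *: x i) v &
      forall (A : seq nat) (e : nat -> bool) v, uniq A ->
        rn (\sum_(i <- A) (-1) ^+ (e i) *: (phi i v *: x i)) <= C * rn v].
Proof.
move=> cV [xY basis_x] [P [cP PP rP]] unc.
have P_span v : closed_span x (P v) by rewrite -rP; exists v.
have P_id v : closed_span x v -> P v = v.
  by rewrite -rP => -[w _ <-]; exact: PP.
have P_cont u l : rcvg u l -> rcvg (P \o u) (P l).
  by move=> /rcvgP ul; apply/rcvgP; exact: (cvg_comp _ _ ul (cP l)).
have /choice[c hc] : forall v, exists a : nat -> scalar R k,
    rcvg (fun n => \sum_(i < n) a i *: x i) (P v) /\
    forall b : nat -> scalar R k, rcvg (fun n => \sum_(i < n) b i *: x i) (P v) -> b = a.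
  move=> v; have [a [/rcvgP ha ua]] := basis_x _ (P_span v).
  by exists a; split=> // b /rcvgP hb; rewrite (ua b).
pose phi i v := c v i.
have P_lin a u v : P (a *: u + v) = a *: P u + P v by rewrite linearP.
have phiP v : rcvg (fun n => \sum_(i < n) phi i v *: x i) (P v) by exact: (hc v).1.
have phi_uniq v (a : nat -> scalar R k) :
    rcvg (fun n => \sum_(i < n) a i *: x i) (P v) -> forall i, a i = phi i v.
  by move=> /(hc v).2 ->.
have [C C0 hC] := unconditional_constant cV P_lin P_span P_id P_cont phiP phi_uniq unc.
exists phi, C => //; split=> //.
- exact: coord_linear P_lin phiP phi_uniq.
- exact: coord_basis P_id phi_uniq.
- by move=> v Yv; rewrite -[X in rcvg _ X](P_id v).
Qed.

End coordinates.

(** * Equivalence of sequences *)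

Section equivalences.
Context {R : realType} {k : scalar_kind} {V W : normedModType (scalar R k)}.
Implicit Types (x : nat -> V) (y : nat -> W).

Lemma closed_spanP x a u v : closed_span x u -> closed_span x v ->
  closed_span x (a *: u + v).
Proof.
move=> /closure_rnP hu /closure_rnP hv; apply/closure_rnP => e e0.
have e2 : 0 < e / 2 by rewrite divr_gt0.
have a1 : 0 < sabs a + 1 by rewrite ltr_wpDl// sabs_ge0.
have [w1 s1 h1] := hu (e / 2 / (sabs a + 1)) (divr_gt0 e2 a1).
have [w2 s2 h2] := hv (e / 2) e2.
exists (a *: w1 + w2); first by apply: linear_spanD => //; exact: linear_spanZ.
rewrite opprD addrACA -scalerBr (le_lt_trans (rnD _ _))// [ltRHS]splitr ltr_leD ?ltW//.
move: h1; rewrite ltr_pdivlMr ?ltr_wpDl ?sabs_ge0// rnZ; apply: le_lt_trans.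
by rewrite mulrC ler_wpM2l ?rn_ge0// lerDl.
Qed.

Lemma linear_on_sum x (T : V -> W) n (a : nat -> scalar R k) :
  linear_on (closed_span x) T ->
  T (\sum_(i < n) a i *: x i) = \sum_(i < n) a i *: T (x i).
Proof.
move=> lT; have m0 : closed_span x 0.
  by apply: subset_closed_span; exists 0%N, (fun=> 0); rewrite big_ord0.
have T0 : T 0 = 0.
  by have := lT 1 0 0 m0 m0; rewrite !scale1r addr0 => /eqP; rewrite -subr_eq0 opprD addrA subrr add0r oppr_eq0 => /eqP.
elim: n => [|n ih]; first by rewrite !big_ord0.
rewrite !big_ord_recr /= addrC lT.
- by rewrite ih addrC.
- by apply: subset_closed_span; exact: linear_span_mem.
- by apply: subset_closed_span; exists n, a.
Qed.

Lemma equivalent_bound x y : equivalent x y ->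
  exists2 C : R, 0 < C & forall n (a : nat -> scalar R k),
    rn (\sum_(i < n) a i *: y i) <= C * rn (\sum_(i < n) a i *: x i).
Proof.
move=> [T [T' [lT _ _ [cT _] Tx]]].
have m0 : closed_span x 0.
  by apply: subset_closed_span; exists 0%N, (fun=> 0); rewrite big_ord0.
have T0 : T 0 = 0.
  by have := linear_on_sum 0 (fun=> 0) lT; rewrite !big_ord0.
have TZ a v : closed_span x v -> T (a *: v) = a *: T v.
  by move=> hv; rewrite -[a *: v]addr0 lT// T0 addr0.
(* continuity at 0 and homogeneity bound T on the span *)
have [d d0 hd] : exists2 d : R, 0 < d & forall v, closed_span x v -> rn v < d -> rn (T v) < 1.
  move/subspace_continuousP : cT => /(_ 0 m0)/cvgrPdist_lt/(_ 1 ltr01).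
  rewrite near_withinE => /nbhs_ballP[_ /= /gt0_sreal[r r0 ->] h].
  exists r => // v sv vr.
  have := h v; rewrite -ball_normE /= sub0r normrN rnE sreal_lt => /(_ vr sv).
  by rewrite (_ : T _ - _ = - T v) ?normrN ?rnE -?(@sreal1 R k) ?sreal_lt ?T0 ?sub0r.
exists (2 / d); first by rewrite divr_gt0.
move=> n a.
have -> : \sum_(i < n) a i *: y i = T (\sum_(i < n) a i *: x i).
  by rewrite linear_on_sum//; apply: eq_bigr => i _; rewrite Tx.
have : closed_span x (\sum_(i < n) a i *: x i).
  by apply: subset_closed_span; exists n, a.
move: (\sum_(i < n) a i *: x i) => v sv.
have [->|v0] := eqVneq v 0; first by rewrite T0 !rn0 mulr0.
have {}v0 : 0 < rn v by rewrite lt_neqAle rn_ge0 andbT eq_sym rn_eq0.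
pose t := d / 2 / rn v.
have t0 : 0 < t by rewrite /t !divr_gt0.
have st : sabs (sreal t : scalar R k) = t by rewrite sabs_sreal gtr0_norm.
have sn0 : sreal t != 0 :> scalar R k by rewrite -sabs_eq0 st gt_eqF.
have /= := hd (sreal t *: v).
have sv' : closed_span x (sreal t *: v) by rewrite -[_ *: v]addr0; exact: closed_spanP.
move=> /(_ sv'); rewrite TZ// !rnZ st.
have -> : t * rn v = d / 2 by rewrite /t divfK// gt_eqF.
rewrite ltr_pdivrMr// ltr_pMr// ltr1n => /(_ isT) /ltW.
rewrite mulrC -ler_pdivlMr// => /le_trans; apply.
suff -> : 1 / t = 2 / d * rn v by [].
by rewrite /t; field; rewrite !gt_eqF.
Qed.

(** A two-sided bound on the closed span makes T injective with closed range;
    the range contains the linear span of y, and each point of the closed span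
    of y is the image of the sum of an absolutely convergent series. *)
Lemma equivalent_of_iso x y (T : V -> W) (D : R) : series_complete V -> 0 < D ->
  (forall a u v, T (a *: u + v) = a *: T u + T v) ->
  (forall v, closed_span x v -> rn (T v) <= D * rn v) ->
  (forall v, closed_span x v -> rn v <= D * rn (T v)) ->
  (forall n, T (x n) = y n) -> equivalent x y.
Proof.
move=> cV D0 lT bT bT' Tx.
have TB u v : T (u - v) = T u - T v.
  by rewrite addrC -scaleN1r lT scaleN1r addrC.
have sB u v : closed_span x u -> closed_span x v -> closed_span x (u - v).
  by move=> su sv; rewrite addrC -scaleN1r; exact: closed_spanP.
have m0 : closed_span x 0.
  by apply: subset_closed_span; exists 0%N, (fun=> 0); rewrite big_ord0.
have Tsum n (a : nat -> scalar R k) : T (\sum_(i < n) a i *: x i) = \sum_(i < n) a i *: y i.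
  rewrite (@linear_on_sum x)//; first by apply: eq_bigr => i _; rewrite Tx.
have T_span v : closed_span x v -> closed_span y (T v).
  move=> sv; apply/closure_rnP => e e0.
  have /closure_rnP/(_ (e / D))[|w [n [a wE]] vw] := sv; first exact: divr_gt0.
  have sw : closed_span x w by apply: subset_closed_span; exists n, a.
  exists (T w); first by rewrite wE Tsum; exists n, a.
  rewrite -TB (le_lt_trans (bT _ _))//; first exact: sB.
  by rewrite mulrC -ltr_pdivlMr.
have T_surj w : closed_span y w -> exists2 v, closed_span x v & T v = w.
  move=> /closure_rnP sw.
  have /choice[f hf] : forall j : nat, exists v, linear_span x v /\ rn (w - T v) < 2^-1 ^+ j.
    move=> j; have [|u [n [a ->]] h] := sw (2^-1 ^+ j); first by rewrite exprn_gt0.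
    by exists (\sum_(i < n) a i *: x i); rewrite Tsum; split=> //; exists n, a.
  have sf j : closed_span x (f j) by apply: subset_closed_span; exact: (hf j).1.
  have step j : rn (f j.+1 - f j) <= D * 2 * (2^-1 ^+ j).
    apply: le_trans (bT' _ _) _; first exact: sB.
    rewrite -mulrA ler_wpM2l ?(ltW D0)// TB.
    rewrite (_ : T (f j.+1) - T (f j) = (w - T (f j)) - (w - T (f j.+1))).
      apply: le_trans (rnB _ _) _.
      have h1 := (hf j).2; have h2 := (hf j.+1).2.
      have h3 : 2^-1 ^+ j.+1 <= 2^-1 ^+ j :> R.
        by rewrite exprS ler_piMl ?exprn_ge0// invf_le1// ler1n.
      by rewrite mulr2n mulrDl mul1r; lra.
    by rewrite opprB [RHS]addrC addrA subrK.
  have [|l hl] := cV (fun j => f j.+1 - f j).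
    exists (D * 2 * 2) => n; apply: (@le_trans _ _ (D * 2 * (2 - 2 * 2^-1 ^+ n))).
      elim: n => [|n ih]; first by rewrite big_ord0 expr0 mulr1 subrr mulr0.
      rewrite big_ord_recr /= (le_trans (lerD ih (step n)))// -mulrDr ler_wpM2l//.
        by rewrite mulr_ge0// ltW.
      by rewrite exprS; lra.
    rewrite ler_wpM2l//; first by rewrite mulr_ge0// ltW.
    by rewrite gerBl mulr_ge0// exprn_ge0.
  have {}hl : rcvg f (f 0%N + l).
    move=> e /hl; apply: filterS => n.
    by rewrite -(big_mkord xpredT (fun i => f i.+1 - f i)) telescope_sumr// opprB addrA [l + _]addrC.
  exists (f 0%N + l); first exact: closed_span_lim hl.
  have sl : closed_span x (f 0%N + l) by exact: closed_span_lim hl.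
  apply/eqP; rewrite -subr_eq0 -rn_eq0 eq_le rn_ge0 andbT.
  apply/ler_addgt0Pr => e e0; rewrite add0r.
  near \oo => n.
  rewrite (_ : T _ - w = T (f 0%N + l - f n) - (w - T (f n))); last first.
    by rewrite TB opprB addrA subrK.
  apply: le_trans (rnB _ _) _; rewrite [leRHS]splitr lerD//.
    apply: le_trans (bT _ _) _; first exact: sB.
    rewrite mulrC -ler_pdivlMr// ltW//; near: n; apply: hl.
    by rewrite !divr_gt0.
  apply: (le_trans (ltW (hf n).2)); near: n.
  have : (fun n => 2^-1 ^+ n) @ \oo --> (0 : R).
    by apply: cvg_expr; rewrite ger0_norm// invf_lt1// ltr1n.
  move=> /cvgr0Pnorm_le/(_ _ (divr_gt0 e0 (ltr0Sn R 1))); apply: filterS => n.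
  by rewrite ger0_norm// exprn_ge0.
pose T' w : V := if pselect (closed_span y w) is left h then projT1 (cid2 (T_surj w h)) else 0.
have T'P w : closed_span y w -> closed_span x (T' w) /\ T (T' w) = w.
  by move=> sw; rewrite /T'; case: pselect => // h; case: (cid2 (T_surj w h)).
have T_inj u v : closed_span x u -> closed_span x v -> T u = T v -> u = v.
  move=> su sv uv; apply/eqP; rewrite -subr_eq0 -rn_eq0 eq_le rn_ge0 andbT.
  by apply: le_trans (bT' _ (sB _ _ su sv)) _; rewrite TB uv subrr rn0 mulr0.
exists T, T'; split=> //.
- by split=> // w /T'P[].
- split=> v; rewrite inE => sv; last by have [] := T'P v sv.
  have [s1 s2] := T'P _ (T_span v sv); exact: T_inj.
- split; apply/subspace_continuousP => u su; apply/cvgrPdist_lt => _ /gt0_sreal[e e0 ->].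
    rewrite near_withinE; apply/nbhs_ballP; exists (sreal (e / D)).
      by rewrite /= sreal_gt0 divr_gt0.
    move=> v; rewrite -ball_normE /= rnE sreal_lt ltr_pdivlMr// => uv sv.
    by rewrite rnE sreal_lt -TB (le_lt_trans (bT _ (sB _ _ su sv)))// mulrC.
  rewrite near_withinE; apply/nbhs_ballP; exists (sreal (e / D)).
    by rewrite /= sreal_gt0 divr_gt0.
  move=> v; rewrite -ball_normE /= rnE sreal_lt ltr_pdivlMr// => uv sv.
  have [s1 e1] := T'P _ su; have [s2 e2] := T'P _ sv.
  rewrite rnE sreal_lt (le_lt_trans (bT' _ (sB _ _ s1 s2)))// TB e1 e2 mulrC//.
Unshelve. all: by end_near. Qed.

End equivalences.

(** * Equivalence with the unit vectors of a sequence space *)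

Section classes.
Context {R : realType} {k : scalar_kind} {E : lmodType (scalar R k)}.
Variable p : eseminorm E.
Implicit Types u v : E.

(** Total, so that classes can be written before the seminorm is known to be
    finite. *)
Definition cls u : nspace p :=
  if pselect (u \in finite_part p) is left h then nclass h else 0.

Lemma nclass_cls u (h : u \in finite_part p) : nclass h = cls u.
Proof.
by rewrite /cls; case: pselect => // h'; congr nclass; exact: bool_irrelevance.
Qed.

Lemma rn_cls u : u \in finite_part p -> rn (cls u) = fine (p u).
Proof.
move=> h; rewrite -(nclass_cls h) /rn.
rewrite [X in sabs X](_ : _ = sreal (fine (p u))).
  by rewrite sabs_sreal ger0_norm// fine_ge0// esn_ge0.
exact: (nnorm_pi (exist _ u h : finite_sub p)).
Qed.

Lemma finite_part_lin a u v : u \in finite_part p -> v \in finite_part p ->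
  a *: u + v \in finite_part p.
Proof. by move=> hu hv; rewrite rpredD// rpredZ. Qed.

Lemma cls_lin a u v : u \in finite_part p -> v \in finite_part p ->
  cls (a *: u + v) = a *: cls u + cls v.
Proof.
move=> hu hv; have huv := finite_part_lin a hu hv.
rewrite -!nclass_cls /nclass.
rewrite [X in _ = X + _](pi_nscale a (exist _ u hu : finite_sub p)) -raddfD.
congr (\pi_(nspace p) _)%qT; apply: val_inj; apply: esym.
exact: (linearP (val : finite_sub p -> E) a (exist _ u hu) (exist _ v hv)).
Qed.

Lemma cls0 : cls 0 = 0.
Proof.
have h0 : 0 \in finite_part p by exact: rpred0.
by have := cls_lin 1 h0 h0; rewrite !scale1r addr0 => /eqP; rewrite -subr_eq0 opprD addrA subrr add0r oppr_eq0 => /eqP.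
Qed.

Lemma finite_part_sum (I : Type) (s : seq I) (a : I -> scalar R k) (f : I -> E) :
  (forall i, f i \in finite_part p) -> \sum_(i <- s) a i *: f i \in finite_part p.
Proof. by move=> h; apply: rpred_sum => i _; rewrite rpredZ. Qed.

Lemma cls_sum (I : Type) (s : seq I) (a : I -> scalar R k) (f : I -> E) :
  (forall i, f i \in finite_part p) ->
  cls (\sum_(i <- s) a i *: f i) = \sum_(i <- s) a i *: cls (f i).
Proof.
move=> h; elim: s => [|i s ih]; first by rewrite !big_nil cls0.
by rewrite !big_cons cls_lin ?ih// finite_part_sum.
Qed.

Lemma cls_rep (w : nspace p) : exists2 u, u \in finite_part p & w = cls u.
Proof.
exists (val (repr w)); first exact: valP.
rewrite -(nclass_cls (valP (repr w))) /nclass -[LHS]reprK; congr (\pi_(nspace p) _)%qT.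
exact: val_inj.
Qed.

End classes.

Section sequence_spaces.
Context {R : realType} {k : scalar_kind}.
Variable p : eseminorm (nat -> scalar R k).
Hypothesis p_dom : esn_dom p = setT.
Hypothesis p_unit : forall n, @unit_seq R k n \in finite_part p.

Definition trunc n (a : nat -> scalar R k) : nat -> scalar R k :=
  fun i => if (i < n)%N then a i else 0.

Hypothesis p_mono : forall n a, (p (trunc n a) <= p a)%E.
Hypothesis p_fatou : forall a (C : R), (forall n, (p (trunc n a) <= C%:E)%E) ->
  (p a <= C%:E)%E.

Lemma truncE n a : trunc n a = \sum_(i < n) a i *: unit_seq k i.
Proof.
apply/funext => j; rewrite fct_sumE /trunc.
have ev (i : nat) : (a i *: unit_seq k i) j = a i * (j == i)%:R by [].
case: ifP => jn.
  rewrite (bigD1 (Ordinal jn))//= big1 ?addr0 => [|i].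
    by rewrite ev eqxx mulr1.
  by rewrite -val_eqE /= ev eq_sym => /negPf ->; rewrite mulr0.
rewrite big1// => i _; rewrite ev.
by case: eqP => [ji|]; rewrite ?mulr0//; move: jn; rewrite ji ltn_ord.
Qed.

Lemma trunc_fin n a : trunc n a \in finite_part p.
Proof. by rewrite truncE; exact: finite_part_sum. Qed.

(** The map sending v to the sequence of its coordinates is the required
    isomorphism; it suffices to compare norms on finite combinations, because
    p of a sequence is controlled by p of its truncations and v is the limit
    of its partial sums. *)
Lemma equivalent_unit_basis (V : normedModType (scalar R k)) (x : nat -> V)
    (phi : nat -> V -> scalar R k) (C D : R) : series_complete V ->
  (forall i a u v, phi i (a *: u + v) = a * phi i u + phi i v) ->
  (forall i j, phi i (x j) = (i == j)%:R) ->
  (forall v, closed_span x v -> rcvg (fun n => \sum_(i < n) phi i v *: x i) v) ->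
  (forall n v, rn (\sum_(i < n) phi i v *: x i) <= C * rn v) ->
  0 <= C -> 0 <= D ->
  (forall n (a : nat -> scalar R k), rn (\sum_(i < n) a i *: x i) <= D * fine (p (trunc n a))) ->
  (forall n (a : nat -> scalar R k), fine (p (trunc n a)) <= D * rn (\sum_(i < n) a i *: x i)) ->
  equivalent x (fun n => nclass (p_unit n)).
Proof.
move=> cV phi_lin phi_x phi_cvg phi_bd C0 D0 lower upper.
pose T v : nspace p := cls p (fun i => phi i v).
have pT v : (p (fun i => phi i v) <= (D * (C * rn v))%:E)%E.
  apply: p_fatou => n.
  rewrite -[leLHS]fineK; last exact/finite_part_fin/trunc_fin.
  rewrite lee_fin (le_trans (upper _ _))// ler_wpM2l//.
have fT v : (fun i => phi i v) \in finite_part p.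
  apply/finite_partP; split; first by rewrite p_dom.
  exact: le_lt_trans (pT v) (ltry _).
have rnT v : rn (T v) = fine (p (fun i => phi i v)) by rewrite rn_cls.
apply: (@equivalent_of_iso _ _ _ _ _ _ T (D * C + D + 1)) => //.
- by rewrite ltr_wpDl// addr_ge0// mulr_ge0.
- by move=> a u v; rewrite -cls_lin//; congr cls; apply/funext => i; rewrite phi_lin.
- move=> v _; rewrite rnT; apply: (@le_trans _ _ (D * C * rn v)).
    by rewrite -mulrA -lee_fin fineK// finite_part_fin.
  by rewrite ler_wpM2r ?rn_ge0// -addrA lerDl addr_ge0.
- move=> v sv; apply: (@le_trans _ _ (D * rn (T v))); last first.
    by rewrite ler_wpM2r ?rn_ge0// addrAC lerDr addr_ge0// mulr_ge0.
  apply: (rcvg_le (phi_cvg v sv)); exists 0%N => // n _.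
  apply: le_trans (lower n (fun i => phi i v)) _; rewrite ler_wpM2l// rnT fine_le//.
    exact/finite_part_fin/trunc_fin.
  exact: finite_part_fin.
- move=> n; rewrite nclass_cls; congr cls; apply/funext => i.
  by rewrite phi_x.
Qed.

End sequence_spaces.

(** * Averages over signs *)

Definition upd (e : nat -> bool) n b : nat -> bool :=
  fun i => if i == n then b else e i.

(** The average over the signs of the first n indices. The recursion
    substitutes the value of the last index first, so that identities follow
    by induction on n. *)
Fixpoint savg (K : numFieldType) (L : lmodType K) n (f : (nat -> bool) -> L) : L :=
  if n is m.+1
  then savg m (fun e => 2^-1 *: (f (upd e m false) + f (upd e m true)))
  else f (fun=> false).

Section sign_average.
Context {K : numFieldType} {L : lmodType K}.
Implicit Types f g : (nat -> bool) -> L.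

Lemma eq_savg n f g : f =1 g -> savg n f = savg n g.
Proof. by move=> /funext ->. Qed.

Lemma savgS n f : savg n.+1 f =
  savg n (fun e => 2^-1 *: (f (upd e n false) + f (upd e n true))).
Proof. by []. Qed.

Lemma savgD n f g : savg n (fun e => f e + g e) = savg n f + savg n g.
Proof.
elim: n f g => //= n ih f g; rewrite -ih; apply: eq_savg => e.
by rewrite -scalerDr addrACA.
Qed.

Lemma half_double (v : L) : 2^-1 *: (v + v) = v.
Proof. by rewrite -[v + v]/(v *+ 2) -[v *+ 2]scaler_nat scalerA mulVf ?scale1r// pnatr_eq0. Qed.

Lemma savg_cst n (v : L) : savg n (fun=> v) = v.
Proof.
elim: n => //= n ih; rewrite -[RHS]ih; apply: eq_savg => e; exact: half_double.
Qed.

Lemma savgZ n a f : savg n (fun e => a *: f e) = a *: savg n f.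
Proof.
elim: n f => //= n ih f; rewrite -ih; apply: eq_savg => e.
by rewrite -scalerDr scalerA mulrC -scalerA.
Qed.

Lemma sign_updE (e : nat -> bool) n b i : (i < n)%N -> upd e n b i = e i.
Proof. by rewrite /upd => /ltn_eqF ->. Qed.

Lemma sign_upd (e : nat -> bool) n b : upd e n b n = b.
Proof. by rewrite /upd eqxx. Qed.

(** The off-diagonal terms carry a sign that averages to zero. *)
Lemma savg_diagonal n (z : nat -> nat -> L) :
  savg n (fun e => \sum_(i < n) \sum_(j < n)
    ((-1) ^+ (e i) * (-1) ^+ (e j)) *: z i j) = \sum_(i < n) z i i.
Proof.
elim: n => [|n ih]; first by rewrite /= !big_ord0.
rewrite savgS big_ord_recr /= -ih -[z n n](savg_cst n) -savgD.
apply: eq_savg => e.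
have h b : \sum_(i < n.+1) \sum_(j < n.+1)
      ((-1) ^+ (upd e n b i) * (-1) ^+ (upd e n b j)) *: z i j =
    \sum_(i < n) \sum_(j < n) ((-1) ^+ (e i) * (-1) ^+ (e j)) *: z i j + z n n +
    (-1) ^+ b *: \sum_(i < n) (-1) ^+ (e i) *: (z i n + z n i).
  transitivity (\sum_(i < n) (\sum_(j < n) ((-1) ^+ (e i) * (-1) ^+ (e j)) *: z i j +
      (-1) ^+ b *: ((-1) ^+ (e i) *: z i n)) +
    (\sum_(j < n) (-1) ^+ b *: ((-1) ^+ (e j) *: z n j) + z n n)).
    rewrite big_ord_recr /=; congr (_ + _).
      apply: eq_bigr => i _; rewrite big_ord_recr /= sign_upd sign_updE//.
      rewrite [in RHS]scalerA [in RHS]mulrC; congr (_ + _).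
      by apply: eq_bigr => j _; rewrite sign_updE.
    rewrite big_ord_recr /= sign_upd -expr2 sqrr_sign scale1r; congr (_ + _).
    by apply: eq_bigr => j _; rewrite sign_updE// scalerA.
  rewrite big_split /= -!scaler_sumr.
  have -> : \sum_(i < n) (-1) ^+ (e i) *: (z i n + z n i) =
      \sum_(i < n) (-1) ^+ (e i) *: z i n + \sum_(i < n) (-1) ^+ (e i) *: z n i.
    by rewrite -big_split; apply: eq_bigr => i _; rewrite scalerDr.
  by rewrite scalerDr -!addrA; congr (_ + _); rewrite addrA addrC.
rewrite !h expr0 expr1 scale1r scaleN1r addrACA subrr addr0.
exact: half_double.
Qed.

End sign_average.

Section real_sign_average.
Context {R : realType}.
Implicit Types f g : (nat -> bool) -> R.

Lemma le_savg n f g : (forall e, f e <= g e) ->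
  savg n (f : _ -> R^o) <= savg n (g : _ -> R^o).
Proof.
elim: n f g => [|n ih] f g fg /=; first exact: fg.
apply: ih => e; rewrite -[_ *: _]/(_ * _) -[leRHS]/(_ * _) ler_wpM2l//.
by apply: lerD; exact: fg.
Qed.

(** Jensen's inequality for the norm. *)
Lemma rn_savg (k : scalar_kind) (V : normedModType (scalar R k)) n
    (f : (nat -> bool) -> V) :
  rn (savg n f) <= savg n ((fun e => rn (f e)) : _ -> R^o).
Proof.
elim: n f => [|n ih] f /=; first exact: lexx.
apply: le_trans (ih _) _; apply: le_savg => e.
rewrite rnZ -[leRHS]/(_ * _).
have -> : (2 : scalar R k) = sreal 2.
  by rewrite -[2 in RHS]/(1 + 1) srealD sreal1.
by rewrite sabsV sabs_sreal ger0_norm// ler_wpM2l// rnD.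
Qed.

Lemma savg_le n f C : (forall e, f e <= C) -> savg n (f : _ -> R^o) <= C.
Proof. by move=> h; apply: le_trans (le_savg n h) _; rewrite savg_cst. Qed.

Lemma savg_ge0 n f : (forall e, 0 <= f e) -> 0 <= savg n (f : _ -> R^o).
Proof. by move=> h; apply: le_trans (le_savg n h); rewrite savg_cst. Qed.

Definition ssum (c : nat -> R) n (e : nat -> bool) : R :=
  \sum_(i < n) (-1) ^+ (e i) * c i.

Lemma ssum_upd c n e b : ssum c n.+1 (upd e n b) = ssum c n e + (-1) ^+ b * c n.
Proof.
rewrite /ssum big_ord_recr /= sign_upd; congr (_ + _).
by apply: eq_bigr => i _; rewrite sign_updE.
Qed.

Lemma savg_ssum2 (c : nat -> R) n :
  savg n ((fun e => ssum c n e ^+ 2) : _ -> R^o) = \sum_(i < n) c i ^+ 2.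
Proof.
elim: n => [|n ih]; first by rewrite /= /ssum !big_ord0 expr0n.
rewrite savgS big_ord_recr /= -ih -[X in _ = _ + X](@savg_cst _ R^o n) -savgD.
apply: eq_savg => e; rewrite !ssum_upd expr0 expr1.
by rewrite -[LHS]/(_ * _); field.
Qed.

(** The fourth moment of a sum of independent signs is 3 s^2 minus twice the
    sum of the c_i^4, where s is the sum of the c_i^2. *)
Lemma savg_ssum4 (c : nat -> R) n :
  savg n ((fun e => ssum c n e ^+ 4) : _ -> R^o) <= 3 * (\sum_(i < n) c i ^+ 2) ^+ 2.
Proof.
elim: n => [|n ih]; first by rewrite /= /ssum !big_ord0 !expr0n mulr0.
rewrite savgS.
have -> : savg n ((fun e => 2^-1 *: (ssum c n.+1 (upd e n false) ^+ 4 +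
     ssum c n.+1 (upd e n true) ^+ 4)) : _ -> R^o) =
   savg n ((fun e => ssum c n e ^+ 4) : _ -> R^o) +
   (6 * c n ^+ 2 * \sum_(i < n) c i ^+ 2 + c n ^+ 4).
  rewrite -[X in _ = _ + X](@savg_cst _ R^o n) -savgD.
  transitivity (savg n ((fun e => ssum c n e ^+ 4 +
     (6 * c n ^+ 2) *: (ssum c n e ^+ 2 : R^o) + c n ^+ 4) : _ -> R^o)).
    apply: eq_savg => e; rewrite !ssum_upd expr0 expr1.
    by rewrite -[LHS]/(_ * _) -[(6 * _) *: _]/(_ * _); field.
  by rewrite !savgD savgZ savg_ssum2 !savg_cst addrA.
apply: le_trans (lerD ih (lexx _)) _.
rewrite big_ord_recr /=; set s := \sum_(i < n) _.
have h : 0 <= c n ^+ 4 by rewrite exprn_even_ge0.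
rewrite -subr_ge0.
have -> : 3 * (s + c n ^+ 2) ^+ 2 - (3 * s ^+ 2 + (6 * c n ^+ 2 * s + c n ^+ 4)) =
  2 * c n ^+ 4 by ring.
by rewrite mulr_ge0.
Qed.

(** The pointwise inequality t^2 <= 4/3 t s + t^4 / (12 s^2), tangent at t = 2
    s, turns the second and fourth moments into a lower bound for the first
    moment. *)
Lemma khinchine_real (c : nat -> R) n :
  9 / 16 * Num.sqrt (\sum_(i < n) c i ^+ 2) <=
  savg n ((fun e => `|ssum c n e|) : _ -> R^o).
Proof.
set s2 := \sum_(i < n) _; pose s := Num.sqrt s2.
have s2_ge0 : 0 <= s2 by rewrite sumr_ge0// => i _; rewrite sqr_ge0.
have sE : s ^+ 2 = s2 by rewrite sqr_sqrtr.
have [->|s0] := eqVneq s2 0.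
  by rewrite sqrtr0 mulr0; apply: savg_ge0.
rewrite -/s; have {}s0 : 0 < s by rewrite sqrtr_gt0 lt_def s0.
have poly (t : R) : 0 <= t -> t ^+ 2 <= 4 / 3 * t * s + t ^+ 4 / (12 * s ^+ 2).
  move=> t0; rewrite -subr_ge0.
  have -> : 4 / 3 * t * s + t ^+ 4 / (12 * s ^+ 2) - t ^+ 2 =
    t * (t - 2 * s) ^+ 2 * (t + 4 * s) / (12 * s ^+ 2) by field; rewrite gt_eqF.
  have h4 : 0 <= 4 * s by rewrite mulr_ge0 ?ltW.
  apply: divr_ge0; apply: mulr_ge0 => //; last exact: sqr_ge0.
    by apply: mulr_ge0 => //; exact: sqr_ge0.
  exact: addr_ge0.
have h : s2 <= 4 / 3 * s * savg n ((fun e => `|ssum c n e|) : _ -> R^o) +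
    savg n ((fun e => ssum c n e ^+ 4) : _ -> R^o) / (12 * s ^+ 2).
  rewrite -[leLHS](savg_ssum2 c n).
  apply: (@le_trans _ _ (savg n ((fun e => (4 / 3 * s) *: (`|ssum c n e| : R^o) +
      (12 * s ^+ 2)^-1 *: (ssum c n e ^+ 4 : R^o)) : _ -> R^o))).
    apply: le_savg => e; have := poly `|ssum c n e| (normr_ge0 _).
    rewrite real_normK ?num_real// (_ : `|_| ^+ 4 = ssum c n e ^+ 4); last first.
      by rewrite -[4%N]/(2 * 2)%N !exprM real_normK ?num_real.
    by rewrite -[_ *: _]/(_ * _) -[X in _ -> _ <= _ + X]/(_ * _) mulrAC [_ / (12 * _)]mulrC.
  by rewrite savgD !savgZ -[_ *: _]/(_ * _) -[X in _ + X <= _]/(_ * _) [_ * savg _ _ in X in _ + X <= _]mulrC.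
have h4 := savg_ssum4 c n.
have h2 : savg n ((fun e => ssum c n e ^+ 4) : _ -> R^o) / (12 * s ^+ 2) <= s2 / 4.
  rewrite ler_pdivrMr ?mulr_gt0 ?exprn_gt0//.
  by apply: le_trans h4 _; rewrite -/s2 sE; lra.
have h3 : 3 / 4 * s * s <= 4 / 3 * s * savg n ((fun e => `|ssum c n e|) : _ -> R^o).
  by rewrite -mulrA -expr2 sE; lra.
move: h3; set a := savg n _; rewrite [4 / 3 * s]mulrC [3 / 4 * s]mulrC -!mulrA ler_pM2l//.
by lra.
Qed.

End real_sign_average.

Section scalar_sign_average.
Context {R : realType} {k : scalar_kind}.
Implicit Types c : nat -> scalar R k.

Lemma sre_sign (b : bool) (z : scalar R k) : sre ((-1) ^+ b * z) = (-1) ^+ b * sre z.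
Proof. by case: b; rewrite ?expr0 ?expr1 ?mul1r ?mulN1r ?sreN. Qed.

Lemma sim_sign (b : bool) (z : scalar R k) : sim ((-1) ^+ b * z) = (-1) ^+ b * sim z.
Proof. by case: b; rewrite ?expr0 ?expr1 ?mul1r ?mulN1r ?simN. Qed.

Definition signed_sum c n (e : nat -> bool) : scalar R k :=
  \sum_(i < n) (-1) ^+ (e i) * c i.

Lemma sre_signed_sum c n e :
  sre (signed_sum c n e) = ssum (fun i => sre (c i)) n e.
Proof. by rewrite sre_sum; apply: eq_bigr => i _; rewrite sre_sign. Qed.

Lemma sim_signed_sum c n e :
  sim (signed_sum c n e) = ssum (fun i => sim (c i)) n e.
Proof. by rewrite sim_sum; apply: eq_bigr => i _; rewrite sim_sign. Qed.

Lemma sabs_sqr (z : scalar R k) : sabs z ^+ 2 = sre z ^+ 2 + sim z ^+ 2.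
Proof. by rewrite sabs_sqrt sqr_sqrtr// addr_ge0// sqr_ge0. Qed.

Lemma savg_signed_sum2 c n :
  savg n ((fun e => sabs (signed_sum c n e) ^+ 2) : _ -> R^o) =
  \sum_(i < n) sabs (c i) ^+ 2.
Proof.
under [RHS]eq_bigr do rewrite sabs_sqr.
rewrite big_split /= -(savg_ssum2 (fun i => sre (c i))) -(savg_ssum2 (fun i => sim (c i))).
by rewrite -savgD; apply: eq_savg => e; rewrite sabs_sqr sre_signed_sum sim_signed_sum.
Qed.

(** Khinchine's inequality for scalars, from the real one for real and
    imaginary parts. *)
Lemma khinchine c n : Num.sqrt (\sum_(i < n) sabs (c i) ^+ 2) <=
  4 * savg n ((fun e => sabs (signed_sum c n e)) : _ -> R^o).
Proof.
set s := savg n _.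
have s0 : 0 <= s by apply: savg_ge0 => e; exact: sabs_ge0.
have h1 : 9 / 16 * Num.sqrt (\sum_(i < n) sre (c i) ^+ 2) <= s.
  apply: le_trans (khinchine_real (fun i => sre (c i)) n) _; apply: le_savg => e.
  by rewrite -sre_signed_sum sre_le.
have h2 : 9 / 16 * Num.sqrt (\sum_(i < n) sim (c i) ^+ 2) <= s.
  apply: le_trans (khinchine_real (fun i => sim (c i)) n) _; apply: le_savg => e.
  by rewrite -sim_signed_sum sim_le.
have h3 : Num.sqrt (\sum_(i < n) sabs (c i) ^+ 2) <=
    Num.sqrt (\sum_(i < n) sre (c i) ^+ 2) + Num.sqrt (\sum_(i < n) sim (c i) ^+ 2).
  rewrite -[leRHS]ger0_norm ?addr_ge0// -sqrtr_sqr ler_wsqrtr// sqrrD.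
  under eq_bigr do rewrite sabs_sqr.
  rewrite big_split /= !sqr_sqrtr ?sumr_ge0//; try by move=> i _; rewrite sqr_ge0.
  by rewrite lerD2r lerDl mulrn_wge0// mulr_ge0.
by lra.
Qed.

Lemma le_sqrt_of_sqr (a b : R) : 0 <= b -> a ^+ 2 <= b -> a <= Num.sqrt b.
Proof.
move=> b0 ab; rewrite (le_trans (ler_norm _))// -sqrtr_sqr ler_wsqrtr//.
Qed.

End scalar_sign_average.

Section diagonal_estimate.
Context {R : realType} {k : scalar_kind} {V : normedModType (scalar R k)}.

(** Projecting an operator onto its diagonal: the sum of the phi_i(w_i) x_i is
    the sign average of the double sums of e_i e_j phi_i(w_j) x_i, and each
    double sum is a signed coordinate sum of the vector \sum_j e_j w_j. *)
Lemma diagonal_estimate (x : nat -> V) (phi : nat -> V -> scalar R k) (C : R) :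
  (forall i a u v, phi i (a *: u + v) = a * phi i u + phi i v) ->
  (forall (A : seq nat) (e : nat -> bool) v, uniq A ->
      rn (\sum_(i <- A) (-1) ^+ (e i) *: (phi i v *: x i)) <= C * rn v) ->
  forall n (w : nat -> V), rn (\sum_(i < n) phi i (w i) *: x i) <=
    savg n ((fun e => C * rn (\sum_(j < n) (-1) ^+ (e j) *: w j)) : _ -> R^o).
Proof.
move=> phi_lin phi_unc n w.
have phi0 i : phi i 0 = 0 := functional0 (phi_lin i).
have phi_sum i m (a : nat -> scalar R k) :
    phi i (\sum_(j < m) a j *: w j) = \sum_(j < m) a j * phi i (w j).
  elim: m => [|m ih]; first by rewrite !big_ord0.
  by rewrite !big_ord_recr /= addrC phi_lin ih addrC.
rewrite -(savg_diagonal n (fun i j => phi i (w j) *: x i)).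
apply: le_trans (rn_savg _ _) _; apply: le_savg => e.
apply: le_trans (phi_unc (iota 0 n) e _ (iota_uniq 0 n)).
have -> : iota 0 n = index_iota 0 n by rewrite /index_iota subn0.
rewrite big_mkord.
rewrite le_eqVlt; apply/orP; left; apply/eqP; congr rn.
apply: eq_bigr => i _; rewrite (phi_sum i n (fun j => (-1) ^+ e j)) scaler_suml scaler_sumr.
by apply: eq_bigr => j _; rewrite !scalerA mulrA.
Qed.

End diagonal_estimate.

(** * The Luxemburg norm of real functions *)

Section modular.
Context {R : realType}.
Variable F : orlicz R.
Implicit Types g h : R -> R.

Local Notation mu := (@lebesgue_measure R).
Definition unit_itv : set R := `[0%R, 1%R[%classic.
Local Notation I01 := unit_itv.

(** The functions to which the modular and the norm are applied. *)
Definition nnmeas g := (forall x, 0 <= g x) /\ measurable_fun I01 g.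

Lemma measurable_unit_itv : measurable I01.
Proof. exact: measurable_itv. Qed.
Local Hint Resolve measurable_unit_itv : core.

Lemma measurable_orlicz_comp g : nnmeas g -> measurable_fun I01 (fun x => F (g x)).
Proof.
move=> [g0 mg].
rewrite (_ : (fun x => _) = (fun t => F (Num.max 0 t)) \o g).
  exact: measurableT_comp (measurable_orlicz F) mg.
by apply/funext => x /=; rewrite max_r.
Qed.

Lemma nnmeasZ c g : 0 <= c -> nnmeas g -> nnmeas (fun x => c * g x).
Proof.
move=> c0 [g0 mg]; split=> [x|]; first by rewrite mulr_ge0.
exact: measurable_funM.
Qed.

Lemma nnmeasV c g : 0 <= c -> nnmeas g -> nnmeas (fun x => g x / c).
Proof.
move=> c0 hg; rewrite (_ : (fun x => _) = (fun x => c^-1 * g x)).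
  by apply: nnmeasZ => //; rewrite invr_ge0.
by apply/funext => x; rewrite mulrC.
Qed.

Lemma nnmeasD g h : nnmeas g -> nnmeas h -> nnmeas (fun x => g x + h x).
Proof.
by move=> [g0 mg] [h0 mh]; split=> [x|]; [rewrite addr_ge0|exact: measurable_funD].
Qed.

Lemma nnmeas0 : nnmeas (fun=> 0).
Proof. by split=> //; exact: measurable_cst. Qed.

Lemma nnmeas_sum (I : Type) (s : seq I) (g : I -> R -> R) :
  (forall i, nnmeas (g i)) -> nnmeas (fun x => \sum_(i <- s) g i x).
Proof.
move=> hg; elim: s => [|i s ih].
  by under eq_fun do rewrite big_nil; exact: nnmeas0.
by under eq_fun do rewrite big_cons; exact: nnmeasD.
Qed.

Lemma modular_le g h : nnmeas g -> nnmeas h -> (forall x, I01 x -> g x <= h x) ->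
  (LF_modular F g <= LF_modular F h)%E.
Proof.
move=> hg hh gh; apply: ge0_le_integral => //.
- by move=> x _; rewrite orlicz_ge0//; exact: hg.1.
- exact: measurable_orlicz_comp.
- exact: measurable_orlicz_comp.
- by move=> x Ix; apply: orlicz_nd; [exact: hg.1|exact: gh].
Qed.

(** The Luxemburg norm on nonnegative real functions: the norm of L_F is LN of
    the modulus, whatever the scalars are. *)
Definition LN g : \bar R := luxemburg (LF_modular F) g.

Lemma LN_ge0 g : (0 <= LN g)%E. Proof. exact: luxemburg_ge0. Qed.

Lemma LN_le g h : nnmeas g -> nnmeas h -> (forall x, I01 x -> g x <= h x) ->
  (LN g <= LN h)%E.
Proof.
move=> hg hh gh; apply: le_ereal_inf => _ [t [t0 ht] <-]; exists t => //; split=> //.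
apply: le_trans _ ht; apply: modular_le; try by apply: nnmeasV => //; exact: ltW.
by move=> x Ix; rewrite ler_wpM2r ?gh// invr_ge0 ltW.
Qed.

Lemma LN_lt_modular g c : nnmeas g -> (LN g < c%:E)%E ->
  (LF_modular F (fun x => g x / c)%R <= 1)%E.
Proof.
move=> hg /ereal_inf_lt[_ [t [t0 ht] <-]]; rewrite lte_fin => tc.
have c0 : 0 < c by exact: lt_trans tc.
apply: le_trans _ ht; apply: modular_le; try by apply: nnmeasV => //; exact: ltW.
by move=> x Ix; rewrite ler_wpM2l ?hg.1// lef_pV2// ltW.
Qed.

Lemma modular_cst0 : LF_modular F (fun=> 0) = 0%E.
Proof. by rewrite /LF_modular orlicz0 integral0. Qed.

Lemma LNZ c g : 0 <= c -> LN (fun x => c * g x) = (c%:E * LN g)%E.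
Proof. by move=> c0; apply: luxemburgZ => //; rewrite modular_cst0. Qed.

Lemma LN0 : LN (fun=> 0) = 0%E.
Proof. by apply: luxemburg0; rewrite modular_cst0. Qed.

(** A nonnegative function is its own modulus, so the triangle inequality of
    L_F over the reals applies. *)
Lemma LND g h : nnmeas g -> nnmeas h ->
  (LN (fun x => g x + h x)%R <= LN g + LN h)%E.
Proof.
move=> [g0 mg] [h0 mh].
have e (f : R -> R) : (forall x, 0 <= f x) ->
    LF_norm F (f : R -> scalar R RealScalars) = LN f.
  by move=> f0; congr luxemburg; apply/funext => x; rewrite /sabs /= ger0_norm.
have m (f : R -> R) : measurable_fun I01 f ->
    scalar_measurable (k := RealScalars) I01 f.
  by move=> mf; split=> //; exact: measurable_cst.
rewrite -!e//; last by move=> x; rewrite addr_ge0.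
exact: (LF_normD F (m _ mg) (m _ mh)).
Qed.

Lemma LN_sum (I : Type) (s : seq I) (g : I -> R -> R) : (forall i, nnmeas (g i)) ->
  (LN (fun x => \sum_(i <- s) g i x)%R <= \sum_(i <- s) LN (g i))%E.
Proof.
move=> hg; elim: s => [|i s ih].
  by under [X in LN X]eq_fun do rewrite big_nil; rewrite big_nil LN0.
under [X in LN X]eq_fun do rewrite big_cons; rewrite big_cons.
apply: le_trans (LND (hg i) (nnmeas_sum s hg)) _; exact: leeD2l.
Qed.

(** Fatou property: the modular passes to the limit by monotone convergence.
    Only domination up to factors theta < 1 is assumed of the h m, and this
    loss is absorbed by enlarging tau to tau + e. *)
Lemma LN_fatou g (h : nat -> R -> R) (tau : R) : nnmeas g -> (forall m, nnmeas (h m)) ->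
  (forall m x, I01 x -> h m x <= h m.+1 x) ->
  (forall x theta, I01 x -> 0 < theta -> theta < 1 -> exists m, theta * g x <= h m x) ->
  0 <= tau -> (forall m, (LN (h m) <= tau%:E)%E) -> (LN g <= tau%:E)%E.
Proof.
move=> hg hh h_nd h_lim tau0 h_le; apply/lee_addgt0Pr => e e0; rewrite -EFinD.
pose t := tau + e / 2; pose theta := t / (tau + e).
have t0 : 0 < t by rewrite ltr_wpDl// divr_gt0.
have te0 : 0 < tau + e by rewrite ltr_wpDl.
have th0 : 0 < theta by rewrite divr_gt0.
have th1 : theta < 1.
  by rewrite ltr_pdivrMr// mul1r ltrD2l ltr_pdivrMr// ltr_pMr// ltr1n.
apply: luxemburg_le => //.
have mono x : I01 x -> {homo (fun m => F (h m x / t)) : m n / (m <= n)%N >-> (m <= n)%E}.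
  move=> Ix; apply/nondecreasing_seqP => m.
  apply: orlicz_nd; first by rewrite divr_ge0 ?(hh m).1// ltW.
  by rewrite ler_wpM2r ?h_nd// invr_ge0 ltW.
have mh m : measurable_fun I01 (fun x => F (h m x / t)).
  by apply: measurable_orlicz_comp; apply: nnmeasV; rewrite ?ltW.
have Fh0 m x : I01 x -> (0 <= F (h m x / t)%R)%E.
  by move=> Ix; rewrite orlicz_ge0// divr_ge0 ?(hh m).1// ltW.
apply: (@le_trans _ _ (\int[mu]_(x in I01) limn (fun m => F (h m x / t)%R))%E).
  apply: ge0_le_integral => //.
  - by move=> x Ix; rewrite orlicz_ge0// divr_ge0 ?hg.1// ltW.
  - by apply: measurable_orlicz_comp; apply: nnmeasV; rewrite ?ltW.
  - apply: (emeasurable_fun_cvg (fun m x => F (h m x / t))) => // x Ix.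
    exact: ereal_nondecreasing_is_cvgn (mono x Ix).
  - move=> x Ix; have [m hm] := h_lim x theta Ix th0 th1.
    apply: (@le_trans _ _ (F (h m x / t))); last first.
      rewrite (cvg_lim _ (ereal_nondecreasing_cvgn (mono x Ix)))//.
      by apply: ereal_sup_ubound; exists m.
    apply: orlicz_nd; first by rewrite divr_ge0 ?hg.1// ltW.
    rewrite ler_pdivlMr//; apply: le_trans hm.
    by rewrite /theta mulrAC [g x * t]mulrC mulrAC.
rewrite (monotone_convergence mu measurable_unit_itv mh Fh0); last first.
  by move=> x Ix m n; exact: mono.
apply: lime_le.
  apply: ereal_nondecreasing_is_cvgn => m n mn; apply: ge0_le_integral => //.
  - by move=> x Ix; exact: Fh0.
  - exact: mh.
  - exact: mh.
  - by move=> x Ix; exact: (mono x Ix _ _ mn).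
apply: nearW => m; apply: LN_lt_modular => //; apply: le_lt_trans (h_le m) _.
by rewrite lte_fin ltrDl divr_gt0.
Qed.

End modular.

(** * Norm estimates from the growth of the Orlicz function *)

Lemma measurable_nat_of_bool (R : realType) (D : set R) (b : R -> bool) :
  measurable_fun D b -> measurable_fun D (fun x => (b x)%:R : R).
Proof.
move=> mb.
have m : measurable_fun [set: bool] (fun c : bool => c%:R : R) by [].
exact: measurableT_comp m mb.
Qed.

Section finite_orlicz_functions.
Context {R : realType}.
Variable F : orlicz R.
Hypothesis finF : finite_orlicz F.
Implicit Types g h : R -> R.
Local Notation mu := (@lebesgue_measure R).
Local Notation I01 := (@unit_itv R).

Definition oreal (t : R) : R := fine (F t).

Lemma orealE t : 0 <= t -> F t = (oreal t)%:E.
Proof. by move=> t0; rewrite fineK// ge0_fin_numE ?finF// orlicz_ge0. Qed.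

Lemma oreal_ge0 t : 0 <= t -> 0 <= oreal t.
Proof. by move=> t0; rewrite fine_ge0// orlicz_ge0. Qed.

Lemma oreal0 : oreal 0 = 0. Proof. by rewrite /oreal orlicz0. Qed.

Lemma oreal_nd s t : 0 <= s -> s <= t -> oreal s <= oreal t.
Proof.
move=> s0 st; have t0 := le_trans s0 st.
by rewrite -lee_fin -!orealE//; exact: orlicz_nd.
Qed.

Lemma oreal_convex a s t : 0 <= a <= 1 -> 0 <= s -> 0 <= t ->
  oreal (a * s + (1 - a) * t) <= a * oreal s + (1 - a) * oreal t.
Proof.
move=> /[dup] a01 /andP[a0 a1] s0 t0.
rewrite -lee_fin EFinD !EFinM -!orealE//; first exact: orlicz_convex.
by rewrite addr_ge0 ?mulr_ge0 ?subr_ge0.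
Qed.

Lemma oreal_scale a t : 0 <= a <= 1 -> 0 <= t -> oreal (a * t) <= a * oreal t.
Proof.
move=> a01 t0; have := oreal_convex a01 t0 (lexx 0).
by rewrite oreal0 !mulr0 !addr0.
Qed.

Hypothesis decF : essentially_decreasing (fun t : R => fine (F t) * t ^- 2).

(** If F vanished on [0, 1], the growth condition would make it vanish
    everywhere. *)
Lemma oreal1_gt0 : 0 < oreal 1.
Proof.
rewrite lt_def oreal_ge0// andbT; apply/eqP => F10.
have [C hC] := decF; have [t t0 /eqP] := orlicz_neq0 F; apply.
rewrite orealE//; congr EFin; apply/eqP; rewrite eq_le oreal_ge0// andbT.
have [t1|t1] := leP t 1; first by rewrite -F10 oreal_nd.
have := hC 1 t (lexx _) (ltW t1); rewrite -!/(oreal _) F10 mul0r mulr0.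
by rewrite pmulr_lle0// invr_gt0 exprn_gt0// (lt_trans ltr01).
Qed.

Lemma oreal_gt0 t : 1 <= t -> 0 < oreal t.
Proof. by move=> t1; apply: lt_le_trans oreal1_gt0 (oreal_nd ler01 t1). Qed.

Lemma oreal_ge_linear t : 1 <= t -> t * oreal 1 <= oreal t.
Proof.
move=> t1; have t0 : 0 < t by apply: lt_le_trans t1.
have := @oreal_scale t^-1 t; rewrite mulVf ?gt_eqF// => h.
rewrite mulrC -ler_pdivlMr// mulrC; apply: h; last exact: ltW.
by rewrite invr_ge0 ltW//= invf_le1.
Qed.

(** The growth condition is a Delta_2 condition of power type 2 at infinity.
    *)
Lemma oreal_delta2 : exists2 C : R, 1 <= C & forall l s, 1 <= l -> 1 <= s ->
  oreal (l * s) <= C * l ^+ 2 * oreal s.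
Proof.
have [C hC] := decF; exists C.
  have := hC 1 1 (lexx _) (lexx _); rewrite -!/(oreal _) expr1n invr1 mulr1.
  by rewrite -{1}[oreal 1]mul1r ler_pM2r// oreal1_gt0.
move=> l s l1 s1.
have s0 : 0 < s by apply: lt_le_trans s1.
have l0 : 0 < l by apply: lt_le_trans l1.
have := hC s (l * s) s1; rewrite ler_peMl ?(ltW s0)// => /(_ isT).
rewrite -!/(oreal _) mulrA ler_pdivrMr ?exprn_gt0 ?mulr_gt0// => /le_trans; apply.
rewrite le_eqVlt; apply/orP; left; apply/eqP; field; rewrite gt_eqF//.
Qed.

Lemma oreal_quadratic : exists2 C : R, 0 < C & forall t, 0 <= t ->
  oreal t <= C * (1 + t ^+ 2).
Proof.
have [C C1 hC] := oreal_delta2; have C0 : 0 < C by apply: lt_le_trans C1.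
exists (C * oreal 1); first by rewrite mulr_gt0// oreal1_gt0.
move=> t t0; have F1 := oreal1_gt0; have [t1|/ltW t1] := leP t 1.
  apply: le_trans (oreal_nd t0 t1) _; rewrite -[leLHS]mul1r -mulrA.
  apply: ler_pM => //; first exact: ltW.
  by rewrite ler_pMr// lerDl sqr_ge0.
have := hC t 1 t1 (lexx _); rewrite mulr1 => /le_trans; apply.
rewrite mulrAC ler_wpM2l ?mulr_ge0 ?ltW//.
by rewrite ltrDr.
Qed.

Lemma mu_unit_itv : mu I01 = 1%E.
Proof. by rewrite /unit_itv lebesgue_measure_itv /= lte_fin ltr01 oppr0 adde0. Qed.

Lemma unit_measurable : measurable I01. Proof. exact: measurable_itv. Qed.
Local Hint Resolve unit_measurable : core.

Lemma nnmeas_EFin g : nnmeas g -> measurable_fun I01 (EFin \o g).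
Proof. by move=> [g0 mg]; exact/measurable_EFinP. Qed.

(** Convexity makes F grow at least linearly, so L_F embeds in L_1. *)
Lemma LN_L1 : exists2 C : R, 0 < C & forall g (c : R), nnmeas g -> 0 <= c ->
  (LN F g <= c%:E)%E -> (\int[mu]_(x in I01) (g x)%:E <= (C * c)%:E)%E.
Proof.
have F1 := oreal1_gt0.
exists (1 + (oreal 1)^-1); first by rewrite addr_gt0// invr_gt0.
set C := 1 + _; have C0 : 0 < C by rewrite addr_gt0// invr_gt0.
suff h g (c : R) : nnmeas g -> 0 < c -> (LN F g < c%:E)%E ->
    (\int[mu]_(x in I01) (g x)%:E <= (C * c)%:E)%E.
  move=> g c hg c0 gc; apply/lee_addgt0Pr => e e0; rewrite -EFinD.
  have -> : C * c + e = C * (c + e / C) by field; rewrite gt_eqF.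
  have eC : 0 < e / C by rewrite divr_gt0.
  apply: h => //; first by rewrite ltr_wpDl.
  by apply: le_lt_trans gc _; rewrite lte_fin ltrDl.
move=> hg c0 /(LN_lt_modular hg) h.
have pt x : (g x)%:E = (c%:E * (g x / c)%:E)%E by rewrite -EFinM mulrC divfK// gt_eqF.
under eq_integral do rewrite pt.
have hgc : nnmeas (fun x => g x / c) by apply: nnmeasV => //; exact: ltW.
rewrite ge0_integralZl//; last 3 first.
- exact: (nnmeas_EFin hgc).
- by move=> x _; rewrite lee_fin; exact: hgc.1.
- by rewrite lee_fin ltW.
rewrite mulrC EFinM; apply: lee_wpmul2l; first by rewrite lee_fin ltW.
apply: (@le_trans _ _ (\int[mu]_(x in I01) (1 + (oreal 1)^-1%:E * F (g x / c)%R))%E).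
  apply: ge0_le_integral => //.
  - by move=> x _; rewrite lee_fin; exact: hgc.1.
  - exact: (nnmeas_EFin hgc).
  - apply: emeasurable_funD => //; apply: measurable_funeM.
    exact: measurable_orlicz_comp.
  move=> x _; have y0 := hgc.1 x; rewrite orealE// -EFinM -EFinD lee_fin.
  have [y1|/ltW y1] := leP (g x / c) 1.
    by rewrite (le_trans y1)// lerDl mulr_ge0// ?invr_ge0 ?(ltW F1)// oreal_ge0.
  by rewrite ler_wpDl// ler_pdivlMl// mulrC oreal_ge_linear.
rewrite ge0_integralD//; last 2 first.
- by move=> x _; rewrite mule_ge0 ?lee_fin ?invr_ge0 ?(ltW F1)// orlicz_ge0//; exact: hgc.1.
- by apply: measurable_funeM; exact: measurable_orlicz_comp.
rewrite integral_cst// mul1e [X in (X + _)%E]mu_unit_itv ge0_integralZl//; last 3 first.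
- exact: measurable_orlicz_comp.
- by move=> x _; rewrite orlicz_ge0//; exact: hgc.1.
- by rewrite lee_fin invr_ge0 ltW.
rewrite /C EFinD leeD2l// -[leRHS]mule1 lee_pmul2l// lte_fin invr_gt0//.
Qed.

(** F(t) <= C (1 + t^2), hence L_2 embeds in L_F; the bound by 1 + q rather
    than by the square root of q is linear in q, and can be averaged over
    signs. *)
Lemma LN_quadratic : exists2 C : R, 0 < C & forall g (q : R), nnmeas g -> 0 <= q ->
  (\int[mu]_(x in I01) (g x ^+ 2)%:E <= q%:E)%E -> (LN F g <= (C * (1 + q))%:E)%E.
Proof.
have [C C0 hC] := oreal_quadratic.
exists (1 + C); first by rewrite addr_gt0.
move=> g q hg q0 gq; set l := (1 + C) * (1 + q).
have l1 : 1 <= l by rewrite /l mulr_ege1 ?lerDl// ltW.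
have l0 : 0 < l by apply: lt_le_trans l1.
apply: luxemburg_le => //.
have m2 : measurable_fun I01 (fun x => (g x ^+ 2)%:E).
  by apply/measurable_EFinP; apply: measurable_funX; exact: hg.2.
apply: (@le_trans _ _ (\int[mu]_(x in I01) ((C / l)%:E * (1 + (g x ^+ 2)%:E)))%E).
  apply: ge0_le_integral => //.
  - by move=> x _; rewrite orlicz_ge0// divr_ge0 ?hg.1// ltW.
  - by apply: measurable_orlicz_comp; apply: nnmeasV => //; exact: ltW.
  - by apply: measurable_funeM; exact: emeasurable_funD.
  move=> x _; have g0 := hg.1 x.
  rewrite -EFinD -EFinM orealE ?divr_ge0 ?(ltW l0)// lee_fin.
  rewrite [g x / l]mulrC; apply: le_trans (oreal_scale _ g0) _.
    by rewrite invr_ge0 ltW//= invf_le1.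
  by rewrite [C / l]mulrC -mulrA ler_pM2l ?invr_gt0// hC.
rewrite ge0_integralZl//; last 3 first.
- exact: emeasurable_funD.
- by move=> x _; rewrite -EFinD lee_fin addr_ge0// sqr_ge0.
- by rewrite lee_fin divr_ge0// ltW.
rewrite ge0_integralD//; last by move=> x _; rewrite lee_fin sqr_ge0.
rewrite integral_cst// mul1e [X in (_ * (X + _))%E]mu_unit_itv.
apply: (@le_trans _ _ ((C / l)%:E * (1 + q%:E))%E).
  by rewrite lee_wpmul2l ?leeD2l// lee_fin divr_ge0// ltW.
rewrite -EFinD -EFinM lee_fin mulrAC ler_pdivrMr// mul1r /l.
by rewrite ler_wpM2r ?addr_ge0// lerDr.
Qed.

(** Order continuity of the norm: by the Delta_2 condition the modular of the
    tail divided by e is controlled by the integral of F(g / r) over the tail,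
    which vanishes in the limit by dominated convergence. *)
Lemma LN_tail g (e : R) : nnmeas g -> (LN F g < +oo)%E -> 0 < e ->
  exists M0 : R, forall M, M0 <= M ->
    (LN F (fun x => (g x * (M < g x)%R%:R)%R) <= e%:E)%E.
Proof.
move=> hg gfin e0; have [C C1 hC] := oreal_delta2.
have C0 : 0 < C by apply: lt_le_trans C1.
have gf : LN F g \is a fin_num by rewrite ge0_fin_numE// LN_ge0.
pose r := fine (LN F g) + 1 + e.
have r0 : 0 < r by rewrite /r ltr_wpDl// addr_ge0// fine_ge0// LN_ge0.
have re : e <= r by rewrite /r lerDr addr_ge0// fine_ge0// LN_ge0.
have hr : (LF_modular F (fun x => g x / r)%R <= 1)%E.
  apply: LN_lt_modular => //; rewrite -(fineK gf) lte_fin /r -addrA ltrDl.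
  by rewrite addr_gt0.
have hgr : nnmeas (fun x => g x / r) by apply: nnmeasV => //; exact: ltW.
pose H x := F (g x / r)%R.
have H0 x : (0 <= H x)%E by apply: orlicz_ge0; exact: hgr.1.
have mH : measurable_fun I01 H by exact: measurable_orlicz_comp.
have mlev n : measurable_fun I01 (fun x => ((n%:R < g x)%R%:R : R)).
  apply: measurable_nat_of_bool.
  exact: measurable_fun_ltr (measurable_cst (n%:R : R)) hg.2.
have iH : mu.-integrable I01 H.
  apply/integrableP; split=> //.
  under eq_integral do rewrite gee0_abs//.
  exact: le_lt_trans hr (ltry _).
pose fn n x := (H x * ((n%:R < g x)%R%:R)%:E)%E.
have mfn n : measurable_fun I01 (fn n).
  by apply: emeasurable_funM => //; exact/measurable_EFinP.
have [] := @dominated_convergence _ _ _ mu I01 unit_measurable fn (cst 0%E) H.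
- by [].
- exact: measurable_cst.
- apply/aeW => x _ /=.
  apply: cvg_near_cst; exists (Num.truncn (g x)).+1 => // n /= hn.
  rewrite /fn ltNge (_ : g x <= n%:R) ?mule0//.
  by apply: le_trans (ltW (truncnS_gt _)) _; rewrite ler_nat.
- exact: iH.
- apply/aeW => x n _; rewrite /fn gee0_abs; last by rewrite mule_ge0// lee_fin.
  by case: (_ < _); rewrite ?mule1 ?mule0.
move=> _ _; rewrite integral_cst// mul0e.
have d0 : 0 < (C * (r / e) ^+ 2)^-1 by rewrite invr_gt0 mulr_gt0// exprn_gt0// divr_gt0.
move=> /fine_cvgP[[N1 _ fin] /cvgr0Pnorm_lt/(_ _ d0)[N2 _ small]].
pose n := maxn N1 N2.
have fin_n : (\int[mu]_(x in I01) fn n x)%E \is a fin_num := fin n (leq_maxl _ _).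
have /= small_n := small n (leq_maxr _ _).
(* above r the quotient g / r is at least 1, where the growth condition
   applies *)
exists (Num.max n%:R r) => M; rewrite ge_max => /andP[nM rM].
have M0 : 0 < M by apply: lt_le_trans rM.
have lev : measurable_fun I01 (fun x => ((M < g x)%R%:R : R)).
  apply: measurable_nat_of_bool.
  exact: measurable_fun_ltr (measurable_cst M) hg.2.
have hgM : nnmeas (fun x => g x * (M < g x)%R%:R).
  by split=> [x|]; [rewrite mulr_ge0 ?hg.1|apply: measurable_funM => //; exact: hg.2].
apply: luxemburg_le => //.
apply: (@le_trans _ _ (\int[mu]_(x in I01) ((C * (r / e) ^+ 2)%:E * fn n x))%E).
  apply: ge0_le_integral => //.
  - by move=> x _; rewrite orlicz_ge0// divr_ge0 ?hgM.1// ltW.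
  - by apply: measurable_orlicz_comp; apply: nnmeasV => //; exact: ltW.
  - by apply: measurable_funeM; exact: mfn.
  move=> x _; have g0 := hg.1 x.
  rewrite /fn /H; have [Mg|gM] := ltP M (g x); last first.
    rewrite mulr0 mul0r orlicz0; apply: mule_ge0.
      by rewrite lee_fin mulr_ge0 ?(ltW C0)// sqr_ge0.
    by apply: mule_ge0; [rewrite orlicz_ge0// divr_ge0// ltW|rewrite lee_fin].
  rewrite (le_lt_trans nM Mg) mule1 mulr1.
  have -> : g x / e = (r / e) * (g x / r) by field; rewrite !gt_eqF.
  have y0 : 0 <= g x / r by rewrite divr_ge0// ltW.
  have z0 : 0 <= r / e * (g x / r) by rewrite mulr_ge0// divr_ge0// ltW.
  rewrite (orealE y0) (orealE z0).
  rewrite -EFinM lee_fin; apply: hC; rewrite ler_pdivlMr// mul1r//.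
  by rewrite (le_trans rM)// ltW.
have fn0 m x : (0 <= fn m x)%E by apply: mule_ge0; [exact: H0|rewrite lee_fin].
rewrite ge0_integralZl//; last 2 first.
- exact: mfn.
- by rewrite lee_fin ltW// -invr_gt0.
rewrite -(fineK fin_n) -EFinM lee_fin.
rewrite -ler_pdivlMl ?mulr1; last by rewrite -invr_gt0.
exact: le_trans (ler_norm _) (ltW small_n).
Qed.

End finite_orlicz_functions.

(** * Completeness of the Orlicz space *)

Section LF_space.
Context {R : realType} {k : scalar_kind}.
Variable F : orlicz R.
Local Notation mu := (@lebesgue_measure R).
Local Notation I01 := (@unit_itv R).
Local Notation K := (scalar R k).
Local Notation p := (LF_eseminorm k F).
Implicit Types f : R -> K.

Definition smod f : R -> R := fun x => sabs (f x).

Lemma smod_nnmeas f : scalar_measurable I01 f -> nnmeas (smod f).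
Proof.
move=> [mr mi]; split=> [x|]; first exact: sabs_ge0.
rewrite (_ : smod f = Num.sqrt \o (fun x => sre (f x) ^+ 2 + sim (f x) ^+ 2)).
  apply: measurableT_comp; first exact: continuous_measurable_fun (@sqrt_continuous R).
  by apply: measurable_funD; apply: measurable_funX.
by apply/funext => x; rewrite /smod /= sabs_sqrt.
Qed.

Lemma LF_finP f : reflect (scalar_measurable I01 f /\ (LN F (smod f) < +oo)%E)
  (f \in finite_part p).
Proof. exact: (@finite_partP R k _ (LF_eseminorm k F) f). Qed.

Lemma LF_meas f : f \in finite_part p -> scalar_measurable I01 f.
Proof. by move=> /LF_finP[]. Qed.

Lemma LF_nnmeas f : f \in finite_part p -> nnmeas (smod f).
Proof. by move=> /LF_meas/smod_nnmeas. Qed.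

Lemma LNfin f : f \in finite_part p -> LN F (smod f) = (rn (cls p f))%:E.
Proof. by move=> h; rewrite rn_cls// fineK//; exact: finite_part_fin h. Qed.

Lemma rn_cls_le f (c : R) : f \in finite_part p -> (LN F (smod f) <= c%:E)%E ->
  rn (cls p f) <= c.
Proof. by move=> h; rewrite LNfin// lee_fin. Qed.

Lemma rn_cls_mono f g : f \in finite_part p -> g \in finite_part p ->
  (forall x, I01 x -> sabs (f x) <= sabs (g x)) -> rn (cls p f) <= rn (cls p g).
Proof.
move=> hf hg fg; apply: rn_cls_le => //; rewrite -LNfin//.
by apply: LN_le => //; exact: LF_nnmeas.
Qed.

Definition cut (b : R -> bool) f : R -> K := fun x => (b x)%:R * f x.

Lemma sabs_cut b f x : sabs (cut b f x) = (b x)%:R * sabs (f x).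
Proof. by rewrite /cut; case: (b x); rewrite ?mul1r ?mul0r ?sabs0. Qed.

Lemma cut_measurable b f : measurable_fun I01 b -> scalar_measurable I01 f ->
  scalar_measurable I01 (cut b f).
Proof.
move=> /measurable_nat_of_bool mb [mr mi]; split.
  rewrite (_ : (fun x => _) = (fun x => (b x)%:R * sre (f x))).
    exact: measurable_funM.
  apply/funext => x; rewrite /cut; case: (b x); rewrite ?mul1r ?mul0r//.
  by have := @sre_sum R k nat [::] (fun=> 0); rewrite !big_nil.
rewrite (_ : (fun x => _) = (fun x => (b x)%:R * sim (f x))).
  exact: measurable_funM.
apply/funext => x; rewrite /cut; case: (b x); rewrite ?mul1r ?mul0r//.
by have := @sim_sum R k nat [::] (fun=> 0); rewrite !big_nil.
Qed.

Lemma cut_fin b f : measurable_fun I01 b -> f \in finite_part p ->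
  cut b f \in finite_part p.
Proof.
move=> mb /LF_finP[mf ff]; apply/LF_finP; split; first exact: cut_measurable.
apply: le_lt_trans ff; apply: LN_le.
- exact/smod_nnmeas/cut_measurable.
- exact: smod_nnmeas.
by move=> x _; rewrite /smod sabs_cut; case: (b x); rewrite ?mul1r ?mul0r ?sabs_ge0.
Qed.

Lemma sum_measurable (I : Type) (s : seq I) (f : I -> R -> K) :
  (forall i, scalar_measurable I01 (f i)) ->
  scalar_measurable I01 (fun x => \sum_(i <- s) f i x).
Proof.
move=> hf; split.
  under eq_fun do rewrite sre_sum.
  by apply: measurable_sum => i; exact: (hf i).1.
under eq_fun do rewrite sim_sum.
by apply: measurable_sum => i; exact: (hf i).2.
Qed.

Lemma cls_eq f g : f \in finite_part p -> g \in finite_part p ->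
  LF_norm F (f - g) = 0%E -> cls p f = cls p g.
Proof.
move=> hf hg fg; apply/eqP; rewrite -subr_eq0 -rn_eq0.
have -> : cls p f - cls p g = cls p (f - g).
  by rewrite [in RHS]addrC -scaleN1r cls_lin// scaleN1r addrC.
by rewrite rn_cls ?rpredB//= [X in fine X]fg.
Qed.

Hypothesis finF : finite_orlicz F.
Hypothesis decF : essentially_decreasing (fun t : R => fine (F t) * t ^- 2).

Lemma nnseries_measurable (h : nat -> R -> R) : (forall j, nnmeas (h j)) ->
  measurable_fun I01 (fun x => (\sum_(j <oo) (h j x)%:E)%E).
Proof.
move=> hh; apply: (emeasurable_fun_cvg (fun n x => (\sum_(0 <= j < n) (h j x)%:E)%E)).
  by move=> n; apply: emeasurable_sum => j; exact: (nnmeas_EFin (hh j)).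
move=> x _; apply: is_cvg_nneseries => j _ _.
by rewrite lee_fin; exact: (hh j).1.
Qed.

(** The norms dominate the L_1 norms, so the integral of the sum of the moduli
    is finite. *)
Lemma ae_summable (f : nat -> R -> K) (C : R) : (forall j, f j \in finite_part p) ->
  (forall n, \sum_(j < n) rn (cls p (f j)) <= C) ->
  {ae mu, forall x, I01 x -> (\sum_(j <oo) (sabs (f j x))%:E < +oo)%E}.
Proof.
move=> hf hC; have [C1 C10 hC1] := LN_L1 finF decF.
have mf j : measurable_fun I01 (fun x => (sabs (f j x))%:E).
  exact: (nnmeas_EFin (LF_nnmeas (hf j))).
have f0 j x : I01 x -> (0 <= (sabs (f j x))%:E)%E by rewrite lee_fin sabs_ge0.
have C0 : 0 <= C by apply: le_trans (hC 0%N); rewrite big_ord0.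
pose G x := (\sum_(j <oo) (sabs (f j x))%:E)%E.
have G0 x : (0 <= G x)%E by apply: nneseries_ge0 => j _ _; rewrite lee_fin sabs_ge0.
have mG : measurable_fun I01 G.
  by apply: nnseries_measurable => j; exact: LF_nnmeas.
have iG : (\int[mu]_(x in I01) G x <= (C1 * C)%:E)%E.
  rewrite /G (@integral_nneseries _ _ _ mu I01 (@unit_measurable R))//.
  apply: lime_le.
    apply: is_cvg_nneseries => j _ _; apply: integral_ge0 => x Ix; exact: f0.
  apply: nearW => n.
  apply: (@le_trans _ _ (\sum_(0 <= j < n) (C1 * rn (cls p (f j)))%:E)%E).
    apply: lee_sum => j _; apply: (hC1 _ _ (LF_nnmeas (hf j))); first exact: rn_ge0.
    by rewrite LNfin.
  by rewrite sumEFin lee_fin -mulr_sumr big_mkord ler_wpM2l// ltW.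
have : mu.-integrable I01 G.
  apply/integrableP; split=> //; under eq_integral do rewrite gee0_abs//.
  exact: le_lt_trans iG (ltry _).
move=> /integrable_ae; move=> /(_ (@unit_measurable R)).
by apply: filterS => x h Ix; rewrite ltey_eq h.
Qed.

(** Riesz-Fischer: an absolutely convergent series converges pointwise almost
    everywhere, and the Fatou property bounds the norm of the remainder by the
    tail of the series of norms. *)
Lemma LF_series_complete : series_complete (LF k F).
Proof.
move=> v [C hC].
have /choice[f hf] : forall j, exists f : R -> K, f \in finite_part p /\ v j = cls p f.
  by move=> j; have [f h1 h2] := cls_rep (v j); exists f.
have f_fin j : f j \in finite_part p := (hf j).1.
have ae := @ae_summable f C f_fin _.
have {}ae : {ae mu, forall x, I01 x -> (\sum_(j <oo) (sabs (f j x))%:E < +oo)%E}.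
  by apply: ae => n; under eq_bigr do rewrite -(hf _).2.
(* the functions are set to zero where the series diverges, which changes them
   on a null set only *)
pose b x := (\sum_(j <oo) (sabs (f j x))%:E < +oo)%E.
have mb : measurable_fun I01 b.
  apply: measurable_fun_lte; last exact: measurable_cst.
  by apply: nnseries_measurable => j; exact: LF_nnmeas.
pose f' j := cut b (f j).
have f'_fin j : f' j \in finite_part p by exact: cut_fin.
have vE j : v j = cls p (f' j).
  rewrite (hf j).2; apply: cls_eq => //; apply/LF_norm_eq0.
    by have /LF_meas : f j - f' j \in finite_part p by rewrite rpredB.
  have [N [mN N0 hN]] := ae; exists N; split=> // x /= fx; apply: hN => /= h; apply: fx => Ix.
  have bx : b x = true := h Ix.
  have e : (f j - f' j) x = f j x - cut b (f j) x by [].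
  rewrite e /cut bx mul1r. exact: subrr.
have /choice[g hg] : forall x, exists y : K, forall e : R, 0 < e ->
    \forall n \near \oo, sabs (y - \sum_(j < n) f' j x) < e.
  move=> x; have [bx|bx] := boolP (b x); last first.
    exists 0 => e e0; apply: nearW => n; rewrite big1 ?subrr ?sabs0// => j _.
    by rewrite /f' /cut (negPf bx) mul0r.
  apply: (@scalar_series R k (fun j => f' j x) (fine (\sum_(j <oo) (sabs (f j x))%:E)%E)) => n.
  rewrite -lee_fin fineK; last first.
    by rewrite ge0_fin_numE// nneseries_ge0// => j _ _; rewrite lee_fin sabs_ge0.
  rewrite -sumEFin -(big_mkord xpredT (fun j => (sabs (f' j x))%:E)).
  apply: (@le_trans _ _ (\sum_(0 <= j < n) (sabs (f j x))%:E)%E).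
    by apply: lee_sum => j _; rewrite /f' sabs_cut bx mul1r.
  by apply: nneseries_lim_ge => j _; rewrite lee_fin sabs_ge0.
have mS n : scalar_measurable I01 (fun x => \sum_(j < n) f' j x).
  by apply: (sum_measurable _ (f := fun j : 'I_n => f' j)) => j; exact: LF_meas.
have mg : scalar_measurable I01 g.
  split.
    apply: (@measurable_fun_cvg _ _ _ I01 (fun n x => sre (\sum_(j < n) f' j x))).
      by move=> n; exact: (mS n).1.
    move=> x _; apply/cvgrPdist_lt => e e0; have := hg x e e0.
    apply: filterS => n; apply: le_lt_trans.
    by rewrite -sreN -sreD sre_le.
  apply: (@measurable_fun_cvg _ _ _ I01 (fun n x => sim (\sum_(j < n) f' j x))).
    by move=> n; exact: (mS n).2.
  move=> x _; apply/cvgrPdist_lt => e e0; have := hg x e e0.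
  apply: filterS => n; apply: le_lt_trans.
  by rewrite -simN -simD sim_le.
have b0 j : 0 <= rn (v j) by exact: rn_ge0.
have [s hs] : exists s : R, (fun n => \sum_(i < n) rn (v i)) @ \oo --> s.
  apply: (@abs_series_cvg R (fun i => rn (v i)) C) => n.
  by under eq_bigr do rewrite ger0_norm ?rn_ge0//.
have s_ub m : \sum_(i < m) rn (v i) <= s.
  have nd : {homo (fun n => \sum_(i < n) rn (v i)) : n m / (n <= m)%N >-> n <= m}.
    by apply/nondecreasing_seqP => n; rewrite big_ord_recr /= lerDl.
  have cs : cvgn (fun n => \sum_(i < n) rn (v i)) by apply/cvg_ex; exists s.
  by rewrite -(cvg_lim (@Rhausdorff R) hs); exact: nondecreasing_cvgn_le nd cs m.
pose S n : R -> K := \sum_(j < n) f' j.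
have SE n x : S n x = \sum_(j < n) f' j x by rewrite /S fct_sumE.
have S_fin n : S n \in finite_part p by apply: rpred_sum => j _.
have gS_meas n : scalar_measurable I01 (g - S n).
  rewrite -scaleN1r; apply: scalar_measurableD => //.
  by apply: scalar_measurableZ; exact: LF_meas.
have tail n : (LN F (smod (g - S n)%R) <= (s - \sum_(j < n) rn (v j))%:E)%E.
  pose h m x := \sum_(i < m) smod (f' (n + i)%N) x.
  apply: (@LN_fatou _ F _ h).
  - exact: smod_nnmeas.
  - move=> m; apply: (nnmeas_sum _ (g := fun (i : 'I_m) => smod (f' (n + i)%N))) => i.
    exact: LF_nnmeas.
  - by move=> m x Ix; rewrite /h big_ord_recr /= lerDl sabs_ge0.
  - move=> x th Ix th0 th1.
    set a := smod (g - S n) x; have [a0|a0] := eqVneq a 0.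
      by exists 0%N; rewrite a0 mulr0 /h big_ord0.
    have {}a0 : 0 < a by rewrite lt_def a0 sabs_ge0.
    have [|N _ hN] := hg x ((1 - th) * a); first by rewrite mulr_gt0 ?subr_gt0.
    exists N; have /= hNn := hN (n + N)%N (leq_addl _ _).
    have : a <= sabs (g x - \sum_(j < n + N) f' j x) + h N x.
      rewrite /a /smod [X in sabs X](_ : _ = (g x - \sum_(j < n + N) f' j x) +
        \sum_(i < N) f' (n + i)%N x).
        by rewrite (le_trans (sabsD _ _))// lerD2l /h; exact: sabs_sum.
      by rewrite [LHS]/(g x - S n x) SE big_split_ord /= opprD addrA subrK.
    by rewrite mulrBl mul1r in hNn; lra.
  - by rewrite subr_ge0.
  move=> m; apply: (@le_trans _ _ (\sum_(i < m) LN F (smod (f' (n + i)%N)))%E).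
    apply: (@LN_sum R F 'I_m _ (fun i => smod (f' (n + i)%N))) => i.
    exact: LF_nnmeas.
  under eq_bigr do rewrite LNfin// -vE.
  rewrite sumEFin lee_fin lerBrDl.
  by apply: le_trans (s_ub (n + m)%N); rewrite big_split_ord.
have g_fin : g \in finite_part p.
  apply/LF_finP; split=> //; have := tail 0%N; rewrite /S big_ord0 subr0.
  by move=> /le_lt_trans; apply; exact: ltry.
exists (cls p g) => e e0.
have [N _ hN] : \forall n \near \oo, s - \sum_(j < n) rn (v j) < e.
  move/cvgrPdist_lt : hs => /(_ _ e0); apply: filterS => n.
  by apply: le_lt_trans; exact: ler_norm.
exists N => // n /= Nn.
have -> : \sum_(i < n) v i = cls p (S n).
  have -> : S n = \sum_(j < n) 1 *: f' j by apply: eq_bigr => j _; rewrite scale1r.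
  rewrite cls_sum//; apply: eq_bigr => j _; by rewrite scale1r vE.
have -> : cls p g - cls p (S n) = cls p (g - S n).
  have -> : g - S n = -1 *: S n + g by rewrite scaleN1r addrC.
  by rewrite cls_lin// scaleN1r addrC.
apply: le_lt_trans (hN n Nn); apply: rn_cls_le; last exact: tail.
by rewrite rpredB.
Qed.

End LF_space.

(** * Truncation in the sequence spaces *)

Section truncated_norms.
Context {R : realType} {k : scalar_kind}.
Implicit Types a : nat -> scalar R k.

Lemma nneseries_finite (h : nat -> \bar R) n :
  (forall i, (n <= i)%N -> h i = 0%E) ->
  (\sum_(i <oo) h i)%E = (\sum_(i < n) h i)%E.
Proof.
move=> h0; apply/cvg_lim => //; apply: cvg_near_cst; exists n => // m /= nm.
rewrite (@big_cat_nat _ _ _ n)//= [X in (_ + X)%E]big_nat_cond.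
rewrite [X in (_ + X)%E]big1 ?adde0 ?big_mkord// => i /andP[/andP[ni _] _].
exact: h0.
Qed.

Lemma sabs_trunc n a i : sabs (trunc n a i) = if (i < n)%N then sabs (a i) else 0.
Proof. by rewrite /trunc; case: ifP => // _; rewrite sabs0. Qed.

Lemma l2_trunc n a :
  l2_norm (trunc n a) = (Num.sqrt (\sum_(i < n) sabs (a i) ^+ 2))%:E.
Proof.
rewrite /l2_norm Lnorm_counting// (nneseries_finite (n := n)); last first.
  move=> i ni; rewrite /= sabs_trunc ltnNge ni /= normr0 powR0// .
under eq_bigr => i _.
  rewrite /= sabs_trunc ltn_ord ger0_norm ?sabs_ge0//.
  rewrite (_ : sabs (a i) `^ 2 = sabs (a i) ^+ 2); last by rewrite -powR_mulrn ?sabs_ge0.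
  over.
rewrite sumEFin poweR_EFin powR12_sqrt// sumr_ge0// => i _; exact: sqr_ge0.
Qed.

Lemma l2_trunc_le n a : (l2_norm (trunc n a) <= l2_norm a)%E.
Proof.
rewrite /l2_norm !Lnorm_counting//; apply: gt0_ler_poweR.
- by [].
- by rewrite in_itv/= leey andbT nneseries_ge0// => i _ _; exact: poweR_ge0.
- by rewrite in_itv/= leey andbT nneseries_ge0// => i _ _; exact: poweR_ge0.
apply: lee_nneseries => i _; first by rewrite poweR_ge0.
rewrite /= lee_fin ge0_ler_powR ?nnegrE// !ger0_norm ?sabs_ge0// sabs_trunc.
by case: ifP => // _; exact: sabs_ge0.
Qed.

Lemma l2_fatou a (C : R) : (forall n, (l2_norm (trunc n a) <= C%:E)%E) ->
  (l2_norm a <= C%:E)%E.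
Proof.
move=> h; have C0 : 0 <= C.
  by have := h 0%N; rewrite l2_trunc big_ord0 sqrtr0 lee_fin.
rewrite /l2_norm !Lnorm_counting//.
have s_le : (\sum_(i <oo) (`|(EFin \o (fun n => sabs (a n))) i| `^ 2) <= (C ^+ 2)%:E)%E.
  apply: lime_le; first by apply: is_cvg_nneseries => i _ _; exact: poweR_ge0.
  apply: nearW => n; rewrite big_mkord.
  under eq_bigr => i _.
    rewrite /= ger0_norm ?sabs_ge0//.
    rewrite (_ : sabs (a i) `^ 2 = sabs (a i) ^+ 2); last by rewrite -powR_mulrn ?sabs_ge0.
    over.
  rewrite sumEFin lee_fin; have := h n; rewrite l2_trunc lee_fin => hn.
  have s0 : 0 <= \sum_(i < n) sabs (a i) ^+ 2 by rewrite sumr_ge0// => i _; exact: sqr_ge0.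
  by rewrite -(sqr_sqrtr s0) ler_sqr ?nnegrE.
apply: (@le_trans _ _ ((C ^+ 2)%:E `^ 2^-1)%E).
  apply: gt0_ler_poweR => //.
    by rewrite in_itv/= leey andbT nneseries_ge0// => i _ _; exact: poweR_ge0.
  by rewrite in_itv/= leey andbT lee_fin sqr_ge0.
by rewrite poweR_EFin powR12_sqrt ?sqr_ge0// sqrtr_sqr ger0_norm.
Qed.

Variable G : orlicz R.

Lemma lG_modular_trunc n a (t : R) :
  lG_modular G (fun i => sabs (trunc n a i) / t) = (\sum_(i < n) G (sabs (a i) / t)%R)%E.
Proof.
rewrite /lG_modular (nneseries_finite (n := n)); last first.
  by move=> i ni; rewrite sabs_trunc ltnNge ni /= mul0r orlicz0.
by apply: eq_bigr => i _; rewrite sabs_trunc ltn_ord.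
Qed.

Lemma lG_trunc_upper n a (t : R) : 0 < t ->
  (\sum_(i < n) G (sabs (a i) / t)%R <= 1)%E -> (lG_norm G (trunc n a) <= t%:E)%E.
Proof.
by move=> t0 h; apply: luxemburg_le => //; rewrite lG_modular_trunc.
Qed.

Lemma lG_trunc_lower n a (t : R) : (lG_norm G (trunc n a) < t%:E)%E ->
  (\sum_(i < n) G (sabs (a i) / t)%R <= 1)%E.
Proof.
move=> /ereal_inf_lt[_ [s [s0 +] <-]]; rewrite lG_modular_trunc lte_fin => hs st.
have t0 := lt_trans s0 st.
apply: le_trans hs; apply: lee_sum => i _; apply: orlicz_nd.
  by rewrite divr_ge0 ?sabs_ge0// ltW.
by rewrite ler_wpM2l ?sabs_ge0// lef_pV2 ?posrE// ltW.
Qed.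

Lemma lG_trunc_le n a : (lG_norm G (trunc n a) <= lG_norm G a)%E.
Proof.
apply: le_ereal_inf => _ [t [t0 ht] <-]; exists t => //; split=> //.
apply: le_trans ht; apply: lee_nneseries => i _.
  by rewrite orlicz_ge0// divr_ge0 ?sabs_ge0// ltW.
rewrite sabs_trunc; apply: orlicz_nd.
  by case: ifP => _; rewrite ?mul0r// divr_ge0 ?sabs_ge0// ltW.
by case: ifP => _//; rewrite mul0r divr_ge0 ?sabs_ge0// ltW.
Qed.

Lemma lG_fatou a (C : R) : (forall n, (lG_norm G (trunc n a) <= C%:E)%E) ->
  (lG_norm G a <= C%:E)%E.
Proof.
move=> h; have C0 : 0 <= C.
  by rewrite -lee_fin; apply: le_trans (h 0%N); exact: luxemburg_ge0.
apply/lee_addgt0Pr => e e0; rewrite -EFinD.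
have t0 : 0 < C + e by rewrite ltr_wpDl.
apply: luxemburg_le => //; rewrite /lG_modular.
have G0 i : (0 <= G (sabs (a i) / (C + e))%R)%E.
  by rewrite orlicz_ge0// divr_ge0 ?sabs_ge0// ltW.
apply: lime_le; first by apply: is_cvg_nneseries => i _ _.
apply: nearW => n; rewrite big_mkord; apply: lG_trunc_lower.
by apply: le_lt_trans (h n) _; rewrite lte_fin ltrDl.
Qed.

End truncated_norms.

(** * Spreading sequences *)

Lemma increasing_choice (Q : nat -> nat -> Prop) :
  (forall n N, exists2 m, (N <= m)%N & Q n m) ->
  exists2 s : nat -> nat, {homo s : m n / (m < n)%N} & forall n, Q n (s n).
Proof.
move=> hQ.
have /choice[f hf] : forall q : nat * nat, exists m, (q.2 <= m)%N /\ Q q.1 m.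
  by move=> [n N]; have [m ? ?] := hQ n N; exists m.
pose fix s n := if n is m.+1 then f (n, (s m).+1) else f (0%N, 0%N).
exists s; last by case=> [|n]; [exact: (hf (0%N, 0%N)).2|exact: (hf (n.+1, (s n).+1)).2].
apply: homo_ltn; first by move=> ? ? ?; exact: ltn_trans.
by move=> n; exact: (hf (n.+1, (s n).+1)).1.
Qed.

Section spreading.
Context {R : realType} {k : scalar_kind}.

(** A linear map has a linear inverse. *)
Lemma equivalent_sym (V W : normedModType (scalar R k)) (x : nat -> V) (y : nat -> W) :
  equivalent x y -> equivalent y x.
Proof.
move=> [T [T' [lT [sT sT'] [TK T'K] [cT cT'] Tx]]]; exists T', T; split=> //.
- move=> a v w yv yw.
  have xv := sT' _ yv; have xw := sT' _ yw.
  have -> : a *: v + w = T (a *: T' v + T' w).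
    by rewrite lT// !T'K// inE.
  by rewrite TK// inE; exact: closed_spanP.
- move=> n; rewrite -Tx TK// inE; apply: subset_closed_span; exact: linear_span_mem.
Qed.

Context {V : normedModType (scalar R k)}.
Implicit Types x : nat -> V.

Lemma equivalent_term_bound (W : normedModType (scalar R k)) x (y : nat -> W) :
  equivalent x y -> exists2 C : R, 0 < C & forall n, rn (y n) <= C * rn (x n).
Proof.
move=> /equivalent_bound[C C0 hC]; exists C => // n.
have e (U : normedModType (scalar R k)) (z : nat -> U) :
    \sum_(i < n.+1) (i == n :> nat)%:R *: z i = z n.
  rewrite big_ord_recr /= eqxx scale1r big1 ?add0r// => i _.
  by rewrite (ltn_eqF (ltn_ord i)) scale0r.
by have := hC n.+1 (fun i => (i == n)%:R); rewrite !e.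
Qed.

(** If the norms were unbounded, or not bounded away from zero, some
    subsequence would have norms that are not comparable to those of the
    sequence itself, although the two are equivalent. *)
Lemma spreading_seminormalized x : (forall n, x n != 0) -> spreading x ->
  exists c C : R, [/\ 0 < c, forall n, c <= rn (x n) & forall n, rn (x n) <= C].
Proof.
move=> x0 spr.
have rx n : 0 < rn (x n) by rewrite lt_def rn_ge0 rn_eq0 x0.
have [C hC] : exists C : R, forall n, rn (x n) <= C.
  apply: contrapT => no.
  have [|s hs Qs] := @increasing_choice (fun n m => n%:R * rn (x n) < rn (x m)).
    move=> n N; apply: contrapT => no2; apply: no.
    exists (n%:R * rn (x n) + \sum_(i < N) rn (x i)) => m.
    have [Nm|mN] := leqP N m.
      apply: ler_wpDr; first by apply: sumr_ge0 => i _; exact: rn_ge0.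
      by rewrite leNgt; apply/negP => h; apply: no2; exists m.
    apply: ler_wpDl; first by rewrite mulr_ge0// rn_ge0.
    rewrite (bigD1 (Ordinal mN))//= lerDl sumr_ge0// => i _; exact: rn_ge0.
  have [D D0 hD] := equivalent_term_bound (spr s hs).
  have := Qs (Num.truncn D).+1; rewrite ltNge => /negP; apply.
  by apply: le_trans (hD _) _; rewrite ler_wpM2r ?rn_ge0// ltW// truncnS_gt.
have [c c0 hc] : exists2 c : R, 0 < c & forall n, c <= rn (x n).
  apply: contrapT => no.
  have small N (e : R) : 0 < e -> exists2 m, (N <= m)%N & rn (x m) < e.
    elim: N e => [|N ih] e e0.
      apply: contrapT => no2; apply: no; exists e => // n; rewrite leNgt.
      by apply/negP => h; apply: no2; exists n.
    have [|m Nm] := ih (Num.min e (rn (x N))); first by rewrite lt_min e0 rx.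
    rewrite lt_min => /andP[me mN]; exists m => //.
    by rewrite ltn_neqAle Nm andbT; apply: contraTneq mN => <-; rewrite ltxx.
  have [|s hs Qs] := @increasing_choice (fun n m => rn (x m) * n.+1%:R < rn (x n)).
    move=> n N; have [|m Nm hm] := small N (rn (x n) / n.+1%:R).
      by rewrite divr_gt0.
    by exists m => //; rewrite -ltr_pdivlMr.
  have [D D0 hD] := equivalent_term_bound (equivalent_sym (spr s hs)).
  have := Qs (Num.truncn D); rewrite ltNge => /negP; apply.
  apply: le_trans (hD _) _; rewrite mulrC ler_wpM2l ?rn_ge0//.
  exact/ltW/truncnS_gt.
by exists c, C.
Qed.

End spreading.

Section integral_sign_average.
Context {R : realType}.
Local Notation mu := (@lebesgue_measure R).
Local Notation I01 := (@unit_itv R).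

Lemma integral_savg n (h : (nat -> bool) -> R -> R) (I : (nat -> bool) -> R) :
  (forall e, nnmeas (h e)) ->
  (forall e, (\int[mu]_(x in I01) (h e x)%:E = (I e)%:E)%E) ->
  nnmeas (fun x => savg n ((fun e => h e x) : _ -> R^o)) /\
  (\int[mu]_(x in I01) (savg n ((fun e => h e x) : _ -> R^o))%:E =
    (savg n (I : _ -> R^o))%:E)%E.
Proof.
elim: n h I => [|n ih] h I mh hI; first by split=> /=; [exact: mh|exact: hI].
have hh e b : nnmeas (h (upd e n b)) by exact: mh.
apply: (ih (fun e x => 2^-1 * (h (upd e n false) x + h (upd e n true) x))
  (fun e => 2^-1 * (I (upd e n false) + I (upd e n true)))) => e.
  by apply: nnmeasZ => //; exact: nnmeasD.
under eq_integral do rewrite EFinM EFinD.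
have h0 b x : I01 x -> (0 <= (h (upd e n b) x)%:E)%E.
  by move=> _; rewrite lee_fin; exact: (hh e b).1.
have mhb b := nnmeas_EFin (hh e b).
have mI : measurable I01 := @unit_measurable R.
rewrite ge0_integralZl//; last 2 first.
- by apply: emeasurable_funD; exact: mhb.
- by move=> x Ix; rewrite adde_ge0 ?h0.
rewrite ge0_integralD//; try (by move=> x Ix; exact: h0); try exact: mhb.
by rewrite !hI.
Qed.

End integral_sign_average.

(** * Limits of normalized convex functions *)

Section convex_functions.
Context {R : realType}.
Implicit Types H : R -> R.

Record unit_convex H := UnitConvex {
  uc0 : H 0 = 0;
  uc1 : H 1 = 1;
  uc_ge0 : forall t, 0 <= t <= 1 -> 0 <= H t;
  uc_convex : forall a s t, 0 <= a <= 1 -> 0 <= s <= 1 -> 0 <= t <= 1 ->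
    H (a * s + (1 - a) * t) <= a * H s + (1 - a) * H t
}.

Variable H : R -> R.
Hypothesis ucH : unit_convex H.

Lemma uc_scale a t : 0 <= a <= 1 -> 0 <= t <= 1 -> H (a * t) <= a * H t.
Proof.
move=> a01 t01; have z01 : 0 <= (0 : R) <= 1 by rewrite lexx ler01.
by have := uc_convex ucH a01 t01 z01; rewrite (uc0 ucH) !mulr0 !addr0.
Qed.

Lemma uc_le_id t : 0 <= t <= 1 -> H t <= t.
Proof.
move=> t01; have z01 : 0 <= (1 : R) <= 1 by rewrite lexx ler01.
by have := uc_scale t01 z01; rewrite (uc1 ucH) !mulr1.
Qed.

Lemma uc_nd s t : 0 <= s -> s <= t -> t <= 1 -> H s <= H t.
Proof.
move=> s0 st t1; have t0 := le_trans s0 st.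
have [tz|tz] := eqVneq t 0.
  by rewrite (_ : s = t)//; apply/eqP; rewrite eq_le st tz.
have {}tz : 0 < t by rewrite lt_def tz.
have t01 : 0 <= t <= 1 by rewrite t0.
have a01 : 0 <= s / t <= 1 by rewrite divr_ge0//= ler_pdivrMr// mul1r.
have := uc_scale a01 t01; rewrite divfK ?gt_eqF// => /le_trans; apply.
case/andP: a01 => _ a1; rewrite -[leRHS]mul1r ler_wpM2r//; exact: (uc_ge0 ucH).
Qed.

(** The slope of a convex function at s is at most that of the chord from s to
    1, which is at most 1 / (1 - s) <= 2. *)
Lemma uc_lipschitz s t : 0 <= s -> s <= t -> t <= 2^-1 ->
  0 <= H t - H s <= 2 * (t - s).
Proof.
move=> s0 st t2.
have h21 : (2^-1 : R) <= 1 by rewrite invf_le1// ler1n.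
have t1 : t <= 1 by apply: le_trans h21.
rewrite subr_ge0 uc_nd//=.
have s2 : s <= 2^-1 by apply: le_trans t2.
have s1 : s < 1 by apply: (le_lt_trans s2); rewrite invf_lt1// ltr1n.
have s01 : 0 <= s <= 1 by rewrite s0 ltW.
have o01 : 0 <= (1 : R) <= 1 by rewrite lexx ler01.
have d0 : 0 < 1 - s by rewrite subr_gt0.
pose a := (1 - t) / (1 - s).
have a01 : 0 <= a <= 1.
  rewrite divr_ge0 ?subr_ge0 ?(ltW s1)//= ler_pdivrMr// mul1r lerD2l lerN2//.
have := uc_convex ucH a01 s01 o01.
have -> : a * s + (1 - a) * 1 = t by rewrite /a; field; rewrite gt_eqF.
rewrite (uc1 ucH) mulr1 => h.
have Hs := uc_ge0 ucH s01.
have e1 : 1 - a = (t - s) / (1 - s) by rewrite /a; field; rewrite gt_eqF.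
have b0 : 0 <= 1 - a by rewrite subr_ge0; case/andP: a01.
have e2 : 1 - a <= 2 * (t - s).
  rewrite e1 ler_pdivrMr// mulrAC -[leLHS]mul1r ler_wpM2r ?subr_ge0//.
  by rewrite mulrBr mulr1; lra.
have h3 : 0 <= (1 - a) * H s by rewrite mulr_ge0.
have e3 : a * H s = H s - (1 - a) * H s by ring.
rewrite e3 in h; lra.
Qed.

Lemma uc_lipschitz_abs s t : 0 <= s <= 2^-1 -> 0 <= t <= 2^-1 ->
  `|H t - H s| <= 2 * `|t - s|.
Proof.
move=> /andP[s0 s2] /andP[t0 t2]; have [st|/ltW ts] := leP s t.
  have /andP[h1 h2] := uc_lipschitz s0 st t2.
  by rewrite (ger0_norm h1) (ger0_norm (_ : 0 <= t - s)) ?subr_ge0.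
have /andP[h1 h2] := uc_lipschitz t0 ts s2.
rewrite -normrN opprB -[`|t - s|]normrN opprB.
by rewrite (ger0_norm h1) (ger0_norm (_ : 0 <= s - t)) ?subr_ge0.
Qed.

End convex_functions.

Lemma ultra_fmap (T W : Type) (f : T -> W) (U : set_system T) :
  UltraFilter U -> UltraFilter (f @ U).
Proof.
move=> UU; split; first exact: fmap_proper_filter.
move=> G PG sG; apply/seteqP; split=> [A GA|]; last exact: sG.
have [//|nA] := in_ultra_setVsetC (f @^-1` A) UU.
have : G (A `&` ~` A) by apply: filterI => //; exact: sG.
by rewrite setICr => /filter_not_empty.
Qed.

(** Written with finite sets of points and explicit errors, so that it can be
    instantiated without reference to the filter that produces g. *)
Definition pointwise_cluster (R : realType) (H : nat -> R -> R) (g : R -> R) :=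
  forall (ts : seq R) (e : R) (N : nat),
  (forall t, t \in ts -> 0 <= t <= 1) -> 0 < e ->
  exists2 n, (N <= n)%N & forall t, t \in ts -> `|H n t - g t| < e.

Section limit_function.
Context {R : realType}.
Variable H : nat -> R -> R.
Hypothesis ucH : forall n, unit_convex (H n).

(** Limits along an ultrafilter finer than the cofinite filter exist in the
    compact interval [0, 1]. *)
Lemma cluster_function : exists g : R -> R, pointwise_cluster H g.
Proof.
have [U [UU sU]] := @ultraFilterLemma nat \oo _.
have /choice[g hg] : forall t, exists y : R, 0 <= t <= 1 -> (fun n => H n t) @ U --> y.
  move=> t; have [t01|nt] := pselect (0 <= t <= 1); last by exists 0.
  have : compact `[0%R, 1%R : R]%classic by exact: segment_compact.
  rewrite compact_ultra => /(_ ((fun n => H n t) @ U) (ultra_fmap _ UU))[].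
    apply: (@filterS _ U _ setT) filterT => n _; rewrite /= in_itv /= (uc_ge0 (ucH n))//.
    by rewrite (le_trans (uc_le_id (ucH n) t01))//; case/andP: t01.
  by move=> y [_ hy]; exists y.
exists g => ts e N tsP e0.
have : U (fun n => (N <= n)%N /\ forall t, t \in ts -> `|H n t - g t| < e).
  apply: filterI; first by apply: sU; exists N.
  elim: ts tsP => [|t ts ih] tsP; first by apply: filterS filterT.
  have h1 : U (fun n => `|H n t - g t| < e).
    have t01 : 0 <= t <= 1 by apply: tsP; rewrite inE eqxx.
    have /cvgrPdist_lt/(_ _ e0) := hg t t01.
    by apply: filterS => n; rewrite distrC.
  have h2 := ih (fun s hs => tsP s (mem_behead (s := t :: ts) hs)).
  apply: filterS (filterI h1 h2) => n [k1 k2] s; rewrite inE => /predU1P[->//|]; exact: k2.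
by move=> /filter_ex[n [Nn hn]]; exists n.
Qed.

Variable g : R -> R.
Hypothesis hg : pointwise_cluster H g.

(** Each property of g involves finitely many values, which are approximated
    by those of a single H n. *)
Lemma cluster_unit_convex : unit_convex g.
Proof.
have pt t e : 0 <= t <= 1 -> 0 < e -> exists n, `|H n t - g t| < e.
  move=> t01 e0; have [|n _ hn] := hg (ts := [:: t]) 0%N _ e0.
    by move=> s; rewrite inE => /eqP->.
  by exists n; apply: hn; rewrite inE.
have o01 : 0 <= (1 : R) <= 1 by rewrite lexx ler01.
have z01 : 0 <= (0 : R) <= 1 by rewrite lexx ler01.
split.
- apply/eqP; rewrite -normr_eq0 eq_le normr_ge0 andbT; apply/ler_addgt0Pr => e e0.
  have [n] := pt 0 e z01 e0; rewrite (uc0 (ucH n)) sub0r normrN add0r; exact: ltW.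
- apply/eqP; rewrite -subr_eq0 -normr_eq0 eq_le normr_ge0 andbT; apply/ler_addgt0Pr => e e0.
  have [n] := pt 1 e o01 e0; rewrite (uc1 (ucH n)) distrC add0r; exact: ltW.
- move=> t t01; apply/ler_addgt0Pr => e e0; have [n hn] := pt t e t01 e0.
  have h0 := uc_ge0 (ucH n) t01; move: hn; rewrite ltr_norml => /andP[_ h]; lra.
move=> a s t a01 s01 t01; apply/ler_addgt0Pr => e e0.
set m := a * s + (1 - a) * t.
have [a0 a1] := andP a01; have [s0 s1] := andP s01; have [t0 t1] := andP t01.
have b0 : 0 <= 1 - a by rewrite subr_ge0.
have m01 : 0 <= m <= 1.
  rewrite /m addr_ge0 ?mulr_ge0//=.
  have h1 : a * s <= a by rewrite ler_piMr.
  have h2 : (1 - a) * t <= 1 - a by rewrite ler_piMr.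
  lra.
have [|n _ hn] := hg (ts := [:: m; s; t]) (e := e / 2) 0%N _ (divr_gt0 e0 (ltr0Sn R 1)).
  by move=> r; rewrite !inE => /or3P[] /eqP->.
have hm := hn m; have hs := hn s; have ht := hn t.
rewrite !inE !eqxx ?orbT in hm hs ht.
have {hm} := hm isT; have {hs} := hs isT; have {ht} := ht isT.
rewrite !ltr_norml => /andP[ht1 ht2] /andP[hs1 hs2] /andP[hm1 hm2].
have cv := uc_convex (ucH n) a01 s01 t01; rewrite -/m in cv.
have h1 : a * H n s <= a * g s + a * (e / 2) by rewrite -mulrDr ler_wpM2l//; lra.
have h2 : (1 - a) * H n t <= (1 - a) * g t + (1 - a) * (e / 2).
  by rewrite -mulrDr ler_wpM2l//; lra.
have h3 : a * (e / 2) + (1 - a) * (e / 2) = e / 2 by ring.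
lra.
Qed.

(** Both sides are 2-Lipschitz on [0, 1/2], so closeness on a grid of step 1 /
    (2 q) implies uniform closeness. *)
Lemma cluster_uniform (e : R) N : 0 < e -> exists2 n, (N <= n)%N &
  forall t, 0 <= t <= 2^-1 -> `|H n t - g t| <= e.
Proof.
move=> e0; have ucg := cluster_unit_convex.
pose q := (Num.truncn (4 / e)).+1.
have q0 : 0 < q%:R :> R by rewrite ltr0n.
have qe : 2 / q%:R <= e / 2.
  rewrite ler_pdivrMr// mulrC -ler_pdivrMr ?divr_gt0//.
  have -> : 2 / (e / 2) = 4 / e by field; rewrite gt_eqF.
  exact/ltW/truncnS_gt.
pose pt (j : nat) : R := j%:R / (2 * q%:R).
have ptP j : (j <= q)%N -> 0 <= pt j <= 2^-1.
  move=> jq; rewrite /pt divr_ge0 ?mulr_ge0//= ler_pdivrMr ?mulr_gt0//.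
  by rewrite mulrA mulVf// mul1r ler_nat.
have h21 : (2^-1 : R) <= 1 by rewrite invf_le1// ler1n.
have [|n Nn hn] := hg (ts := [seq pt j | j <- iota 0 q.+1]) (e := e / 2) N _ (divr_gt0 e0 (ltr0Sn R 1)).
  move=> t /mapP[j]; rewrite mem_iota add0n ltnS => /andP[_ /ptP/andP[h1 h2]] ->.
  by rewrite h1 (le_trans h2).
exists n => // t /[dup] t02 /andP[t0 t2].
pose j := Num.truncn (2 * q%:R * t).
have y0 : 0 <= 2 * q%:R * t by rewrite !mulr_ge0.
have /andP[j1 j2] := truncn_itv y0.
have jq : (j <= q)%N.
  rewrite -(ler_nat R) (le_trans j1)// mulrAC ler_piMl ?ler0n//.
  by rewrite mulrC -ler_pdivlMr// mul1r.
have ptj := ptP j jq.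
have tp : `|t - pt j| <= (2 * q%:R)^-1.
  have d1 : pt j <= t by rewrite /pt ler_pdivrMr ?mulr_gt0// mulrC.
  rewrite ger0_norm ?subr_ge0// lerBlDr /pt -[X in X + _]mul1r -mulrDl.
  by rewrite ler_pdivlMr ?mulr_gt0// mulrC addrC natr1 ltW.
have hj := hn (pt j) _; have {hj} := hj (map_f _ _).
rewrite mem_iota add0n ltnS jq => /(_ isT) hj.
have l1 := uc_lipschitz_abs (ucH n) ptj t02.
have l2 := uc_lipschitz_abs ucg t02 ptj.
rewrite [`|pt j - t|]distrC in l2.
have e1 : 2 * (2 * q%:R)^-1 = (q%:R)^-1 :> R by field; rewrite gt_eqF.
have -> : H n t - g t = (H n t - H n (pt j)) + (H n (pt j) - g (pt j)) + (g (pt j) - g t) by ring.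
apply: le_trans (ler_normD _ _) _; apply: le_trans (lerD (ler_normD _ _) (lexx _)) _.
have l3 : 2 * `|t - pt j| <= (q%:R)^-1 by rewrite -e1 ler_wpM2l.
have l4 : (q%:R)^-1 + (q%:R)^-1 = 2 / q%:R :> R by field; rewrite gt_eqF.
lra.
Qed.

End limit_function.

(** * Affine extension of the limit function *)

Section ray_convex_functions.
Context {R : realType}.
Implicit Types H : R -> R.

Record ray_convex H := RayConvex {
  rc0 : H 0 = 0;
  rc1 : H 1 = 1;
  rc_ge0 : forall t, 0 <= t -> 0 <= H t;
  rc_convex : forall a s t, 0 <= a <= 1 -> 0 <= s -> 0 <= t ->
    H (a * s + (1 - a) * t) <= a * H s + (1 - a) * H t
}.

Lemma ray_unit_convex H : ray_convex H -> unit_convex H.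
Proof.
case=> h0 h1 hp hc; split=> // [t /andP[t0 _]|a s t a01 /andP[s0 _] /andP[t0 _]]; first exact: hp.
exact: hc.
Qed.

Section one_function.
Variable H : R -> R.
Hypothesis rcH : ray_convex H.

Lemma rc_scale a t : 0 <= a <= 1 -> 0 <= t -> H (a * t) <= a * H t.
Proof.
move=> a01 t0; have := rc_convex rcH a01 t0 (lexx 0).
by rewrite (rc0 rcH) !mulr0 !addr0.
Qed.

Lemma rc_nd s t : 0 <= s -> s <= t -> H s <= H t.
Proof.
move=> s0 st; have t0 := le_trans s0 st.
have [tz|tz] := eqVneq t 0.
  by rewrite (_ : s = t)//; apply/eqP; rewrite eq_le st tz.
have {}tz : 0 < t by rewrite lt_def tz.
have a01 : 0 <= s / t <= 1 by rewrite divr_ge0//= ler_pdivrMr// mul1r.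
have := rc_scale a01 t0; rewrite divfK ?gt_eqF// => /le_trans; apply.
by case/andP: a01 => _ a1; rewrite -[leRHS]mul1r ler_wpM2r// (rc_ge0 rcH).
Qed.

Lemma rc_le1 s : 0 <= s -> H s <= 1 -> s <= 1.
Proof.
move=> s0 hs; rewrite leNgt; apply/negP => s1.
have p := lt_trans ltr01 s1.
have a01 : 0 <= s^-1 <= 1 by rewrite invr_ge0 s0/= invf_le1// ltW.
have := rc_scale a01 s0; rewrite mulVf ?gt_eqF// (rc1 rcH) mulrC ler_pdivlMr// mul1r => h.
by have := lt_le_trans s1 (le_trans h hs); rewrite ltxx.
Qed.

Lemma rc_half s : 0 <= s -> H (2^-1 * s) <= 2^-1 * H s.
Proof. by move=> s0; apply: rc_scale => //; rewrite invr_ge0 ler0n invf_le1// ler1n. Qed.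

Definition ray_orlicz : orlicz R.
Proof.
apply: (@Orlicz R (fun t => (H t)%:E)).
- by move=> t t0; rewrite lee_fin (rc_ge0 rcH).
- by move=> s t s0 st; rewrite lee_fin rc_nd.
- by move=> a s t a01 s0 t0; rewrite -!EFinM -EFinD lee_fin (rc_convex rcH).
- by rewrite (rc0 rcH).
- by exists 1; rewrite ?ler01// (rc1 rcH) eqe oner_neq0.
- by exists 1; rewrite ?ltr01// ltry.
Defined.

End one_function.

(** On [1/2, +oo) the graph is the line through (1/2, g(1/2)) and (1, 1). *)
Definition affine_ext (g : R -> R) (t : R) : R :=
  if t <= 2^-1 then g t else 2 * (1 - g 2^-1) * t + (2 * g 2^-1 - 1).

Variable g : R -> R.
Hypothesis ucg : unit_convex g.
Local Notation G := (affine_ext g).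
Local Notation h := (g 2^-1).

Let half01 : 0 <= (2^-1 : R) <= 1.
Proof. by rewrite invr_ge0 ler0n invf_le1// ler1n. Qed.

Let half_lt1 : (2^-1 : R) < 1. Proof. by rewrite invf_lt1// ltr1n. Qed.

Let h_ge0 : 0 <= h. Proof. exact: uc_ge0. Qed.

Let h_le : h <= 2^-1. Proof. exact: uc_le_id. Qed.

Lemma affine_ext_low t : t <= 2^-1 -> G t = g t.
Proof. by rewrite /affine_ext => ->. Qed.

Lemma affine_ext_high t : 2^-1 <= t -> G t = 2 * (1 - h) * t + (2 * h - 1).
Proof.
move=> t2; rewrite /affine_ext; case: ifP => // t2'.
have -> : t = 2^-1 by apply/eqP; rewrite eq_le t2' t2.
by field.
Qed.

Let line_le t : 0 <= t -> 2 * (1 - h) * t + (2 * h - 1) <= G t.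
Proof.
move=> t0; have [t2|/ltW t2] := leP t 2^-1; last by rewrite affine_ext_high.
rewrite affine_ext_low//.
have t1 : t < 1 by apply: le_lt_trans half_lt1.
have d0 : 0 < 1 - t by rewrite subr_gt0.
have o01 : 0 <= (1 : R) <= 1 by rewrite lexx ler01.
have t01 : 0 <= t <= 1 by rewrite t0 ltW.
pose a := 2^-1 / (1 - t).
have a01 : 0 <= a <= 1.
  rewrite divr_ge0 ?invr_ge0 ?(ltW d0)//= ler_pdivrMr// mul1r; lra.
have := uc_convex ucg a01 t01 o01.
have -> : a * t + (1 - a) * 1 = 2^-1 by rewrite /a; field; rewrite gt_eqF.
rewrite (uc1 ucg) => hh.
have : (1 - t) * h <= (1 - t) * (a * g t + (1 - a) * 1) by rewrite ler_wpM2l// ltW.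
have -> : (1 - t) * (a * g t + (1 - a) * 1) = 2^-1 * g t + (2^-1 - t).
  by rewrite /a; field; rewrite gt_eqF.
move=> h3; nra.
Qed.

(** The line lies below the extension everywhere, and the extension equals it
    from 1/2 on; this is convexity at any mean m >= 1/2. If m < 1/2 < t,
    convexity of g between s and 1/2 is combined with the chord inequality at
    1/2. *)
Lemma affine_ext_convex a s t : 0 <= a <= 1 -> 0 <= s -> 0 <= t ->
  G (a * s + (1 - a) * t) <= a * G s + (1 - a) * G t.
Proof.
have high b u v : 0 <= b <= 1 -> 0 <= u -> 0 <= v -> 2^-1 <= b * u + (1 - b) * v ->
    G (b * u + (1 - b) * v) <= b * G u + (1 - b) * G v.
  move=> /andP[b0 b1] u0 v0 m2; rewrite (affine_ext_high m2).
  have e1 : b * (2 * (1 - h) * u + (2 * h - 1)) <= b * G u by rewrite ler_wpM2l ?line_le.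
  have e2 : (1 - b) * (2 * (1 - h) * v + (2 * h - 1)) <= (1 - b) * G v.
    by rewrite ler_wpM2l ?subr_ge0 ?line_le.
  apply: le_trans (lerD e1 e2); rewrite le_eqVlt; apply/orP; left; apply/eqP; ring.
wlog st : a s t / s <= t => [hwlog|].
  have [|/ltW ts] := leP s t; first exact: hwlog.
  move=> /andP[a0 a1] s0 t0; rewrite [a * s + _]addrC [a * G s + _]addrC.
  have b01 : 0 <= 1 - a <= 1 by rewrite subr_ge0 a1 lerBlDr lerDl.
  by have := hwlog (1 - a) t s ts b01 t0 s0; rewrite subKr.
move=> /[dup] a01 /andP[a0 a1] s0 t0; set m := a * s + (1 - a) * t.
have b0 : 0 <= 1 - a by rewrite subr_ge0.
have [m2|m2] := leP 2^-1 m; first exact: high.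
have sm : s <= m.
  have : (1 - a) * s <= (1 - a) * t by rewrite ler_wpM2l.
  rewrite /m; lra.
have s2 : s < 2^-1 by apply: le_lt_trans m2.
have s2' := ltW s2; have m2' := ltW m2.
rewrite (affine_ext_low m2') (affine_ext_low s2').
have [t2|t2] := leP t 2^-1.
  rewrite (affine_ext_low t2); case/andP: half01 => _ h21.
  by apply: (uc_convex ucg a01); rewrite ?s0 ?t0/=; apply: le_trans h21.
have ts : 0 < t - s by rewrite subr_gt0 (lt_trans s2).
have ds : 0 < 2^-1 - s by rewrite subr_gt0.
(* 1/2 is the mean of s and t with weight b, and m the mean of s and 1/2 with
   weight c *)
pose b := (t - 2^-1) / (t - s); pose c := (2^-1 - m) / (2^-1 - s).
have b01 : 0 <= b <= 1.
  rewrite divr_ge0 ?(ltW ts) ?subr_ge0 ?(ltW t2)//= ler_pdivrMr// mul1r lerD2l lerN2.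
  exact: s2'.
have c01 : 0 <= c <= 1.
  rewrite divr_ge0 ?(ltW ds) ?subr_ge0 ?m2'//= ler_pdivrMr// mul1r lerD2l lerN2.
  exact: sm.
have e1 : b * s + (1 - b) * t = 2^-1 by rewrite /b; field; rewrite gt_eqF.
have e2 : c * s + (1 - c) * 2^-1 = m.
  by rewrite /c; field; rewrite gt_eqF//; lra.
have := high b s t b01 s0 t0; rewrite e1 lexx => /(_ isT).
rewrite (affine_ext_low (lexx _)) (affine_ext_low s2') => k1.
have s01 : 0 <= s <= 1 by case/andP: half01 => _; rewrite s0; exact: le_trans.
have k2 := uc_convex ucg c01 s01 half01; rewrite e2 in k2.
apply: le_trans k2 _.
have c1 : 0 <= 1 - c by rewrite subr_ge0; case/andP: c01.
apply: (@le_trans _ _ (c * g s + (1 - c) * (b * g s + (1 - b) * G t))).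
  by rewrite lerD2l ler_wpM2l.
have e3 : (1 - c) * (1 - b) = 1 - a.
  rewrite /b /c /m; field.
  by apply/andP; split; rewrite gt_eqF//; lra.
have -> : c * g s + (1 - c) * (b * g s + (1 - b) * G t) =
  (1 - (1 - c) * (1 - b)) * g s + (1 - c) * (1 - b) * G t by ring.
by rewrite e3 subKr.
Qed.

Lemma affine_ext_ray : ray_convex G.
Proof.
split.
- by rewrite affine_ext_low ?(uc0 ucg)//; case/andP: half01.
- by rewrite affine_ext_high; [ring|exact: ltW].
- move=> t t0; have [t2|/ltW t2] := leP t 2^-1.
    rewrite affine_ext_low// (uc_ge0 ucg)// t0 (le_trans t2)// ltW//.
  rewrite affine_ext_high//; have hl := h_le.
  have h1 : 0 <= 2 * (1 - h) by lra.
  have : 2 * (1 - h) * 2^-1 <= 2 * (1 - h) * t by rewrite ler_wpM2l.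
  have -> : 2 * (1 - h) * 2^-1 = 1 - h by field.
  move=> h3; have := h_ge0; lra.
- exact: affine_ext_convex.
Qed.

Lemma affine_extension_ray : affine_extension g (ray_orlicz affine_ext_ray).
Proof.
split=> [t /andP[t0 t2]||] /=.
- by rewrite affine_ext_low.
- exists (2 * (1 - h)), (2 * h - 1) => t t2; by rewrite affine_ext_high.
- by rewrite (rc1 affine_ext_ray).
Qed.

End ray_convex_functions.

(** * Comparison of modulars *)

Section comparison.
Context {R : realType}.
Variables (H : nat -> R -> R) (g : R -> R) (w : nat -> R) (m : R).
Hypothesis rcH : forall i, ray_convex (H i).
Hypothesis ucg : unit_convex g.
Hypothesis Hg : forall i t, 0 <= t <= 2^-1 -> `|H i t - g t| <= 2 ^- (i.+2).
Hypothesis m_gt0 : 0 < m.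
Hypothesis w_ge : forall i, m <= w i.
Hypothesis w_le1 : forall i, w i <= 1.
Local Notation G := (affine_ext g).

Let sum_geo n : \sum_(i < n) 2 ^- (i.+2) <= 2^-1 :> R.
Proof.
suff -> : \sum_(i < n) 2 ^- (i.+2) = 2^-1 - 2 ^- n.+1 :> R.
  by rewrite gerBl invr_ge0 exprn_ge0.
elim: n => [|n ih]; first by rewrite big_ord0 expr1 subrr.
rewrite big_ord_recr /= ih !exprS; field.
by rewrite expf_neq0.
Qed.

Let term_le (i n : nat) (F : nat -> R) : (i < n)%N -> (forall j, 0 <= F j) ->
  \sum_(j < n) F j <= 1 -> F i <= 1.
Proof.
move=> ni F0; apply: le_trans; rewrite (bigD1 (Ordinal ni))//= lerDl.
by apply: sumr_ge0.
Qed.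

Let rcG := affine_ext_ray ucg.

(** A term G(c_i) <= 1 forces c_i <= 1, so only values of H_i and g on [0,
    1/2] enter, where they differ by 2^-(i+2). Halving the argument once more
    halves the values and absorbs the total error 1/2. *)
Lemma weighted_modular_le n (c : nat -> R) : (forall i, 0 <= c i) ->
  \sum_(i < n) G (c i) <= 1 -> \sum_(i < n) w i * H i (c i / 4) <= 1.
Proof.
move=> c0 hs.
have c4 i : 0 <= c i / 4 by rewrite divr_ge0.
apply: (@le_trans _ _ (\sum_(i < n) 2^-1 * (G (c i) + 2 ^- i.+2))).
  apply: ler_sum => i _.
  have ci1 : c i <= 1.
    apply: (rc_le1 rcG (c0 i)); apply: (term_le (F := fun i => G (c i)) (ltn_ord i)) hs => j.
    exact: (rc_ge0 rcG).
  have c2 : 0 <= 2^-1 * c i by rewrite mulr_ge0.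
  have c22 : 2^-1 * c i <= 2^-1 by rewrite ler_piMr.
  apply: (@le_trans _ _ (H i (c i / 4))).
    by rewrite -[leRHS]mul1r ler_wpM2r// (rc_ge0 (rcH i)).
  have -> : c i / 4 = 2^-1 * (2^-1 * c i) by field.
  apply: le_trans (rc_half (rcH i) c2) _; rewrite ler_wpM2l//.
  have := Hg i (t := 2^-1 * c i); rewrite c2 c22 => /(_ isT).
  rewrite ler_norml -(affine_ext_low g c22) => /andP[_ k1].
  have k2 : G (2^-1 * c i) <= G (c i).
    by apply: (rc_nd rcG) => //; rewrite ler_piMl// invf_le1// ler1n.
  lra.
rewrite -mulr_sumr big_split /=.
have := sum_geo n; lra.
Qed.

(** The converse of [weighted_modular_le]; multiplying the argument by m
    absorbs the weights. *)
Lemma weighted_modular_ge n (c : nat -> R) : (forall i, 0 <= c i) ->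
  \sum_(i < n) w i * H i (c i) <= 1 -> \sum_(i < n) G (m * c i / 4) <= 1.
Proof.
move=> c0 hs.
have w0 i : 0 <= w i by apply: le_trans (w_ge i); exact: ltW.
have m01 : 0 <= m <= 1 by rewrite ltW//= (le_trans (w_ge 0)).
have term i : H i (m * c i) <= w i * H i (c i).
  by apply: le_trans (rc_scale (rcH i) m01 (c0 i)) _; rewrite ler_wpM2r// (rc_ge0 (rcH i)).
apply: (@le_trans _ _ (\sum_(i < n) 2^-1 * (w i * H i (c i) + 2 ^- i.+2))).
  apply: ler_sum => i _.
  have d0 : 0 <= m * c i by rewrite mulr_ge0// ltW.
  have d1 : m * c i <= 1.
    apply: (rc_le1 (rcH i) d0); apply: le_trans (term i) _.
    apply: (term_le (F := fun i => w i * H i (c i)) (ltn_ord i)) hs => j.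
    by rewrite mulr_ge0// (rc_ge0 (rcH j)).
  have c2 : 0 <= 2^-1 * (m * c i) by rewrite mulr_ge0.
  have c22 : 2^-1 * (m * c i) <= 2^-1 by rewrite ler_piMr.
  have -> : m * c i / 4 = 2^-1 * (2^-1 * (m * c i)) by field.
  apply: le_trans (rc_half rcG c2) _; rewrite ler_wpM2l//.
  have := Hg i (t := 2^-1 * (m * c i)); rewrite c2 c22 => /(_ isT).
  rewrite ler_norml -(affine_ext_low g c22) => /andP[k1 _].
  have k2 : H i (2^-1 * (m * c i)) <= H i (m * c i).
    by apply: (rc_nd (rcH i)) => //; rewrite ler_piMl// invf_le1// ler1n.
  have := term i; lra.
rewrite -mulr_sumr big_split /=.
have := sum_geo n; lra.
Qed.

End comparison.

Section hull_limits.
Context {R : realType}.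
Variable F : orlicz R.
Hypothesis finF : finite_orlicz F.
Hypothesis decF : essentially_decreasing (fun t : R => fine (F t) * t ^- 2).

Lemma dilate_ray (s : R) : 1 <= s -> ray_convex (dilate F s).
Proof.
move=> s1; have s0 : 0 <= s by apply: le_trans s1.
have Fs := oreal_gt0 finF decF s1.
split.
- by rewrite /dilate mulr0 orlicz0 /= mul0r.
- by rewrite /dilate mulr1 divff// gt_eqF.
- by move=> t t0; rewrite /dilate divr_ge0 ?(oreal_ge0 F) ?mulr_ge0// ltW.
move=> a u v a01 u0 v0; rewrite /dilate.
rewrite !mulrA -mulrDl ler_pM2r ?invr_gt0//.
have := oreal_convex finF a01 (mulr_ge0 s0 u0) (mulr_ge0 s0 v0).
by rewrite /oreal mulrDr !mulrA ![s * _]mulrC ?mulrA.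
Qed.

Lemma hull_ray n (w : 'I_n -> R) (D : 'I_n -> R -> R) :
  (forall j, 0 <= w j) -> \sum_j w j = 1 -> (forall j, ray_convex (D j)) ->
  ray_convex (\sum_j w j *: D j).
Proof.
move=> w0 w1 hD; have E t : (\sum_j w j *: D j) t = \sum_j w j * D j t by rewrite fct_sumE.
split.
- by rewrite E big1// => j _; rewrite (rc0 (hD j)) mulr0.
- by rewrite E -[RHS]w1; apply: eq_bigr => j _; rewrite (rc1 (hD j)) mulr1.
- by move=> t t0; rewrite E sumr_ge0// => j _; rewrite mulr_ge0// (rc_ge0 (hD j)).
move=> a s t a01 s0 t0; rewrite !E !mulr_sumr -big_split /=; apply: ler_sum => j _.
apply: le_trans (ler_wpM2l (w0 j) (rc_convex (hD j) a01 s0 t0)) _.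
by rewrite le_eqVlt; apply/orP; left; apply/eqP; ring.
Qed.

(** The topology of C_F is that of uniform convergence on [0, 1/2], and
    [uc_lipschitz] provides the continuity of g. *)
Lemma CF_limit (g : R -> R) : unit_convex g ->
  (forall (b e : R), 0 < e -> exists2 H, 
     convex_hull [set dilate F s | s in [set s | b < s /\ (0 < F s)%E]] H &
     forall t, 0 <= t <= 2^-1 -> `|H t - g t| < e) ->
  CF F g.
Proof.
move=> ucg app b _; split.
  apply/subspace_continuousP => s; rewrite /= in_itv /= => s02.
  apply/cvgrPdist_lt => e e0.
  have e2 : 0 < e / 2 by rewrite divr_gt0.
  have : \forall t \near s, `|s - t| < e / 2 by apply: (@nbhsx_ballx _ _ s _ e2).
  rewrite near_withinE; apply: filterS => t st; rewrite /= in_itv /= => t02.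
  apply: le_lt_trans (uc_lipschitz_abs ucg t02 s02) _.
  by rewrite mulrC -ltr_pdivlMr.
move=> P /uniform_nbhs[E [entE EP]].
move: entE; rewrite -entourage_ballE => -[e e0 sE].
have [H hH hg] := app b e e0.
exists H; split; first exact: hH.
apply: EP => t; rewrite /= in_itv /= => t02; apply: sE => /=.
by rewrite /ball /= distrC hg.
Qed.

End hull_limits.

Section orlicz_sequence_norm.
Context {R : realType} {k : scalar_kind}.
Variables (V : normedModType (scalar R k)) (y : nat -> V).
Variables (H : nat -> R -> R) (g : R -> R) (w : nat -> R) (m K L : R).
Hypothesis rcH : forall i, ray_convex (H i).
Hypothesis ucg : unit_convex g.
Hypothesis Hg : forall i t, 0 <= t <= 2^-1 -> `|H i t - g t| <= 2 ^- (i.+2).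
Hypothesis m_gt0 : 0 < m.
Hypothesis w_ge : forall i, m <= w i.
Hypothesis w_le1 : forall i, w i <= 1.
Hypothesis K_ge0 : 0 <= K.
Hypothesis L_ge0 : 0 <= L.
Hypothesis y_upper : forall n (a : nat -> scalar R k) (tau : R), 0 < tau ->
  \sum_(i < n) w i * H i (sabs (a i) / tau) <= 1 ->
  rn (\sum_(i < n) a i *: y i) <= L * tau.
Hypothesis y_lower : forall n (a : nat -> scalar R k) (tau : R),
  K * rn (\sum_(i < n) a i *: y i) < tau ->
  \sum_(i < n) w i * H i (sabs (a i) / tau) <= 1.
Local Notation G := (ray_orlicz (affine_ext_ray ucg)).

(** Two-sided modular estimates become two-sided norm estimates, by the choice
    of tau just above the norm on either side. *)
Lemma orlicz_sequence_norm : exists2 D : R, 0 <= D & forall n (a : nat -> scalar R k),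
  rn (\sum_(i < n) a i *: y i) <= D * fine (lG_norm G (trunc n a)) /\
  fine (lG_norm G (trunc n a)) <= D * rn (\sum_(i < n) a i *: y i).
Proof.
pose D := Num.max (L * 4) (4 / m * K).
have D1 : L * 4 <= D by rewrite le_max lexx.
have D2 : 4 / m * K <= D by rewrite le_max lexx orbT.
exists D; first by apply: le_trans D1; rewrite mulr_ge0.
move=> n a; have Nfin := trunc_fin (unit_seq_lG k G) n a.
have [_ Nlt] := finite_partP _ _ Nfin.
set N := lG_norm G (trunc n a); have N0 : (0 <= N)%E by exact: lG_norm_ge0.
have NE : N = (fine N)%:E by rewrite fineK// ge0_fin_numE.
have fN0 : 0 <= fine N by rewrite fine_ge0.
set r := rn _; have r0 : 0 <= r by exact: rn_ge0.
split.
- apply: le_trans (ler_wpM2r fN0 D1).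
  apply/ler_addgt0Pr => e e0.
  have L4 : 0 < L * 4 + 1 by rewrite ltr_wpDl// mulr_ge0.
  pose d := e / (L * 4 + 1); have d0 : 0 < d by rewrite divr_gt0.
  have tau0 : 0 < fine N + d by rewrite ltr_wpDl.
  have hN : (N < (fine N + d)%:E)%E by rewrite {1}NE lte_fin ltrDl.
  have := lG_trunc_lower hN; rewrite sumEFin lee_fin => hs.
  have c0 i : 0 <= sabs (a i) / (fine N + d) by rewrite divr_ge0 ?sabs_ge0 ?(ltW tau0).
  have := weighted_modular_le rcH ucg Hg w_le1 c0 hs.
  under eq_bigr => i _ do rewrite -mulrA -invfM.
  have t4 : 0 < (fine N + d) * 4 by rewrite mulr_gt0.
  move=> /(y_upper t4) => /le_trans; apply.
  have eE : e = L * 4 * d + d by rewrite /d; field; rewrite gt_eqF.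
  have -> : L * ((fine N + d) * 4) = L * 4 * fine N + L * 4 * d by ring.
  by rewrite lerD2l eE lerDl ltW.
apply: le_trans (ler_wpM2r r0 D2).
apply/ler_addgt0Pr => e e0.
pose d := e * m / 4; have d0 : 0 < d by rewrite divr_gt0// mulr_gt0.
have tau0 : 0 < K * r + d by rewrite ltr_wpDl// mulr_ge0.
have hr : K * r < K * r + d by rewrite ltrDl.
have c0 i : 0 <= sabs (a i) / (K * r + d) by rewrite divr_ge0 ?sabs_ge0 ?(ltW tau0).
have := weighted_modular_ge rcH ucg Hg m_gt0 w_ge w_le1 c0 (y_lower hr) => hs.
have t0 : 0 < 4 / m * (K * r + d) by rewrite mulr_gt0// divr_gt0.
have : (N <= (4 / m * (K * r + d))%:E)%E.
  apply: lG_trunc_upper => //; rewrite sumEFin lee_fin; apply: le_trans hs.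
  rewrite le_eqVlt; apply/orP; left; apply/eqP; apply: eq_bigr => i _ /=; congr affine_ext.
  by field; rewrite !gt_eqF.
rewrite {1}NE lee_fin => /le_trans; apply.
rewrite mulrDr mulrA lerD2l /d le_eqVlt; apply/orP; left; apply/eqP.
by field; rewrite gt_eqF.
Qed.

End orlicz_sequence_norm.

(** * Biorthogonal systems in the Orlicz space *)

Section system.
Context {R : realType} {k : scalar_kind}.
Variable F : orlicz R.
Hypothesis finF : finite_orlicz F.
Hypothesis decF : essentially_decreasing (fun t : R => fine (F t) * t ^- 2).
Local Notation mu := (@lebesgue_measure R).
Local Notation I01 := (@unit_itv R).
Local Notation K := (scalar R k).
Local Notation p := (LF_eseminorm k F).

Variables (f : nat -> R -> K) (phi : nat -> LF k F -> K) (K0 K1 : R).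
Hypothesis f_fin : forall i, f i \in finite_part p.
Local Notation x i := (cls p (f i) : LF k F).
Hypothesis phi_lin : forall i a u v, phi i (a *: u + v) = a * phi i u + phi i v.
Hypothesis phi_x : forall i j, phi i (x j) = (i == j)%:R.
Hypothesis phi_unc : forall (A : seq nat) (e : nat -> bool) v, uniq A ->
  rn (\sum_(i <- A) (-1) ^+ (e i) *: (phi i v *: x i)) <= K0 * rn v.
Hypothesis K0_ge0 : 0 <= K0.
Hypothesis K1_gt0 : 0 < K1.
Hypothesis phi_bd : forall i v, sabs (phi i v) <= K1 * rn v.

Lemma phiZ i a v : phi i (a *: v) = a * phi i v.
Proof. exact: functionalZ. Qed.

(** A signed sum over a subsequence is a signed sum for the whole system,
    after reindexing the signs. *)
Lemma subsequence_unconditional (s : nat -> nat) (A : seq nat) (e : nat -> bool) v : injective s -> uniq A ->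
  rn (\sum_(i <- A) (-1) ^+ (e i) *: (phi (s i) v *: x (s i))) <= K0 * rn v.
Proof.
move=> s_inj uA; pose t j := nth 0%N A (index j [seq s i | i <- A]).
have -> : \sum_(i <- A) (-1) ^+ (e i) *: (phi (s i) v *: x (s i)) =
    \sum_(j <- [seq s i | i <- A]) (-1) ^+ ((e \o t) j) *: (phi j v *: x j).
  rewrite big_map; apply: eq_big_seq => i iA.
  by rewrite /t /= (index_map s_inj) nth_index.
by apply: phi_unc; rewrite map_inj_uniq.
Qed.

(** Unconditionality for finite combinations: the coefficients of a
    combination are its coordinates. *)
Lemma sign_bound (s : nat -> nat) (e : nat -> bool) n (a : nat -> K) :
  {homo s : i j / (i < j)%N} ->
  rn (\sum_(i < n) (-1) ^+ (e i) *: (a i *: x (s i))) <=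
  K0 * rn (\sum_(i < n) a i *: x (s i)).
Proof.
move=> hs; have s_inj : injective s.
  move=> i j sij; case: (ltngtP i j) => // /hs; by rewrite sij ltnn.
set v := \sum_(i < n) a i *: x (s i).
have phi_v i : (i < n)%N -> phi (s i) v = a i.
  move=> lin; rewrite /v.
  have : forall m, phi (s i) (\sum_(j < m) a j *: x (s j)) = if (i < m)%N then a i else 0.
    elim=> [|m ih]; first by rewrite big_ord0 -(scale0r 0) phiZ mul0r.
    rewrite big_ord_recr /= addrC phi_lin phi_x ih (inj_eq s_inj).
    case: (ltngtP i m) => [lim|mli|->].
    - by rewrite (ltn_trans lim (ltnSn m)) mulr0 add0r.
    - by rewrite ltnNge mli /= mulr0 addr0.
    - by rewrite ltnSn mulr1 addr0.
  by move=> ->; rewrite lin.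
have := subsequence_unconditional e v s_inj (iota_uniq 0 n).
have -> : iota 0 n = index_iota 0 n by rewrite /index_iota subn0.
by rewrite big_mkord; under eq_bigr => i _ do rewrite phi_v//.
Qed.

Lemma sum_cls_fin n (a : nat -> K) (g : nat -> R -> K) :
  (forall i, g i \in finite_part p) -> \sum_(i < n) a i *: g i \in finite_part p.
Proof. by move=> hg; apply: rpred_sum => i _; rewrite rpredZ. Qed.

Lemma sum_cls n (a : nat -> K) (g : nat -> R -> K) :
  (forall i, g i \in finite_part p) ->
  \sum_(i < n) a i *: cls p (g i) = cls p (\sum_(i < n) a i *: g i).
Proof. by move=> hg; rewrite (@cls_sum _ _ _ p 'I_n (index_enum _) (fun i => a i) (fun i => g i)). Qed.

(** * Large bounded parts: equivalence with the basis of l_2 *)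

Section bounded_parts.
Variable b : R.
Hypothesis b_gt0 : 0 < b.
Let low i x : bool := sabs (f i x) <= b.
Let z i := cut (low i) (f i).
Hypothesis phi_z : forall i, 2^-1 <= sabs (phi i (cls p (z i))).

Let mlow i : measurable_fun I01 (low i).
Proof.
by apply: measurable_fun_ler; [exact: (LF_nnmeas (f_fin i)).2|exact: measurable_cst].
Qed.

Let z_fin i : z i \in finite_part p. Proof. exact: cut_fin. Qed.

Let z_le i t : sabs (z i t) <= b.
Proof.
rewrite sabs_cut /low; have [h|h] := leP (sabs (f i t)) b; first by rewrite mul1r.
by rewrite mul0r ltW.
Qed.

Let z_lef i t : sabs (z i t) <= sabs (f i t).
Proof. by rewrite sabs_cut; case: (low i t); rewrite ?mul1r// mul0r sabs_ge0. Qed.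

Let theta i := phi i (cls p (z i)).

Let theta_neq0 i : theta i != 0.
Proof. by rewrite -sabs_eq0 gt_eqF//; apply: lt_le_trans (phi_z i). Qed.

(** The diagonal estimate replaces x_i by its bounded part z_i divided by
    phi_i(z_i). The quadratic bound for the norm and the orthogonality of
    signs then leave the integral of the sum of |a_i z_i|^2 / |phi_i(z_i)|^2,
    which is at most 4 b^2. *)
Lemma l2_upper : exists2 D : R, 0 <= D & forall n (a : nat -> K),
  \sum_(i < n) sabs (a i) ^+ 2 <= 1 -> rn (\sum_(i < n) a i *: x i) <= D.
Proof.
have [C C0 hC] := LN_quadratic finF decF.
exists (K0 * (C * (1 + 4 * b ^+ 2))).
  by rewrite !mulr_ge0 ?(ltW C0)// addr_ge0// mulr_ge0// sqr_ge0.
move=> n a ha.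
pose w j := (a j / theta j) *: cls p (z j).
have -> : \sum_(i < n) a i *: x i = \sum_(i < n) phi i (w i) *: x i.
  by apply: eq_bigr => i _; rewrite phiZ divfK.
apply: le_trans (diagonal_estimate phi_lin phi_unc n w) _.
pose c t i := a i / theta i * z i t.
pose H e t := sabs (signed_sum (c t) n e).
have H_eq (e : nat -> bool) t : (\sum_(i < n) ((-1) ^+ (e i) * (a i / theta i)) *: z i) t = signed_sum (c t) n e.
  by rewrite fct_sumE; apply: eq_bigr => i _; rewrite [LHS]/(_ * _) mulrA.
have h_fin (e : nat -> bool) : \sum_(i < n) ((-1) ^+ (e i) * (a i / theta i)) *: z i \in finite_part p.
  exact: (@sum_cls_fin n (fun i => (-1) ^+ (e i) * (a i / theta i)) z).
have H_meas e : nnmeas (H e).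
  rewrite (_ : H e = smod (\sum_(i < n) ((-1) ^+ (e i) * (a i / theta i)) *: z i)).
    exact: LF_nnmeas.
  by apply/funext => t; rewrite /smod H_eq.
have H2_meas e : nnmeas (fun t => H e t ^+ 2).
  by split=> [t|]; [exact: sqr_ge0|apply: measurable_funX; exact: (H_meas e).2].
pose B := \sum_(i < n) sabs (a i / theta i) * b.
have B0 : 0 <= B by rewrite sumr_ge0// => i _; rewrite mulr_ge0 ?sabs_ge0// ltW.
have H_bd e t : H e t <= B.
  apply: le_trans (sabs_sum _ _) _; apply: ler_sum => i _.
  rewrite [leLHS]sabsM sabs_sign mul1r [leLHS]sabsM; apply: ler_wpM2l; [exact: sabs_ge0|exact: z_le].
have mI := @unit_measurable R.
have q_fin e : (\int[mu]_(t in I01) (H e t ^+ 2)%:E)%E \is a fin_num.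
  rewrite ge0_fin_numE; last by apply: integral_ge0 => t _; rewrite lee_fin sqr_ge0.
  apply: (@le_lt_trans _ _ (\int[mu]_(t in I01) (B ^+ 2)%:E)%E).
    apply: ge0_le_integral => //.
    - by move=> t _; rewrite lee_fin sqr_ge0.
    - exact: (nnmeas_EFin (H2_meas e)).
    - by move=> t _; rewrite lee_fin ler_sqr ?nnegrE ?sabs_ge0//; exact: H_bd.
  by rewrite integral_cst// [X in (_ * X)%E]mu_unit_itv mule1 ltry.
pose q e := fine (\int[mu]_(t in I01) (H e t ^+ 2)%:E)%E.
have qE e : (\int[mu]_(t in I01) (H e t ^+ 2)%:E)%E = (q e)%:E by rewrite fineK.
have [_ avg_q] := @integral_savg R n (fun e t => H e t ^+ 2) q H2_meas qE.
have q_le : savg n (q : _ -> R^o) <= 4 * b ^+ 2.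
  rewrite -lee_fin -avg_q.
  apply: (@le_trans _ _ (\int[mu]_(t in I01) (4 * b ^+ 2)%:E)%E); last first.
    by rewrite integral_cst// [X in (_ * X)%E]mu_unit_itv mule1.
  apply: ge0_le_integral => //.
  - by move=> t _; rewrite lee_fin; apply: savg_ge0 => e; exact: sqr_ge0.
  - apply: (@nnmeas_EFin R (fun t => savg n ((fun e => H e t ^+ 2) : _ -> R^o))).
    exact: (@integral_savg R n (fun e t => H e t ^+ 2) q H2_meas qE).1.
  move=> t _; rewrite lee_fin savg_signed_sum2.
  apply: (@le_trans _ _ (\sum_(i < n) sabs (a i) ^+ 2 * (4 * b ^+ 2))); last first.
    by rewrite -mulr_suml ler_piMl// mulr_ge0// sqr_ge0.
  apply: ler_sum => i _; rewrite /c.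
  have e1 : sabs (a i / theta i * z i t) =
      sabs (a i) * ((sabs (theta i))^-1 * sabs (z i t)).
    by rewrite (sabsM (a i / theta i)) (sabsM (a i)) sabsV mulrA.
  rewrite e1 exprMn; apply: ler_wpM2l; first exact: sqr_ge0.
  have th0 : 0 < sabs (theta i) by apply: lt_le_trans (phi_z i).
  have th2 : (sabs (theta i))^-1 <= 2.
    by rewrite -[2]invrK lef_pV2 ?posrE ?invr_gt0//; exact: phi_z.
  rewrite (_ : 4 * b ^+ 2 = (2 * b) ^+ 2); last by rewrite exprMn -natrX.
  have h1 : 0 <= (sabs (theta i))^-1 * sabs (z i t).
    by rewrite mulr_ge0 ?sabs_ge0// invr_ge0 ltW.
  rewrite ler_sqr ?nnegrE//; last by rewrite mulr_ge0// ltW.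
  by apply: ler_pM => //; rewrite ?sabs_ge0 ?invr_ge0 ?(ltW th0).
apply: (@le_trans _ _ (savg n ((fun e => K0 * C + (K0 * C) *: (q e : R^o)) : _ -> R^o))).
  apply: le_savg => e.
  rewrite -[X in K0 * C + X]/(K0 * C * q e) -{1}[K0 * C]mulr1 -mulrDr -mulrA ler_wpM2l//.
  have -> : \sum_(j < n) (-1) ^+ e j *: w j =
      cls p (\sum_(i < n) ((-1) ^+ (e i) * (a i / theta i)) *: z i).
    rewrite -(@sum_cls n (fun i => (-1) ^+ (e i) * (a i / theta i)))//.
    by apply: eq_bigr => i _; rewrite scalerA.
  apply: rn_cls_le => //; rewrite (_ : smod _ = H e); last first.
    by apply/funext => t; rewrite /smod H_eq.
  apply: hC => //; last by rewrite qE.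
  by rewrite -lee_fin -qE; apply: integral_ge0 => t _; rewrite lee_fin sqr_ge0.
rewrite savgD savg_cst savgZ -[X in _ + X]/(K0 * C * _) -{1}[K0 * C]mulr1 -mulrDr.
by rewrite -mulrA ler_wpM2l// ler_wpM2l ?(ltW C0)// lerD2l.
Qed.

(** If z_i had a small square integral, its norm would be small by the
    quadratic bound applied to a large multiple of z_i, contradicting
    |phi_i(z_i)| >= 1/2. *)
Let z_energy : exists2 d : R, 0 < d &
  forall i, (d%:E <= \int[mu]_(t in I01) (sabs (z i t) ^+ 2)%:E)%E.
Proof.
have [C C0 hC] := LN_quadratic finF decF.
(* with this l a square integral below l^2 makes |phi_i(z_i)| at most 1/4 *)
pose l := (8 * K1 * C)^-1; have l0 : 0 < l by rewrite invr_gt0 !mulr_gt0.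
exists (l ^+ 2); first by rewrite exprn_gt0.
move=> i; rewrite leNgt; apply/negP => small.
have z_meas : nnmeas (smod (z i)) by exact: LF_nnmeas.
have zl_meas : nnmeas (fun t => l^-1 * smod (z i) t).
  by apply: nnmeasZ => //; rewrite invr_ge0 ltW.
have h : (LN F (fun t => l^-1 * smod (z i) t)%R <= (C * (1 + 1))%:E)%E.
  apply: hC => //.
  under eq_integral do rewrite exprMn EFinM.
  rewrite ge0_integralZl//; last 4 first.
  - exact: unit_measurable.
  - apply/measurable_EFinP; apply: measurable_funX; exact: z_meas.2.
  - by move=> t _; rewrite lee_fin sqr_ge0.
  - by rewrite lee_fin sqr_ge0.
  rewrite exprVn; apply: (@le_trans _ _ (((l ^+ 2)^-1)%:E * (l ^+ 2)%:E)%E).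
    by apply: lee_wpmul2l; [rewrite lee_fin invr_ge0 sqr_ge0|exact: ltW].
  by rewrite -EFinM mulVf// expf_neq0// gt_eqF.
have {}h : rn (cls p (z i)) <= l * (C * 2).
  apply: rn_cls_le => //.
  rewrite (_ : smod (z i) = fun t => l * (l^-1 * smod (z i) t)); last first.
    by apply/funext => t; rewrite mulrA divff ?mul1r// gt_eqF.
  rewrite (LNZ F (fun t => l^-1 * smod (z i) t) (ltW l0)) EFinM.
  by apply: lee_wpmul2l; [rewrite lee_fin ltW|].
have := le_trans (phi_z i) (phi_bd i (cls p (z i))); apply/negP; rewrite -ltNge.
apply: (@le_lt_trans _ _ (K1 * (l * (C * 2)))); first by rewrite ler_wpM2l// ltW.
rewrite (_ : K1 * (l * (C * 2)) = 4^-1); last by rewrite /l; field; rewrite !gt_eqF.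
by rewrite ltf_pV2 ?posrE// ltr_nat.
Qed.

(** The norm dominates the L_1 norm; by unconditionality so does the sign
    average of the L_1 norms, and Khinchine's inequality bounds it below by
    the integral of the square function of the a_i z_i. This function is at
    most b when the a_i have square sum 1, hence dominates its square divided
    by b, whose integral is bounded below. *)
Lemma l2_lower : exists2 D : R, 0 <= D & forall n (a : nat -> K),
  \sum_(i < n) sabs (a i) ^+ 2 = 1 -> 1 <= D * rn (\sum_(i < n) a i *: x i).
Proof.
have [d d0 hd] := z_energy; have [C C0 hC] := LN_L1 finF decF.
exists (4 * b * C * K0 / d).
  by rewrite divr_ge0 ?(ltW d0)// !mulr_ge0 ?(ltW b_gt0) ?(ltW C0).
move=> n a ha.
pose T e t := sabs (signed_sum (fun i => a i * f i t) n e).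
have T_eq (e : nat -> bool) t : (\sum_(i < n) ((-1) ^+ (e i) * a i) *: f i) t =
    signed_sum (fun i => a i * f i t) n e.
  by rewrite fct_sumE; apply: eq_bigr => i _; rewrite [LHS]/(_ * _) mulrA.
have t_fin (e : nat -> bool) : \sum_(i < n) ((-1) ^+ (e i) * a i) *: f i \in finite_part p.
  exact: (@sum_cls_fin n (fun i => (-1) ^+ (e i) * a i) f).
have T_smod e : T e = smod (\sum_(i < n) ((-1) ^+ (e i) * a i) *: f i).
  by apply/funext => t; rewrite /smod T_eq.
have T_meas e : nnmeas (T e) by rewrite T_smod; exact: LF_nnmeas.
have mI := @unit_measurable R.
set v := \sum_(i < n) a i *: x i.
have T_int e : (\int[mu]_(t in I01) (T e t)%:E <= (C * (K0 * rn v))%:E)%E.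
  apply: hC => //; first by rewrite mulr_ge0// rn_ge0.
  rewrite T_smod LNfin// lee_fin.
  rewrite -(@sum_cls n (fun i => (-1) ^+ (e i) * a i) f)//.
  under eq_bigr do rewrite -scalerA.
  exact: (@sign_bound id).
have T_fin e : (\int[mu]_(t in I01) (T e t)%:E)%E \is a fin_num.
  rewrite ge0_fin_numE; last by apply: integral_ge0 => t _; rewrite lee_fin sabs_ge0.
  exact: le_lt_trans (T_int e) (ltry _).
pose I e := fine (\int[mu]_(t in I01) (T e t)%:E)%E.
have IE e : (\int[mu]_(t in I01) (T e t)%:E)%E = (I e)%:E by rewrite fineK.
have [avg_meas avg_I] := integral_savg n T_meas IE.
have avg_le : savg n (I : _ -> R^o) <= C * (K0 * rn v).
  by apply: savg_le => e; rewrite -lee_fin -IE.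
have z2_meas i : nnmeas (fun t => sabs (z i t) ^+ 2).
  split=> [t|]; first exact: sqr_ge0.
  by apply: measurable_funX; exact: (LF_nnmeas (z_fin i)).2.
have az2_meas i : nnmeas (fun t => sabs (a i) ^+ 2 * sabs (z i t) ^+ 2).
  by apply: nnmeasZ => //; exact: sqr_ge0.
have low_int : (d%:E <= \int[mu]_(t in I01)
    (\sum_(i < n) sabs (a i) ^+ 2 * sabs (z i t) ^+ 2)%:E)%E.
  under eq_integral do rewrite -sumEFin.
  rewrite ge0_integral_sum//; last 2 first.
  - by move=> i; exact: (nnmeas_EFin (az2_meas i)).
  - by move=> i t _; rewrite lee_fin; exact: (az2_meas i).1.
  rewrite -[d]mul1r -ha mulr_suml -sumEFin; apply: lee_sum => i _.
  under eq_integral do rewrite EFinM.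
  rewrite ge0_integralZl//; last 3 first.
  - exact: (nnmeas_EFin (z2_meas i)).
  - by move=> t _; rewrite lee_fin sqr_ge0.
  - by rewrite lee_fin sqr_ge0.
  by rewrite EFinM; apply: lee_wpmul2l => //; rewrite lee_fin sqr_ge0.
have khin t : (4 * b)^-1 * \sum_(i < n) sabs (a i) ^+ 2 * sabs (z i t) ^+ 2 <=
    savg n ((fun e => T e t) : _ -> R^o).
  set s := \sum_(i < n) _.
  have s0 : 0 <= s by rewrite sumr_ge0// => i _; rewrite mulr_ge0 ?sqr_ge0.
  have sb : s <= b ^+ 2.
    rewrite -[b ^+ 2]mul1r -ha mulr_suml; apply: ler_sum => i _.
    by rewrite ler_wpM2l ?sqr_ge0// ler_sqr ?nnegrE ?sabs_ge0// ltW.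
  have h1 : s / b <= Num.sqrt s.
    apply: le_sqrt_of_sqr => //; rewrite exprMn exprVn ler_pdivrMr ?exprn_gt0//.
    by rewrite expr2 ler_wpM2l.
  have h2 : Num.sqrt s <= Num.sqrt (\sum_(i < n) sabs (a i * f i t) ^+ 2).
    apply: ler_wsqrtr; apply: ler_sum => i _; rewrite sabsM exprMn ler_wpM2l ?sqr_ge0//.
    by rewrite ler_sqr ?nnegrE ?sabs_ge0//; exact: z_lef.
  have h3 := khinchine (fun i => a i * f i t) n.
  have h4 := le_trans h1 (le_trans h2 h3).
  by rewrite invfM mulrAC -mulrA ler_pdivrMl.
have s_meas : nnmeas (fun t => \sum_(i < n) sabs (a i) ^+ 2 * sabs (z i t) ^+ 2).
  exact: (nnmeas_sum (index_enum 'I_n)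
    (g := fun (i : 'I_n) t => sabs (a i) ^+ 2 * sabs (z i t) ^+ 2) (fun i => az2_meas i)).
have b4 : 0 < (4 * b)^-1 by rewrite invr_gt0 mulr_gt0.
have main : (((4 * b)^-1 * d)%:E <= (savg n (I : _ -> R^o))%:E)%E.
  rewrite -avg_I EFinM.
  apply: (@le_trans _ _ (((4 * b)^-1)%:E * \int[mu]_(t in I01)
    (\sum_(i < n) sabs (a i) ^+ 2 * sabs (z i t) ^+ 2)%:E)%E).
    by apply: lee_wpmul2l => //; rewrite lee_fin ltW.
  rewrite -ge0_integralZl//; last 3 first.
  - exact: (nnmeas_EFin s_meas).
  - by move=> t _; rewrite lee_fin; exact: s_meas.1.
  - by rewrite lee_fin ltW.
  apply: ge0_le_integral => //.
  - by move=> t _; rewrite -EFinM lee_fin mulr_ge0 ?(ltW b4)//; exact: s_meas.1.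
  - by apply: measurable_funeM; exact: (nnmeas_EFin s_meas).
  - exact: (nnmeas_EFin avg_meas).
  - by move=> t _; rewrite -EFinM lee_fin; exact: khin.
rewrite lee_fin in main; have {main}avg_le := le_trans main avg_le.
rewrite (_ : 4 * b * C * K0 / d * rn v = (C * (K0 * rn v)) / ((4 * b)^-1 * d)).
  by rewrite ler_pdivlMr ?mul1r// mulr_gt0.
by field; rewrite !gt_eqF.
Qed.

(** The two estimates for coefficients of square sum 1, made homogeneous. *)
Lemma l2_equivalence : exists2 D : R, 0 <= D & forall n (a : nat -> K),
  rn (\sum_(i < n) a i *: x i) <= D * Num.sqrt (\sum_(i < n) sabs (a i) ^+ 2) /\
  Num.sqrt (\sum_(i < n) sabs (a i) ^+ 2) <= D * rn (\sum_(i < n) a i *: x i).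
Proof.
have [D1 D10 h1] := l2_upper; have [D2 D20 h2] := l2_lower.
exists (D1 + D2); first exact: addr_ge0.
move=> n a; set s2 := \sum_(i < n) sabs (a i) ^+ 2; set s := Num.sqrt s2.
have s2_ge0 : 0 <= s2 by rewrite sumr_ge0// => i _; exact: sqr_ge0.
have [s0|s0] := eqVneq s 0.
  have a0 i : (i < n)%N -> a i = 0.
    move=> lin; apply/eqP; rewrite -sabs_eq0 -sqrf_eq0.
    have : s2 = 0 by rewrite -(sqr_sqrtr s2_ge0) -/s s0 expr0n.
    move=> /eqP; rewrite psumr_eq0; last by move=> j _; exact: sqr_ge0.
    by move=> /allP/(_ (Ordinal lin)); apply; rewrite mem_index_enum.
  rewrite s0 mulr0 big1 ?rn0 ?mulr0// => i _; by rewrite a0// scale0r.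
have {}s0 : 0 < s by rewrite lt_def s0 sqrtr_ge0.
pose a' i := sreal s^-1 * a i.
have sab i : sabs (a' i) ^+ 2 = s ^- 2 * sabs (a i) ^+ 2.
  by rewrite sabsM exprMn sabs_sreal ger0_norm ?invr_ge0 ?ltW// exprVn.
have a'1 : \sum_(i < n) sabs (a' i) ^+ 2 = 1.
  under eq_bigr do rewrite sab.
  by rewrite -mulr_sumr -/s2 -(sqr_sqrtr s2_ge0) -/s mulVf// expf_neq0// gt_eqF.
have rna : rn (\sum_(i < n) a' i *: x i) = s^-1 * rn (\sum_(i < n) a i *: x i).
  under eq_bigr do rewrite -scalerA.
  by rewrite -scaler_sumr rnZ sabs_sreal ger0_norm// invr_ge0 ltW.
split.
  have := h1 n a'; rewrite a'1 lexx rna => /(_ isT).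
  rewrite ler_pdivrMl// mulrC => /le_trans; apply.
  by rewrite ler_wpM2r ?(ltW s0)// lerDl.
have := h2 n a' a'1; rewrite rna mulrCA ler_pdivlMl// mulr1 => /le_trans; apply.
by rewrite ler_wpM2r ?rn_ge0// lerDr.
Qed.

End bounded_parts.

(** * Disjoint blocks *)

Lemma sum_single (h : nat -> K) n : (forall i j, h i != 0 -> h j != 0 -> i = j) ->
  sabs (\sum_(i < n) h i) = \sum_(i < n) sabs (h i).
Proof.
move=> hh; elim: n => [|n ih]; first by rewrite !big_ord0 sabs0.
rewrite !big_ord_recr /=; have [->|hn] := eqVneq (h n) 0; first by rewrite sabs0 !addr0.
have h0 i : (i < n)%N -> h i = 0.
  move=> lin; apply/eqP; apply: contraT => hi; move: (hh _ _ hi hn) lin => ->.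
  by rewrite ltnn.
rewrite !big1 ?add0r// => i _; by rewrite h0// sabs0.
Qed.

Lemma sum_single_orlicz (h : nat -> R) n : (forall i j, h i != 0 -> h j != 0 -> i = j) ->
  F (\sum_(i < n) h i) = (\sum_(i < n) F (h i))%E.
Proof.
move=> hh; elim: n => [|n ih]; first by rewrite !big_ord0 orlicz0.
rewrite !big_ord_recr /=; have [->|hn] := eqVneq (h n) 0.
  by rewrite orlicz0 addr0 adde0.
have h0 i : (i < n)%N -> h i = 0.
  move=> lin; apply/eqP; apply: contraT => hi; move: (hh _ _ hi hn) lin => ->.
  by rewrite ltnn.
rewrite !big1 ?add0r ?add0e// => i _; by rewrite h0// orlicz0.
Qed.

Section blocks.
Variables (s : nat -> nat) (A : nat -> R -> bool) (l J : nat -> nat).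
Hypothesis s_inc : {homo s : i j / (i < j)%N}.
Hypothesis A_meas : forall i, measurable_fun I01 (A i).
Hypothesis A_disj : forall i j t, A i t -> A j t -> i = j.
Hypothesis l_gt0 : forall i, (0 < l i)%N.
Hypothesis A_lev : forall i t, A i t ->
  (l i <= Num.truncn (sabs (f (s i) t)) < l i + J i)%N.
Let u i := cut (A i) (f (s i)).
Hypothesis phi_u : forall i, 4^-1 <= sabs (phi (s i) (cls p (u i))).

Let s_inj : injective s.
Proof. by move=> i j sij; case: (ltngtP i j) => // /s_inc; rewrite sij ltnn. Qed.

Let u_fin i : u i \in finite_part p. Proof. exact: cut_fin. Qed.

Let theta i := phi (s i) (cls p (u i)).

Let theta_neq0 i : theta i != 0.
Proof. by rewrite -sabs_eq0 gt_eqF//; apply: lt_le_trans (phi_u i). Qed.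

Let u_disj i j t : u i t != 0 -> u j t != 0 -> i = j.
Proof.
rewrite /u /cut => ui uj; apply: (@A_disj i j t).
  by apply: contraNT ui => /negPf->; rewrite mul0r.
by apply: contraNT uj => /negPf->; rewrite mul0r.
Qed.

Let sumE n (c : nat -> K) (g : nat -> R -> K) t :
  (\sum_(i < n) c i *: g i) t = \sum_(i < n) c i * g i t.
Proof. by rewrite fct_sumE. Qed.

Let sabs_usum n (c : nat -> K) t :
  sabs ((\sum_(i < n) c i *: u i) t) = \sum_(i < n) sabs (c i) * sabs (u i t).
Proof.
rewrite sumE (@sum_single (fun i => c i * u i t)).
  by apply: eq_bigr => i _; rewrite sabsM.
move=> i j hi hj; apply: (@u_disj i j t).
  by apply: contraNneq hi => ->; rewrite mulr0.
by apply: contraNneq hj => ->; rewrite mulr0.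
Qed.

(** The diagonal estimate with w_i = a_i / phi_i(u_i) u_i; since the u_i are
    disjoint, signs do not change the modulus of their combinations. *)
Lemma block_upper n (a : nat -> K) : rn (\sum_(i < n) a i *: x (s i)) <=
  4 * K0 * rn (cls p (\sum_(i < n) a i *: u i)).
Proof.
pose w j : LF k F := (a j / theta j) *: cls p (u j).
have -> : \sum_(i < n) a i *: x (s i) = \sum_(i < n) phi (s i) (w i) *: x (s i).
  by apply: eq_bigr => i _; rewrite phiZ divfK.
have lin i c v v' : phi (s i) (c *: v + v') = c * phi (s i) v + phi (s i) v'.
  exact: phi_lin.
apply: le_trans (@diagonal_estimate _ _ _ (fun i => x (s i)) (fun i => phi (s i))
  K0 lin _ n w) _; first by move=> B e v uB; exact: subsequence_unconditional.
apply: savg_le => e; rewrite mulrAC [leRHS]mulrC ler_wpM2l//.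
have -> : \sum_(j < n) (-1) ^+ e j *: w j =
    cls p (\sum_(i < n) ((-1) ^+ (e i) * (a i / theta i)) *: u i).
  rewrite -(@sum_cls n (fun i => (-1) ^+ (e i) * (a i / theta i)))//.
  by apply: eq_bigr => i _; rewrite scalerA.
have fin1 := @sum_cls_fin n (fun i => (-1) ^+ (e i) * (a i / theta i)) u u_fin.
have fin2 := @sum_cls_fin n a u u_fin.
apply: (rn_cls_le fin1).
apply: (@le_trans _ _ (LN F (fun t => 4 * smod (\sum_(i < n) a i *: u i) t)%R)).
  apply: (LN_le F (LF_nnmeas fin1) (nnmeasZ (ler0n _ 4) (LF_nnmeas fin2))).
  move=> t _; rewrite /smod (@sabs_usum n (fun i => (-1) ^+ (e i) * (a i / theta i))).
  rewrite sabs_usum mulr_sumr; apply: ler_sum => i _.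
  rewrite [leRHS]mulrA; apply: ler_wpM2r; first exact: sabs_ge0.
  rewrite (sabsM ((-1) ^+ _)) sabs_sign mul1r sabsM sabsV mulrC.
  apply: ler_wpM2r; first exact: sabs_ge0.
  by rewrite -[4]invrK lef_pV2 ?posrE ?invr_gt0//; [exact: phi_u|apply: lt_le_trans (phi_u i)].
by rewrite (LNZ F (smod (\sum_(i < n) a i *: u i)) (ler0n _ 4)) (LNfin fin2).
Qed.

Let block_count n t : \sum_(i < n) (A i t)%:R <= 1 :> R.
Proof.
elim: n => [|n ih]; first by rewrite big_ord0.
rewrite big_ord_recr /=; have [An|] := boolP (A n t); last by rewrite addr0.
rewrite big1 ?add0r// => i _; have [Ai|//] := boolP (A i t).
by have := ltn_ord i; rewrite (A_disj Ai An) ltnn.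
Qed.

(** Conversely, the sum of the a_i u_i is the diagonal of the array of the
    parts of the a_i x_i in the sets A_j. A signed double sum over this array
    is the sum of the +-a_i x_i multiplied by a function with values in {-1,
    0, 1}. *)
Lemma block_lower n (a : nat -> K) : rn (cls p (\sum_(i < n) a i *: u i)) <=
  K0 * rn (\sum_(i < n) a i *: x (s i)).
Proof.
pose z i j : LF k F := a i *: cls p (cut (A j) (f (s i))).
have -> : cls p (\sum_(i < n) a i *: u i) = savg n (fun e => \sum_(i < n)
    \sum_(j < n) ((-1) ^+ (e i) * (-1) ^+ (e j)) *: z i j).
  by rewrite savg_diagonal -(@sum_cls n a u).
apply: le_trans (rn_savg _ _) _; apply: savg_le => e.
have zf i j : cut (A j) (f (s i)) \in finite_part p by exact: cut_fin.
pose c i j := (-1) ^+ (e i) * (-1) ^+ (e j) * a i.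
pose g i : R -> K := \sum_(j < n) c i j *: cut (A j) (f (s i)).
have g_fin i : g i \in finite_part p.
  exact: (@sum_cls_fin n (c i) (fun j => cut (A j) (f (s i))) (zf i)).
pose S : R -> K := \sum_(i < n) 1 *: g i.
have S_fin : S \in finite_part p by exact: (@sum_cls_fin n (fun=> 1) g g_fin).
have -> : \sum_(i < n) \sum_(j < n) ((-1) ^+ (e i) * (-1) ^+ (e j)) *: z i j = cls p S.
  rewrite -(@sum_cls n (fun=> 1) g g_fin); apply: eq_bigr => i _.
  rewrite scale1r -(@sum_cls n (c i) (fun j => cut (A j) (f (s i))) (zf i)).
  by apply: eq_bigr => j _; rewrite scalerA.
apply: le_trans (sign_bound e n a s_inc).
have -> : \sum_(i < n) (-1) ^+ e i *: (a i *: x (s i)) =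
    cls p (\sum_(i < n) ((-1) ^+ (e i) * a i) *: f (s i)).
  rewrite -(@sum_cls n (fun i => (-1) ^+ (e i) * a i) (fun i => f (s i)) (fun i => f_fin (s i))).
  by apply: eq_bigr => i _; rewrite scalerA.
have fin1 : \sum_(i < n) ((-1) ^+ (e i) * a i) *: f (s i) \in finite_part p.
  exact: (@sum_cls_fin n (fun i => (-1) ^+ (e i) * a i) (fun i => f (s i)) (fun i => f_fin (s i))).
apply: (rn_cls_mono S_fin fin1) => t _.
have -> : S t = (\sum_(j < n) (-1) ^+ (e j) * (A j t)%:R) *
    (\sum_(i < n) ((-1) ^+ (e i) * a i) *: f (s i)) t.
  have -> : S t = \sum_(i < n) 1 * g i t by exact: (@sumE n (fun=> 1) g t).
  rewrite (@sumE n (fun i => (-1) ^+ (e i) * a i) (fun i => f (s i))).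
  rewrite mulr_sumr; apply: eq_bigr => i _.
  have -> : g i t = \sum_(j < n) c i j * cut (A j) (f (s i)) t.
    exact: (@sumE n (c i) (fun j => cut (A j) (f (s i))) t).
  rewrite mul1r mulr_suml.
  by apply: eq_bigr => j _; rewrite /cut /c; ring.
rewrite sabsM -[leRHS]mul1r; apply: ler_wpM2r; first exact: sabs_ge0.
rewrite (@sum_single (fun j => (-1) ^+ e j * (A j t)%:R)); last first.
  have nz i : (-1) ^+ e i * (A i t)%:R != 0 :> K -> A i t.
    by apply: contraNT => /negPf->; rewrite mulr0.
  by move=> i j /nz hi /nz hj; exact: A_disj hj.
have -> : \sum_(i < n) sabs ((-1) ^+ e i * (A i t)%:R : K) = \sum_(i < n) (A i t)%:R.
  apply: eq_bigr => i _; rewrite sabsM sabs_sign mul1r.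
  by case: (A i t); rewrite ?sabs1 ?sabs0.
exact: block_count.
Qed.

(** The modulus of u_i, rounded down to an integer; since it takes finitely
    many integer values, its modular is a weighted sum of values of F. *)
Let r i t : R := (A i t)%:R * (Num.truncn (sabs (f (s i) t)))%:R.

Let lev i j t : bool :=
  A i t && ((j%:R <= sabs (f (s i) t)) && (sabs (f (s i) t) < j.+1%:R)).

Let lev_meas i j : measurable_fun I01 (lev i j).
Proof.
have mf := (LF_nnmeas (f_fin (s i))).2.
apply: measurable_and => //; apply: measurable_and.
  by apply: measurable_fun_ler => //; exact: measurable_cst.
by apply: measurable_fun_ltr => //; exact: measurable_cst.
Qed.

Let lev_nnmeas i j : nnmeas (fun t => (lev i j t)%:R).
Proof. by split=> [t//|]; exact: measurable_nat_of_bool. Qed.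

Let levE i j t : A i t -> lev i j t = (Num.truncn (sabs (f (s i) t)) == j).
Proof.
move=> Ai; rewrite /lev Ai /=; have y0 := sabs_ge0 (f (s i) t).
apply/idP/eqP => [|<-]; first exact: truncn_def.
exact: truncn_itv.
Qed.

Let level_sum i t (h : nat -> R) : h 0%N = 0 ->
  h (A i t * Num.truncn (sabs (f (s i) t)))%N =
  \sum_(j < J i) h (l i + j)%N * (lev i (l i + j) t)%:R.
Proof.
move=> h0; have [Ai|nAi] := boolP (A i t); last first.
  rewrite mul0n h0 big1// => j _; by rewrite /lev (negPf nAi) mulr0.
rewrite mul1n; set y := Num.truncn _.
have /andP[ly yJ] := A_lev Ai.
have yl : (y - l i < J i)%N by rewrite ltn_subLR.
rewrite (bigD1 (Ordinal yl))//= subnKC// levE// eqxx mulr1 big1 ?addr0// => j jy.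
rewrite levE//; case: eqP => [yE|_]; last by rewrite mulr0.
by move: jy; rewrite -val_eqE /= -/y -[y]/(Num.truncn _) yE addKn eqxx.
Qed.

Let v i j : R := fine (\int[mu]_(t in I01) ((lev i j t)%:R)%:E)%E.

Let vE i j : (\int[mu]_(t in I01) ((lev i j t)%:R)%:E = (v i j)%:E)%E.
Proof.
rewrite fineK// ge0_fin_numE; last by apply: integral_ge0 => t _; rewrite lee_fin.
apply: (@le_lt_trans _ _ (\int[mu]_(t in I01) 1%:E)%E).
  apply: ge0_le_integral => //.
  - exact: unit_measurable.
  - exact: (nnmeas_EFin (lev_nnmeas i j)).
  - by move=> t _; rewrite lee_fin lern1 leq_b1.
rewrite integral_cst; last exact: unit_measurable.
by rewrite [X in (_ * X)%E]mu_unit_itv mule1 ltry.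
Qed.

Let v_ge0 i j : 0 <= v i j.
Proof. by rewrite fine_ge0//; apply: integral_ge0 => t _; rewrite lee_fin. Qed.

Let orlicz_r i t c : 0 <= c -> F (c * r i t) =
  (\sum_(j < J i) oreal F (c * (l i + j)%:R) * (lev i (l i + j) t)%:R)%:E.
Proof.
move=> c0; rewrite -(@level_sum i t (fun j => oreal F (c * j%:R))); last first.
  by rewrite mulr0 oreal0.
rewrite orealE//; first by rewrite /r -natrM.
by rewrite mulr_ge0// /r mulr_ge0.
Qed.

Let integral_r i c : 0 <= c -> (\int[mu]_(t in I01) F (c * r i t)%R =
  (\sum_(j < J i) oreal F (c * (l i + j)%:R) * v i (l i + j))%:E)%E.
Proof.
move=> c0; under eq_integral do rewrite orlicz_r// -sumEFin.
rewrite ge0_integral_sum//; last 3 first.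
- exact: unit_measurable.
- move=> j; apply/measurable_EFinP; apply: measurable_funM => //.
  exact: (lev_nnmeas i _).2.
- move=> j t _; rewrite lee_fin mulr_ge0//; apply: oreal_ge0.
  by rewrite mulr_ge0.
rewrite -sumEFin; apply: eq_bigr => j _.
under eq_integral do rewrite EFinM.
rewrite ge0_integralZl; [by rewrite vE EFinM|exact: unit_measurable| | |].
- exact: (nnmeas_EFin (lev_nnmeas i _)).
- by move=> t _; rewrite lee_fin.
- by rewrite lee_fin oreal_ge0// mulr_ge0.
Qed.

(** The modular of r_i, and its distribution over the values l_i + j; the
    modular of c r_i is then the mass times [block_fun i c]. *)
Definition block_mass i : R := \sum_(j < J i) oreal F (l i + j)%:R * v i (l i + j).

Definition block_weight i (j : 'I_(J i)) : R :=
  oreal F (l i + j)%:R * v i (l i + j) / block_mass i.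

Definition block_fun i : R -> R :=
  \sum_(j < J i) block_weight j *: dilate F (l i + j)%:R.

Let lj_ge1 i j : 1 <= (l i + j)%:R :> R.
Proof. by rewrite ler1n addn_gt0 l_gt0. Qed.

Lemma block_mass_ge0 i : 0 <= block_mass i.
Proof. by apply: sumr_ge0 => j _; rewrite mulr_ge0// oreal_ge0. Qed.

Let mass_fun i c : 0 < block_mass i -> 0 <= c ->
  block_mass i * block_fun i c =
  \sum_(j < J i) oreal F (c * (l i + j)%:R) * v i (l i + j).
Proof.
move=> m0 c0; rewrite /block_fun fct_sumE mulr_sumr; apply: eq_bigr => j _.
have -> : (block_weight j *: dilate F (l i + j)%:R) c = block_weight j *
    (oreal F (c * (l i + j)%:R) / oreal F (l i + j)%:R).
  by rewrite [c * _]mulrC.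
have o0 := oreal_gt0 finF decF (lj_ge1 i j).
by rewrite /block_weight; field; rewrite !gt_eqF.
Qed.

Let r_nnmeas i : nnmeas (r i).
Proof.
split=> [t|]; first by rewrite /r mulr_ge0.
rewrite (_ : r i = fun t => \sum_(j < J i) (l i + j)%:R * (lev i (l i + j) t)%:R).
  apply: measurable_sum => j; apply: measurable_funM => //.
  exact: (lev_nnmeas i _).2.
apply/funext => t; rewrite /r -natrM.
exact: (@level_sum i t (fun j => j%:R)).
Qed.

Let r_le i t : r i t <= sabs (u i t).
Proof.
rewrite sabs_cut /r; apply: ler_wpM2l => //.
by have /andP[] := truncn_itv (sabs_ge0 (f (s i) t)).
Qed.

Let r_ge i t : sabs (u i t) <= 2 * r i t.
Proof.
rewrite sabs_cut /r; have [Ai|nAi] := boolP (A i t); last by rewrite !mul0r mulr0.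
rewrite !mul1r; have /andP[_ /ltW h] := truncn_itv (sabs_ge0 (f (s i) t)).
apply: le_trans h _; have /andP[ly _] := A_lev Ai.
rewrite -natrM ler_nat mul2n -addnn -addn1 leq_add2l.
exact: leq_trans (l_gt0 i) ly.
Qed.

Hypothesis x_norm : forall i, rn (x i) < 1.

Lemma block_mass_le1 i : block_mass i <= 1.
Proof.
rewrite -lee_fin /block_mass.
have := @integral_r i 1 ler01; under eq_bigr do rewrite mul1r.
move=> <-; under eq_integral do rewrite mul1r.
have fi := f_fin (s i).
have h : (LF_modular F (fun t => smod (f (s i)) t / 1)%R <= 1)%E.
  apply: LN_lt_modular; first exact: LF_nnmeas.
  by rewrite (LNfin fi) lte_fin.
apply: le_trans h; apply: (modular_le F (r_nnmeas i)).
  by apply: nnmeasV => //; exact: LF_nnmeas.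
move=> t _; rewrite divr1; apply: le_trans (r_le i t) _.
by rewrite sabs_cut; case: (A i t); rewrite ?mul1r// mul0r sabs_ge0.
Qed.

(** A small modular of r_i would, by the Delta_2 condition, make the norm of
    u_i small, contradicting the lower bound for phi(u_i). The condition
    applies because the values of r_i are at least 1. *)
Lemma block_mass_lower : exists2 m : R, 0 < m & forall i, m <= block_mass i.
Proof.
have [C C1 hC] := oreal_delta2 finF decF.
have C0 : 0 < C by apply: lt_le_trans C1.
pose q := Num.max 1 (16 * K1); have q1 : 1 <= q by rewrite le_max lexx.
have q0 : 0 < q by apply: lt_le_trans q1.
exists (C * q ^+ 2)^-1; first by rewrite invr_gt0 mulr_gt0// exprn_gt0.
move=> i; rewrite leNgt; apply/negP => small.
have hq : (LN F (r i) <= (q^-1)%:E)%E.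
  apply: luxemburg_le; first by rewrite invr_gt0.
  rewrite /LF_modular invrK; under eq_integral do rewrite mulrC.
  rewrite integral_r ?(ltW q0)// lee_fin.
  apply: (@le_trans _ _ (C * q ^+ 2 * block_mass i)); last first.
    rewrite mulrC -ler_pdivlMr ?mulr_gt0 ?exprn_gt0// mul1r.
    exact: ltW.
  rewrite mulr_sumr; apply: ler_sum => j _; rewrite mulrA; apply: ler_wpM2r => //.
  exact: hC.
have hu : rn (cls p (u i)) <= 2 * q^-1.
  apply: (rn_cls_le (u_fin i)).
  apply: (@le_trans _ _ (LN F (fun t => 2 * r i t)%R)).
    apply: LN_le; [exact: LF_nnmeas (u_fin i)|exact: nnmeasZ (r_nnmeas i)|].
    by move=> t _; exact: r_ge.
  by rewrite (LNZ F (r i) (ler0n _ 2)) EFinM; apply: lee_wpmul2l; rewrite ?lee_fin.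
have := le_trans (phi_u i) (phi_bd (s i) (cls p (u i))); apply/negP; rewrite -ltNge.
apply: (@le_lt_trans _ _ (K1 * (2 * q^-1))); first by rewrite ler_wpM2l// ltW.
apply: (@le_lt_trans _ _ (K1 * (2 * (16 * K1)^-1))).
  rewrite ler_wpM2l ?(ltW K1_gt0)// ler_wpM2l// lef_pV2 ?posrE ?mulr_gt0//.
  by rewrite le_max lexx orbT.
rewrite (_ : K1 * (2 * (16 * K1)^-1) = 8^-1); last by field; rewrite gt_eqF.
by rewrite ltf_pV2 ?posrE// ltr_nat.
Qed.

Lemma block_weight_ge0 i (j : 'I_(J i)) : 0 <= block_weight j.
Proof.
by rewrite divr_ge0 ?block_mass_ge0// mulr_ge0// oreal_ge0.
Qed.

Lemma block_weight_sum i : \sum_(j < J i) block_weight j = 1.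
Proof.
have [m m0 hm] := block_mass_lower.
rewrite -mulr_suml divff// gt_eqF//; exact: lt_le_trans (hm i).
Qed.

Let rho n (a : nat -> K) t : R := \sum_(i < n) sabs (a i) * r i t.

Let rho_nnmeas n a : nnmeas (rho n a).
Proof.
apply: (nnmeas_sum (index_enum 'I_n) (g := fun (i : 'I_n) t => sabs (a i) * r i t)) => i.
by apply: nnmeasZ (r_nnmeas i); exact: sabs_ge0.
Qed.

(** For functions with disjoint supports the modular is additive. *)
Let modular_rho n a (tau : R) : 0 < tau ->
  LF_modular F (fun t => rho n a t / tau) =
  (\sum_(i < n) block_mass i * block_fun i (sabs (a i) / tau))%:E.
Proof.
move=> tau0; have [m m0 hm] := block_mass_lower.
rewrite /LF_modular.
have a0 i : 0 <= sabs (a i) / tau by rewrite divr_ge0 ?sabs_ge0// ltW.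
have pt t : F (rho n a t / tau) = (\sum_(i < n) F (sabs (a i) / tau * r i t)%R)%E.
  have -> : rho n a t / tau = \sum_(i < n) sabs (a i) / tau * r i t.
    by rewrite /rho mulr_suml; apply: eq_bigr => i _; rewrite mulrAC.
  apply: (@sum_single_orlicz (fun i : nat => sabs (a i) / tau * r i t) n).
  have nz i : sabs (a i) / tau * r i t != 0 -> A i t.
    by apply: contraNT => /negPf nA; rewrite /r nA mul0r mulr0.
  by move=> i j /nz hi /nz hj; exact: A_disj hj.
under eq_integral do rewrite pt.
rewrite ge0_integral_sum; [|exact: unit_measurable| |]; last 2 first.
- move=> i; apply: (measurable_orlicz_comp F (g := fun t => sabs (a i) / tau * r i t)).
  exact: nnmeasZ (r_nnmeas i).
- by move=> i t _; rewrite orlicz_ge0// mulr_ge0//; exact: (r_nnmeas i).1.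
rewrite -sumEFin; apply: eq_bigr => i _; rewrite integral_r// mass_fun//.
exact: lt_le_trans (hm i).
Qed.

Lemma block_norm_upper n (a : nat -> K) (tau : R) : 0 < tau ->
  \sum_(i < n) block_mass i * block_fun i (sabs (a i) / tau) <= 1 ->
  rn (\sum_(i < n) a i *: x (s i)) <= 8 * K0 * tau.
Proof.
move=> tau0 h; apply: le_trans (block_upper n a) _.
have -> : 8 * K0 * tau = 4 * K0 * (2 * tau) by ring.
apply: ler_wpM2l; first by rewrite mulr_ge0.
have fin2 := @sum_cls_fin n a u u_fin.
apply: (rn_cls_le fin2).
apply: (@le_trans _ _ (LN F (fun t => 2 * rho n a t)%R)).
  apply: (LN_le F (LF_nnmeas fin2) (nnmeasZ (ler0n _ 2) (rho_nnmeas n a))) => t _.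
  rewrite /smod sabs_usum /rho mulr_sumr; apply: ler_sum => i _.
  by rewrite mulrCA; apply: ler_wpM2l; [exact: sabs_ge0|exact: r_ge].
rewrite (LNZ F (rho n a) (ler0n _ 2)) EFinM; apply: lee_wpmul2l; first by rewrite lee_fin.
by apply: luxemburg_le => //; rewrite modular_rho// lee_fin.
Qed.

Lemma block_norm_lower n (a : nat -> K) (tau : R) :
  K0 * rn (\sum_(i < n) a i *: x (s i)) < tau ->
  \sum_(i < n) block_mass i * block_fun i (sabs (a i) / tau) <= 1.
Proof.
move=> h; have tau0 : 0 < tau by apply: le_lt_trans h; rewrite mulr_ge0// rn_ge0.
rewrite -lee_fin -modular_rho//.
apply: (LN_lt_modular (rho_nnmeas n a)).
have fin2 := @sum_cls_fin n a u u_fin.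
apply: (@le_lt_trans _ _ (rn (cls p (\sum_(i < n) a i *: u i)))%:E); last first.
  by rewrite lte_fin; exact: le_lt_trans (block_lower n a) h.
rewrite -(LNfin fin2); apply: (LN_le F (rho_nnmeas n a) (LF_nnmeas fin2)) => t _.
rewrite /smod sabs_usum; apply: ler_sum => i _.
by apply: ler_wpM2l; [exact: sabs_ge0|exact: r_le].
Qed.

End blocks.

(** * Choice of the blocks by a gliding hump *)

Section choice_of_blocks.
Hypothesis x_norm : forall i, rn (x i) < 1.
Hypothesis low_small : forall b : R, exists n,
  sabs (phi n (cls p (cut (fun t => sabs (f n t) <= b) (f n)))) < 2^-1.

Let gt i (b : R) t : bool := b < sabs (f i t).
Let hi i (b M : R) t : bool := (b < sabs (f i t)) && (sabs (f i t) <= M).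

Let f_meas i : measurable_fun I01 (fun t => sabs (f i t)) := (LF_nnmeas (f_fin i)).2.

Let gt_meas i b : measurable_fun I01 (gt i b).
Proof. by apply: measurable_fun_ltr => //; exact: measurable_cst. Qed.

Let hi_meas i b M : measurable_fun I01 (hi i b M).
Proof.
apply: measurable_and; first exact: gt_meas.
by apply: measurable_fun_ler => //; exact: measurable_cst.
Qed.

Let phi_cut_le i b (c : R) : measurable_fun I01 b ->
  (LN F (smod (cut b (f i))) <= c%:E)%E ->
  sabs (phi i (cls p (cut b (f i)))) <= K1 * c.
Proof.
move=> mb h; apply: le_trans (phi_bd i _) _; apply: ler_wpM2l; first exact: ltW.
exact: (rn_cls_le (cut_fin mb (f_fin i))).
Qed.

Let phi_cutD i (b b1 b2 : R -> bool) : measurable_fun I01 b1 -> measurable_fun I01 b2 ->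
  (forall t, (b t : nat) = (b1 t + b2 t)%N) ->
  phi i (cls p (cut b (f i))) =
  phi i (cls p (cut b1 (f i))) + phi i (cls p (cut b2 (f i))).
Proof.
move=> m1 m2 hb.
have -> : cut b (f i) = 1 *: cut b1 (f i) + cut b2 (f i).
  rewrite scale1r; apply/funext => t.
  by rewrite [RHS]/(cut b1 (f i) t + cut b2 (f i) t) /cut hb natrD mulrDl.
by rewrite (cls_lin 1 (cut_fin m1 (f_fin i)) (cut_fin m2 (f_fin i))) phi_lin mul1r.
Qed.

Let phi_tail i (e : R) : 0 < e -> exists M0 : R, forall M, M0 <= M ->
  sabs (phi i (cls p (cut (gt i M) (f i)))) <= e.
Proof.
move=> e0; have [/LF_finP[_ fl] fm] := (f_fin i, LF_nnmeas (f_fin i)).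
have [M0 h] := LN_tail finF decF fm fl (divr_gt0 e0 K1_gt0).
exists M0 => M /h hM; have := @phi_cut_le i (gt i M) (e / K1) (gt_meas i M).
rewrite [K1 * _]mulrC divfK ?gt_eqF//; apply.
rewrite (_ : smod _ = fun t => smod (f i) t * (M < smod (f i) t)%R%:R)//.
by apply/funext => t; rewrite /smod sabs_cut mulrC.
Qed.

(** Tails of finitely many functions are small simultaneously above a
    sufficiently high level. *)
Let phi_tails N (e b : R) : 0 < e -> exists2 B : R, b <= B & forall i M, (i < N)%N ->
  B <= M -> sabs (phi i (cls p (cut (gt i M) (f i)))) <= e.
Proof.
move=> e0; elim: N => [|N [B bB hB]]; first by exists b.
have [M0 hM] := phi_tail N e0; exists (Num.max B M0); first by rewrite le_max bB.
move=> i M; rewrite ltnS leq_eqVlt => /predU1P[->|iN]; rewrite ge_max => /andP[BM MM].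
  exact: hM.
exact: hB.
Qed.

(** Since the part of some x_n below the level B carries less than half of
    phi_n(x_n) = 1, the part above B carries more than 1/2, and cutting off
    its tail at a higher level M costs at most 1/12. This x_n comes late in
    the sequence, because the tails above B of the earlier ones are small. *)
Let next_block (b : R) N : exists q : nat * (R * R), [/\ (N <= q.1)%N, b <= q.2.1,
  q.2.1 <= q.2.2 & 3^-1 <= sabs (phi q.1 (cls p (cut (hi q.1 q.2.1 q.2.2) (f q.1))))].
Proof.
have e0 : 0 < (12^-1 : R) by rewrite invr_gt0.
have e2 : 2^-1 + 2^-1 = 1 :> R by field.
have e4 : 3^-1 <= 2^-1 - 12^-1 :> R by lra.
have [B bB hB] := phi_tails N b e0; have [n hn] := low_small B.
have [M BM hM] := phi_tails n.+1 B e0.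
have low_meas : measurable_fun I01 (fun t => sabs (f n t) <= B).
  by apply: measurable_fun_ler => //; exact: measurable_cst.
have split1 : phi n (x n) = phi n (cls p (cut (fun t => sabs (f n t) <= B) (f n))) +
    phi n (cls p (cut (gt n B) (f n))).
  have le_gt t : (xpredT t : nat) = ((sabs (f n t) <= B)%R + gt n B t)%N.
    by rewrite /gt; case: leP.
  rewrite -(@phi_cutD n xpredT _ _ low_meas (gt_meas n B) le_gt).
  by congr phi; congr cls; apply/funext => t; rewrite /cut mul1r.
have gtB : 2^-1 < sabs (phi n (cls p (cut (gt n B) (f n)))).
  have h1 : 1 = sabs (phi n (x n)) by rewrite phi_x eqxx sabs1.
  have h2 := sabsD (phi n (cls p (cut (fun t => sabs (f n t) <= B) (f n))))
    (phi n (cls p (cut (gt n B) (f n)))).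
  have h3 : 1 <= sabs (phi n (cls p (cut (fun t => sabs (f n t) <= B) (f n)))) +
      sabs (phi n (cls p (cut (gt n B) (f n)))).
    by rewrite {1}h1 split1; exact: h2.
  rewrite -(ltrD2l 2^-1) e2; apply: le_lt_trans h3 _.
  by rewrite ltrD2r.
have Nn : (N <= n)%N.
  rewrite leqNgt; apply/negP => nN; have := hB n B nN (lexx _).
  by move=> /(lt_le_trans gtB); rewrite ltf_pV2 ?posrE// ltr_nat.
exists (n, (B, M)); split; [exact: Nn|exact: bB|exact: BM|].
have split2 : phi n (cls p (cut (gt n B) (f n))) =
    phi n (cls p (cut (hi n B M) (f n))) + phi n (cls p (cut (gt n M) (f n))).
  apply: phi_cutD => // t; rewrite /hi /gt.
  by case: (leP (sabs (f n t)) M) => hf; rewrite ?andbT ?addn0// andbF (le_lt_trans BM hf).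
have h3 := sabsD (phi n (cls p (cut (hi n B M) (f n)))) (phi n (cls p (cut (gt n M) (f n)))).
have h4 := hM n M (ltnSn n) (lexx _).
have h5 : 2^-1 <= sabs (phi n (cls p (cut (hi n B M) (f n)))) +
    sabs (phi n (cls p (cut (gt n M) (f n)))).
  by apply: (le_trans (ltW gtB)); rewrite split2; exact: h3.
apply: (le_trans e4); rewrite lerBlDr; apply: (le_trans h5).
by rewrite lerD2l.
Qed.

(** Iterating [next_block] with rapidly increasing levels gives sets E_i where
    B_i < |x_(s i)| <= M_i. The indicator of E_i has norm at most 1 / B_i, so
    the union of the later E_j has norm at most 2 / (L M_i), and removing it
    from E_i changes phi by at most 2 K1 / L <= 1/12. What remains of the E_i
    is disjoint. *)
Lemma choose_blocks : exists (s : nat -> nat) (A : nat -> R -> bool) (l J : nat -> nat),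
  [/\ {homo s : i j / (i < j)%N}, forall i, measurable_fun I01 (A i),
      forall i j t, A i t -> A j t -> i = j,
      (forall i, (i < l i)%N) /\
      (forall i t, A i t -> (l i <= Num.truncn (sabs (f (s i) t)) < l i + J i)%N) &
      forall i, 4^-1 <= sabs (phi (s i) (cls p (cut (A i) (f (s i)))))].
Proof.
have e6 : 4^-1 <= 3^-1 - 12^-1 :> R by lra.
(* L is chosen for 2 K1 / L <= 1/12, and for M_i to grow at least
   geometrically *)
pose L := 24 * K1 + 2.
have L2 : 2 <= L by rewrite lerDr mulr_ge0// ltW.
have L0 : 0 < L by apply: lt_le_trans L2.
have /choice[g hg] : forall q : R * nat, exists q' : nat * (R * R),
    [/\ (q.2 <= q'.1)%N, q.1 <= q'.2.1, q'.2.1 <= q'.2.2 &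
        3^-1 <= sabs (phi q'.1 (cls p (cut (hi q'.1 q'.2.1 q'.2.2) (f q'.1))))].
  by move=> [b N]; exact: next_block.
pose fix st i := if i is j.+1 then g (L * (st j).2.2, (st j).1.+1) else g (1, 0%N).
pose s i := (st i).1; pose B i := (st i).2.1; pose M i := (st i).2.2.
have BM i : B i <= M i.
  by case: i => [|i]; [have [] := hg (1, 0%N)|have [] := hg (L * M i, (s i).+1)].
have phi_hi i : 3^-1 <= sabs (phi (s i) (cls p (cut (hi (s i) (B i) (M i)) (f (s i))))).
  by case: i => [|i]; [have [] := hg (1, 0%N)|have [] := hg (L * M i, (s i).+1)].
have s_inc : {homo s : i j / (i < j)%N}.
  apply: homo_ltn; first by move=> ? ? ?; exact: ltn_trans.
  by move=> i; have [] := hg (L * M i, (s i).+1).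
have BLM i : L * M i <= B i.+1 by have [] := hg (L * M i, (s i).+1).
have B0 : 1 <= B 0%N by have [] := hg (1, 0%N).
have B_ge i : i.+1%:R <= B i.
  elim: i => [//|i ih].
  have M1 : 1 <= M i by rewrite (le_trans _ (BM i))// (le_trans _ ih)// ler1n.
  apply: le_trans (BLM i); apply: (@le_trans _ _ (2 * M i)).
    rewrite -(addn1 i.+1) natrD mulr_natl mulr2n lerD// (le_trans ih)//.
  by rewrite ler_wpM2r// (le_trans ler01).
have B_gt0 i : 0 < B i by apply: lt_le_trans (B_ge i).
have M_gt0 i : 0 < M i by apply: lt_le_trans (BM i).
have B_geom i j : 2 ^+ j * B i <= B (i + j)%N.
  elim: j => [|j ih]; first by rewrite expr0 mul1r addn0.
  rewrite addnS exprS -mulrA; apply: le_trans (BLM _).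
  apply: ler_pM => //; last exact: le_trans ih (BM _).
  by rewrite mulr_ge0 ?exprn_ge0// ltW.
pose E i := hi (s i) (B i) (M i).
have E_meas i : measurable_fun I01 (E i) by exact: hi_meas.
have E_norm i : (LN F (fun t => (E i t)%:R) <= ((B i)^-1)%:E)%E.
  have En : nnmeas (fun t => (E i t)%:R : R).
    by split=> [t//|]; exact: measurable_nat_of_bool.
  apply: (@le_trans _ _ (LN F (fun t => (B i)^-1 * smod (f (s i)) t)%R)).
    have B1 : 0 <= (B i)^-1 by rewrite invr_ge0 ltW.
    apply: (LN_le F En (nnmeasZ B1 (LF_nnmeas (f_fin (s i))))) => t _.
    rewrite ler_pdivlMl// /smod /E /hi; have [h|h] := ltP (B i) (sabs (f (s i) t)).
      by case: (_ <= M i); rewrite ?mulr1 ?mulr0 ?sabs_ge0// ltW.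
    by rewrite mulr0 sabs_ge0.
  rewrite LNZ ?invr_ge0 ?(ltW (B_gt0 i))// (LNfin (f_fin (s i))) -EFinM lee_fin.
  by rewrite ler_piMr ?invr_ge0 ?(ltW (B_gt0 i))// ltW.
pose later i t : bool := `[< exists j, E (i.+1 + j)%N t >].
have later_meas i : measurable_fun I01 (later i).
  apply: (measurable_fun_bool true).
  rewrite (_ : _ `&` _ = \bigcup_j (I01 `&` (E (i.+1 + j)%N @^-1` [set true]))).
    by apply: bigcup_measurable => j _; apply: E_meas => //; exact: unit_measurable.
  apply/seteqP; split=> t /=.
    by move=> [It /asboolP[j Ej]]; exists j.
  by move=> [j _ [It Ej]]; split=> //; apply/asboolP; exists j.
have later_nn i : nnmeas (fun t => (later i t)%:R : R).
  by split=> [t//|]; exact: measurable_nat_of_bool.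
have later_norm i : (LN F (fun t => (later i t)%:R) <= (2 / (L * M i))%:E)%E.
  have hn m : nnmeas (fun t => \sum_(j < m) (E (i.+1 + j)%N t)%:R : R).
    apply: (nnmeas_sum (index_enum 'I_m) (g := fun (j : 'I_m) t => (E (i.+1 + j)%N t)%:R)) => j.
    by split=> [t//|]; exact: measurable_nat_of_bool.
  apply: (LN_fatou (later_nn i) hn).
  - by move=> m t _; rewrite big_ord_recr /= lerDl.
  - move=> t th _ th0 th1; have [/asboolP[j Ej]|nl] := boolP (later i t); last first.
      by exists 0%N; rewrite big_ord0 mulr0.
    exists j.+1; rewrite mulr1 big_ord_recr /= Ej (le_trans (ltW th1))// lerDr.
    by rewrite sumr_ge0.
  - by rewrite divr_ge0// mulr_ge0// ltW.
  move=> m.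
  apply: (le_trans (@LN_sum R F 'I_m (index_enum _) (fun j t => (E (i.+1 + j)%N t)%:R) _)).
    by move=> j; split=> [t//|]; exact: measurable_nat_of_bool.
  apply: (@le_trans _ _ (\sum_(j < m) ((L * M i)^-1 * (2^-1 ^+ j))%:E)%E).
    apply: lee_sum => j _; apply: le_trans (E_norm _) _; rewrite lee_fin.
    rewrite exprVn -invfM lef_pV2 ?posrE ?mulr_gt0 ?exprn_gt0//.
    apply: le_trans (B_geom i.+1 j); rewrite mulrC ler_wpM2l ?exprn_ge0//.
  rewrite sumEFin lee_fin -mulr_sumr mulrC; apply: ler_wpM2r.
    by rewrite invr_ge0 mulr_ge0 ?(ltW L0)// ltW.
  suff -> : \sum_(j < m) 2^-1 ^+ j = 2 - 2 * 2^-1 ^+ m :> R.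
    by rewrite gerBl mulr_ge0// exprn_ge0.
  elim: (m) => [|m' ih]; first by rewrite big_ord0 expr0 mulr1 subrr.
  by rewrite big_ord_recr /= ih exprS; field.
pose A i t := E i t && ~~ later i t.
have A_meas i : measurable_fun I01 (A i).
  by apply: measurable_and => //; exact: measurable_neg.
exists s, A, (fun i => Num.truncn (B i)), (fun i => (Num.truncn (M i)).+1).
split; [exact: s_inc|exact: A_meas| | |].
- move=> i j t /andP[Ei nli] /andP[Ej nlj].
  case: (ltngtP i j) => // [ij|ji].
    move/negP: nli; case; apply/asboolP; exists (j - i.+1)%N.
    by rewrite subnKC.
  move/negP: nlj; case; apply/asboolP; exists (i - j.+1)%N.
  by rewrite subnKC.
- split=> [i|i t /andP[/andP[Bf fM] _]].
    by rewrite truncn_gt_nat; exact: B_ge.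
  rewrite (le_truncn (ltW Bf)) addnS ltnS; apply: (leq_trans (le_truncn fM)).
  exact: leq_addl.
move=> i.
have m2 : measurable_fun I01 (fun t => E i t && later i t) by exact: measurable_and.
have split3 : phi (s i) (cls p (cut (E i) (f (s i)))) =
    phi (s i) (cls p (cut (A i) (f (s i)))) +
    phi (s i) (cls p (cut (fun t => E i t && later i t) (f (s i)))).
  by apply: phi_cutD => // t; rewrite /A; case: (E i t); case: (later i t).
have h6 : sabs (phi (s i) (cls p (cut (fun t => E i t && later i t) (f (s i))))) <=
    K1 * (2 / L).
  apply: phi_cut_le => //.
  have cn : nnmeas (smod (cut (fun t => E i t && later i t) (f (s i)))).
    exact: LF_nnmeas (cut_fin m2 (f_fin (s i))).
  apply: (@le_trans _ _ (LN F (fun t => M i * (later i t)%:R)%R)).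
    apply: (LN_le F cn (nnmeasZ (ltW (M_gt0 i)) (later_nn i))) => t _.
    rewrite /smod sabs_cut; case: (later i t); rewrite ?andbF ?mul0r ?mulr0// andbT mulr1.
    have [/andP[_ h]|] := boolP (E i t); first by rewrite mul1r.
    by rewrite mul0r ltW.
  rewrite (LNZ F (fun t => (later i t)%:R) (ltW (M_gt0 i))).
  apply: (@le_trans _ _ ((M i)%:E * (2 / (L * M i))%:E)%E).
    by apply: lee_wpmul2l; [rewrite lee_fin ltW|exact: later_norm].
  rewrite -EFinM lee_fin le_eqVlt; apply/orP; left; apply/eqP; field.
  by have Mi := M_gt0 i; rewrite !gt_eqF.
have h7 : K1 * (2 / L) <= 12^-1.
  rewrite mulrA ler_pdivrMr// ler_pdivlMl// mulrA.
  have -> : 12 * K1 * 2 = 24 * K1 by ring.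
  by rewrite /L lerDl.
have h8 := sabsD (phi (s i) (cls p (cut (A i) (f (s i)))))
  (phi (s i) (cls p (cut (fun t => E i t && later i t) (f (s i))))).
have h9 : 3^-1 <= sabs (phi (s i) (cls p (cut (A i) (f (s i))))) +
    sabs (phi (s i) (cls p (cut (fun t => E i t && later i t) (f (s i))))).
  by apply: (le_trans (phi_hi i)); rewrite split3; exact: h8.
apply: (le_trans e6); rewrite lerBlDr; apply: (le_trans h9).
by rewrite lerD2l; exact: le_trans h6 h7.
Qed.

End choice_of_blocks.

(** * A subsequence equivalent to the basis of l_G *)

(** The functions H_i of the blocks have a limit g in C_F, and along a further
    subsequence q they approach it fast enough for the modulars to be
    comparable. *)
Lemma block_subsequence : (forall i, rn (x i) < 1) ->
  (forall b : R, exists n,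
    sabs (phi n (cls p (cut (fun t => sabs (f n t) <= b) (f n)))) < 2^-1) ->
  exists g, CF F g /\ exists G : orlicz R, affine_extension g G /\
  exists2 s : nat -> nat, {homo s : i j / (i < j)%N} &
  exists2 D : R, 0 <= D & forall n (a : nat -> K),
    rn (\sum_(i < n) a i *: x (s i)) <= D * fine (lG_norm G (trunc n a)) /\
    fine (lG_norm G (trunc n a)) <= D * rn (\sum_(i < n) a i *: x (s i)).
Proof.
move=> x_norm low_small.
have [s [A [l [J [s_inc A_meas A_disj [l_gt A_lev] phi_u]]]]] :=
  choose_blocks x_norm low_small.
have l_gt0 i : (0 < l i)%N by apply: leq_ltn_trans (l_gt i).
pose H := block_fun s A l J.
have lev_ge1 i (j : 'I_(J i)) : 1 <= (l i + j)%:R :> R.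
  by rewrite ler1n (leq_trans (l_gt0 i))// leq_addr.
have w1 := block_weight_sum A_meas l_gt0 A_lev phi_u.
have rcH i : ray_convex (H i).
  apply: hull_ray => [j||j]; [exact: block_weight_ge0|exact: w1|].
  exact: (dilate_ray finF decF (lev_ge1 i j)).
have ucH i := ray_unit_convex (rcH i).
have [g hg] := cluster_function ucH.
have ucg := cluster_unit_convex ucH hg.
have gCF : CF F g.
  apply: CF_limit => // b e e0.
  have [n bn hn] := cluster_uniform ucH hg (Num.truncn b).+1 (divr_gt0 e0 (ltr0Sn R 1)).
  exists (H n); last first.
    by move=> t t02; apply: le_lt_trans (hn t t02) _; rewrite ltr_pdivrMr// ltr_pMr// ltr1n.
  exists (J n), (block_weight s A l (J := J) (i := n)), (fun j => dilate F (l n + j)%:R).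
  split=> [j||j|]; [exact: block_weight_ge0|exact: w1| |by []].
  exists (l n + j)%:R => //; split.
    apply: lt_le_trans (truncnS_gt b) _; rewrite ler_nat.
    by apply: leq_trans bn _; apply: leq_trans (ltnW (l_gt n)) _; rewrite leq_addr.
  have j1 := lev_ge1 n j; rewrite (orealE finF) ?lte_fin; last exact: le_trans j1.
  exact: (oreal_gt0 finF decF j1).
exists g; split=> //.
exists (ray_orlicz (affine_ext_ray ucg)); split; first exact: affine_extension_ray.
have [n N|q q_inc hq] := @increasing_choice
    (fun i n => forall t, 0 <= t <= 2^-1 -> `|H n t - g t| <= 2 ^- i.+2).
  by have [|n' Nn' hn'] := cluster_uniform ucH hg N (e := 2 ^- n.+2);
    [rewrite invr_gt0 exprn_gt0|exists n'].
exists (s \o q); first by move=> i j /q_inc; exact: s_inc.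
have [m m0 hm] := block_mass_lower A_meas l_gt0 A_lev phi_u.
have sq_inc : {homo s \o q : i j / (i < j)%N} by move=> i j /q_inc; exact: s_inc.
have q_inj : injective q.
  move=> i j qij; case: (ltngtP i j) => // /q_inc; rewrite qij ltnn //.
have Aq_disj i j t : A (q i) t -> A (q j) t -> i = j by move=> /A_disj h /h/q_inj.
(* passing to the subsequence q of the blocks commutes with all constructions
   *)
have massE i : block_mass (s \o q) (A \o q) (l \o q) (J \o q) i =
  block_mass s A l J (q i) by [].
have funE i t : block_fun (s \o q) (A \o q) (l \o q) (J \o q) i t = H (q i) t by [].
have sumE n (c : nat -> R) : \sum_(i < n) block_mass (s \o q) (A \o q) (l \o q) (J \o q) i *
    block_fun (s \o q) (A \o q) (l \o q) (J \o q) i (c i) =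
    \sum_(i < n) block_mass s A l J (q i) * H (q i) (c i).
  by apply: eq_bigr => i _; rewrite massE funE.
pose y i : LF k F := x (s (q i)).
have up n (a : nat -> K) tau : 0 < tau ->
    \sum_(i < n) block_mass s A l J (q i) * H (q i) (sabs (a i) / tau) <= 1 ->
    rn (\sum_(i < n) a i *: y i) <= 8 * K0 * tau.
  rewrite -(sumE n (fun i => sabs (a i) / tau)).
  exact: (block_norm_upper sq_inc
    (fun i => A_meas (q i)) Aq_disj (fun i => l_gt0 (q i)) (fun i => A_lev (q i))
    (fun i => phi_u (q i))).
have lo n (a : nat -> K) tau : K0 * rn (\sum_(i < n) a i *: y i) < tau ->
    \sum_(i < n) block_mass s A l J (q i) * H (q i) (sabs (a i) / tau) <= 1.
  rewrite -(sumE n (fun i => sabs (a i) / tau)).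
  exact: (block_norm_lower sq_inc
    (fun i => A_meas (q i)) Aq_disj (fun i => l_gt0 (q i)) (fun i => A_lev (q i))
    (fun i => phi_u (q i))).
have mass1 i := block_mass_le1 A_meas A_lev x_norm (q i).
have L0 : 0 <= 8 * K0 by rewrite mulr_ge0.
exact: (orlicz_sequence_norm (y := y) (H := fun i => H (q i)) (w := fun i => block_mass s A l J (q i))
  (fun i => rcH (q i)) ucg hq m0 (fun i => hm (q i)) mass1 K0_ge0 L0 up lo).
Qed.

End system.

(** * The dichotomy *)

Theorem theorem6p5 (R : realType) (k : scalar_kind) (F : orlicz R)
    (finF : finite_orlicz F)
    (decF : essentially_decreasing (fun t : R => fine (F t) * t ^- 2))
    (x : nat -> LF k F)
    (basic_x : basic_sequence x) (compl_x : complemented x)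
    (subsym_x : subsymmetric x) :
  equivalent x (@l2_unit R k) \/
  exists g : R -> R, CF F g /\
    exists G : orlicz R, affine_extension g G /\ equivalent x (lG_unit k G).
Proof.
have [unc_x spr_x] := subsym_x.
have cV : series_complete (LF k F) := LF_series_complete finF decF.
have [phi [C C0 [phi_lin phi_x phi_cvg phi_unc]]] :=
  unconditional_coordinates cV basic_x compl_x unc_x.
have phi0 i : phi i 0 = 0 := functional0 (phi_lin i).
have phiZ i a v : phi i (a *: v) = a * phi i v := functionalZ a v (phi_lin i).
have phi_part n v : rn (\sum_(i < n) phi i v *: x i) <= C * rn v.
  have := phi_unc (iota 0 n) (fun=> false) v (iota_uniq _ _).
  by under eq_bigr do rewrite expr0 scale1r; rewrite -[n in iota 0 n]subn0 -/(index_iota 0 n) big_mkord.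
have x_neq0 n : x n != 0.
  apply/eqP => xn0; have := phi_x n n; rewrite xn0 eqxx phi0.
  by move/eqP; rewrite eq_sym oner_eq0.
have [c [B [c0 cx xB]]] := spreading_seminormalized x_neq0 spr_x.
have B0 : 0 < B by apply: lt_le_trans c0 (le_trans (cx 0%N) (xB 0%N)).
(* the system is rescaled by M, so that all its terms have norm less than 1 *)
have [M [M0 BM]] : exists M : R, 0 < M /\ B < M.
  by exists (2 * B); rewrite mulr_gt0// ltr_pMl// ltr1n.
have MK : sreal M * sreal M^-1 = 1 :> scalar R k.
  by rewrite -srealM divff ?gt_eqF// sreal1.
have sM (r : R) : 0 <= r -> sabs (sreal r : scalar R k) = r.
  by move=> r0; rewrite sabs_sreal ger0_norm.
have /choice[f hf] : forall i, exists h : R -> scalar R k,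
    h \in finite_part (LF_eseminorm k F) /\ sreal M^-1 *: x i = cls (LF_eseminorm k F) h.
  by move=> i; have [u u_fin u_eq] := cls_rep (sreal M^-1 *: x i : LF k F); exists u.
have f_fin i : f i \in finite_part (LF_eseminorm k F) by case: (hf i).
pose y i : LF k F := cls (LF_eseminorm k F) (f i).
have yE i : y i = sreal M^-1 *: x i by case: (hf i).
pose psi i v := sreal M * phi i v.
have psi_lin i a u v : psi i (a *: u + v) = a * psi i u + psi i v.
  by rewrite /psi phi_lin mulrDr mulrCA.
have psi_y i j : psi i (y j) = (i == j)%:R by rewrite /psi yE phiZ mulrA MK mul1r phi_x.
have psi_term i v : psi i v *: y i = phi i v *: x i.
  by rewrite /psi yE scalerA mulrAC MK mul1r.
have psi_unc (A : seq nat) (e : nat -> bool) v : uniq A ->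
    rn (\sum_(i <- A) (-1) ^+ (e i) *: (psi i v *: y i)) <= C * rn v.
  by move=> uA; under eq_bigr do rewrite psi_term; exact: phi_unc.
pose K1 := M * C / c + 1.
have K1_gt0 : 0 < K1 by rewrite ltr_wpDl// divr_ge0 ?(ltW c0)// mulr_ge0// ltW.
have psi_bd i v : sabs (psi i v) <= K1 * rn v.
  have := phi_unc [:: i] (fun=> false) v isT.
  rewrite big_seq1 expr0 scale1r rnZ => h.
  have h2 : sabs (phi i v) * c <= C * rn v.
    by apply: le_trans h; rewrite ler_wpM2l ?sabs_ge0.
  rewrite /psi sabsM sM ?(ltW M0)//.
  apply: (@le_trans _ _ (M * C / c * rn v)).
    have -> : M * C / c * rn v = M * (C * rn v / c) by ring.
    by rewrite ler_wpM2l ?(ltW M0)// ler_pdivlMr.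
  by rewrite ler_wpM2r ?rn_ge0// lerDl.
have y_norm i : rn (y i) < 1.
  rewrite yE rnZ sM ?invr_ge0 ?(ltW M0)// mulrC ltr_pdivrMr// mul1r.
  exact: le_lt_trans (xB i) BM.
have y_sum n (a : nat -> scalar R k) (s : nat -> nat) :
    rn (\sum_(i < n) a i *: x (s i)) = M * rn (\sum_(i < n) a i *: y (s i)).
  rewrite -{1}(sM M (ltW M0)) -rnZ scaler_sumr; congr rn; apply: eq_bigr => i _.
  by rewrite yE !scalerA mulrCA MK mulr1.
have [[b b0 hb]|nb] := pselect (exists2 b : R, 0 < b & forall i, 2^-1 <=
    sabs (psi i (cls (LF_eseminorm k F) (cut (fun t => sabs (f i t) <= b) (f i))))).
  left.
  have [D D0 hD] := l2_equivalence finF decF f_fin psi_lin psi_y psi_unc C0 K1_gt0 psi_bd b0 hb.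
  have E0 : 0 <= M * D + D / M by rewrite addr_ge0 ?mulr_ge0 ?invr_ge0// ltW.
  refine (equivalent_unit_basis (p := @l2_eseminorm R k) erefl (@unit_seq_l2 R k)
    (fun n a => l2_trunc_le n a) (fun a r => @l2_fatou R k a r) cV phi_lin phi_x phi_cvg phi_part C0 E0 _ _).
  - move=> n a; rewrite [p in fine p]l2_trunc /= (y_sum n a id).
    have [h _] := hD n a.
    apply: (@le_trans _ _ (M * D * Num.sqrt (\sum_(i < n) sabs (a i) ^+ 2))).
      by rewrite -mulrA ler_wpM2l// ltW.
    by rewrite ler_wpM2r ?sqrtr_ge0// lerDl divr_ge0// ltW.
  - move=> n a; rewrite [p in fine p]l2_trunc /= (y_sum n a id).
    have [_ h] := hD n a; apply: le_trans h _.
    rewrite mulrA ler_wpM2r ?rn_ge0// mulrDl divfK ?gt_eqF// lerDr.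
    by rewrite !mulr_ge0// ltW.
right.
(* a nonpositive level gives a zero part, hence a zero coordinate *)
have low_small (b : R) : exists n, sabs (psi n (cls (LF_eseminorm k F)
    (cut (fun t => sabs (f n t) <= b) (f n)))) < 2^-1.
  have [b0|b0] := ltP 0 b.
    have /existsNP[n /negP hn] : ~ forall i, 2^-1 <=
        sabs (psi i (cls (LF_eseminorm k F) (cut (fun t => sabs (f i t) <= b) (f i)))).
      by move=> h; apply: nb; exists b.
    by exists n; rewrite ltNge.
  exists 0%N.
  have -> : cut (fun t => sabs (f 0%N t) <= b) (f 0%N) = 0.
    apply/funext => t; rewrite /cut /=; have [h|] := boolP (sabs (f 0%N t) <= b);
      rewrite ?mul0r// mul1r; apply/eqP.
    rewrite -sabs_eq0 eq_le sabs_ge0 andbT; exact: le_trans b0.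
  by rewrite cls0 /psi phi0 mulr0 sabs0 invr_gt0.
have [g [gCF [G [gG [s s_inc [D D0 hD]]]]]] := block_subsequence finF decF f_fin psi_lin psi_y
  psi_unc C0 K1_gt0 psi_bd y_norm low_small.
exists g; split=> //; exists G; split=> //.
have [Ca Ca0 hCa] := equivalent_bound (spr_x s s_inc).
have [Cb Cb0 hCb] := equivalent_bound (equivalent_sym (spr_x s s_inc)).
have E0 : 0 <= Cb * (M * D) + D / M * Ca.
  by rewrite addr_ge0 ?mulr_ge0 ?invr_ge0// ltW.
refine (equivalent_unit_basis (p := lG_eseminorm k G) erefl (@unit_seq_lG R k G)
  (fun n a => lG_trunc_le G n a) (fun a r => @lG_fatou R k G a r)
  cV phi_lin phi_x phi_cvg phi_part C0 E0 _ _) => n a.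
- have [h _] := hD n a; apply: le_trans (hCb n a) _.
  rewrite /= (y_sum n a s); set N := fine _.
  have N0 : 0 <= N by apply: fine_ge0; exact: lG_norm_ge0.
  apply: (@le_trans _ _ (Cb * (M * D) * N)).
    rewrite -!mulrA; apply: (ler_wpM2l (ltW Cb0)); apply: (ler_wpM2l (ltW M0)); exact: h.
  by rewrite ler_wpM2r// lerDl mulr_ge0 ?divr_ge0// ltW.
- have [_ h] := hD n a; apply: le_trans h _.
  have h2 : M * rn (\sum_(i < n) a i *: y (s i)) <= Ca * rn (\sum_(i < n) a i *: x i).
    by rewrite -y_sum; exact: hCa.
  rewrite mulrC -ler_pdivlMr// in h2.
  apply: (@le_trans _ _ (D / M * Ca * rn (\sum_(i < n) a i *: x i))).
    have -> : D / M * Ca * rn (\sum_(i < n) a i *: x i) =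
      D * (Ca * rn (\sum_(i < n) a i *: x i) / M) by ring.
    by rewrite ler_wpM2l.
  by rewrite ler_wpM2r ?rn_ge0// lerDr !mulr_ge0// ltW.
Qed.
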